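(* Let $\kappa$ be a positive integer, $m>0$, $\lambda>2\kappa$, $0<\alpha\le m(\lambda-2\kappa)$, and $1<p_1,\dots,p_\kappa<\infty$ with $\frac1p=\frac1{p_1}+\cdots+\frac1{p_\kappa}$. Let $\mu$ be a power bounded measure on $\mathbb{R}^n$ with exponent $m$, and let $(s_t)_{t>0}$ be a family of kernels satisfying the size and Hölder conditions with exponent $\alpha$. Let $\beta>0$ and $\mathfrak{C}>0$ be big enough numbers depending only on the dimension $n$ (that is, exceeding certain thresholds depending only on $n$), and let $\theta\in(0,1)$. Suppose that for each $(2,\beta)$-doubling cube $Q$ with $\mathfrak{C}$-small boundary (both with respect to $\mu$) there exists a subset $G_Q\subset Q$ such that $\mu(G_Q)\ge\theta\,\mu(Q)$ and $$g^*_\lambda:\mathfrak{M}(\mathbb{R}^n)\times\cdots\times\mathfrak{M}(\mathbb{R}^n)\to L^{\frac1\kappa,\infty}(\mu\lfloor G_Q)$$ is bounded with a constant independent of $Q$. Then there is a finite constant $C$ such that $$\big\|g^*_{\lambda,\mu}(f_1,\dots,f_\kappa)\big\|_{L^p(\mu)}\le C\prod_{i=1}^\kappa\|f_i\|_{L^{p_i}(\mu)}$$ for all $f_i\in L^{p_i}(\mu)$, $i=1,\dots,\kappa$.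
   Context: A Borel measure $\mu$ on $\mathbb{R}^n$ is power bounded with exponent $m>0$ if there is a constant $C$ with $\mu(B(x,r))\le C r^m$ for all $x\in\mathbb{R}^n$, $r>0$. $\mathfrak{M}(\mathbb{R}^n)$ is the space of complex Borel measures on $\mathbb{R}^n$ with the total variation norm $\|\nu\|=|\nu|(\mathbb{R}^n)$; $\mu\lfloor G$ is the restriction of $\mu$ to $G$. Kernels: for each $t>0$, $s_t:(\mathbb{R}^n)^{\kappa+1}\to\mathbb{C}$ (measurable, so that the integrals below make sense). For some constant $C$ independent of $t$ and of the points, with $\vec y=(y_1,\dots,y_\kappa)$: Size condition: $|s_t(x,\vec y)|\le C\,\dfrac{t^{\kappa\alpha}}{\prod_{i=1}^\kappa(t+|x-y_i|)^{m+\alpha}}$. Hölder conditions: $|s_t(x,\vec y)-s_t(x',\vec y)|\le C\,\dfrac{t^{(\kappa-1)\alpha}|x-x'|^\alpha}{\prod_{i=1}^\kappa(t+|x-y_i|)^{m+\alpha}}$ whenever $|x-x'|<t/2$; and, for each $1\le i\le\kappa$, $|s_t(x,\vec y)-s_t(x,y_1,\dots,y_i',\dots,y_\kappa)|\le C\,\dfrac{t^{(\kappa-1)\alpha}|y_i-y_i'|^\alpha}{\prod_{i=1}^\kappa(t+|x-y_i|)^{m+\alpha}}$ whenever $|y_i-y_i'|<t/2$. For $\vec\nu=(\nu_1,\dots,\nu_\kappa)\in\mathfrak{M}(\mathbb{R}^n)^\kappa$ define $$\Theta_t(\vec\nu)(y)=\int_{(\mathbb{R}^n)^\kappa}s_t(y,z_1,\dots,z_\kappa)\,d\nu_1(z_1)\cdots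 d\nu_\kappa(z_\kappa),$$ $$g^*_\lambda(\vec\nu)(x)=\Big(\int_0^\infty\!\!\int_{\mathbb{R}^n}\Big(\frac{t}{t+|x-y|}\Big)^{m\lambda}|\Theta_t(\vec\nu)(y)|^2\frac{d\mu(y)\,dt}{t^{m+1}}\Big)^{1/2},$$ and for functions $\vec f=(f_1,\dots,f_\kappa)$ define $g^*_{\lambda,\mu}(\vec f)$ by the same formula with $\Theta_t(\vec\nu)$ replaced by $\Theta_t^\mu(\vec f)(y)=\int_{(\mathbb{R}^n)^\kappa}s_t(y,\vec z)\prod_{i=1}^\kappa f_i(z_i)\,d\mu(z_1)\cdots d\mu(z_\kappa)$. Boundedness of $g_\lambda^*$ into $L^{\frac1\kappa,\infty}(\mu\lfloor G_Q)$ with constant $A$ means $\sup_{\zeta>0}\zeta\,\mu(\{x\in G_Q:g^*_\lambda(\vec\nu)(x)>\zeta\})^{\kappa}\le A\prod_{i=1}^\kappa\|\nu_i\|$ for all $\nu_i\in\mathfrak{M}(\mathbb{R}^n)$. For $a,b>1$, a cube $Q$ is $(a,b)$-doubling for $\mu$ if $\mu(aQ)\le b\,\mu(Q)$, where $aQ$ is the concentric dilate. For $\mathfrak{C}>0$, $Q$ has $\mathfrak{C}$-small boundary with respect to $\mu$ if $\mu(\{x\in2Q:\operatorname{dist}(x,\partial Q)\le\xi\,\ell(Q)\})\le\mathfrak{C}\,\xi\,\mu(2Q)$ for every $\xi>0$, where $\ell(Q)$ is the side length of $Q$. *)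

(* Defs.v *)
From HB Require Import structures.
From mathcomp Require Import all_boot all_order all_algebra.
From mathcomp Require Import complex.
From mathcomp Require Import all_classical all_reals all_analysis.

Set Implicit Arguments.
Unset Strict Implicit.
Unset Printing Implicit Defensive.

Import Order.TTheory GRing.Theory Num.Theory.
Import numFieldNormedType.Exports.

Local Open Scope classical_set_scope.
Local Open Scope ring_scope.
Local Open Scope complex_scope.

Notation cmod := ComplexField.Normc.normc.

(* R^n with its Borel sigma-algebra. The library topology on matrices comes
   from the sup norm, which has the same open sets as the Euclidean norm. *)
Definition Rn (R : realType) (n : nat) : Type :=
  g_sigma_algebraType (@open 'rV[R]_n).

Section geometry.
Context {R : realType} {n : nat}.
Implicit Types (x y c : Rn R n) (A : set (Rn R n)).

Definition eucl_dist x y : R :=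
  Num.sqrt (\sum_(i < n) ((x : 'rV[R]_n) 0 i - (y : 'rV[R]_n) 0 i) ^+ 2).

Definition eball x (r : R) : set (Rn R n) := [set y | eucl_dist x y < r].

Definition dist_set x A : R := inf [set eucl_dist x y | y in A].

Definition boundary A : set (Rn R n) :=
  closure (A : set 'rV[R]_n) `\` interior (A : set 'rV[R]_n).

(* Closed, axis-parallel, of centre c and side length l; the concentric dilate
   aQ of Q = cube c l is cube c (a * l). *)
Definition cube c (l : R) : set (Rn R n) :=
  [set x | forall i : 'I_n,
     `|(x : 'rV[R]_n) 0 i - (c : 'rV[R]_n) 0 i| <= l / 2].

Variable mu : {measure set (Rn R n) -> \bar R}.

Definition power_bounded (m : R) : Prop :=
  exists C : R, forall (x : Rn R n) (r : R),
    0 < r -> (mu (eball x r) <= (C * r `^ m)%:E)%E.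

Definition doubling (a b : R) c (l : R) : Prop :=
  (mu (cube c (a * l)) <= b%:E * mu (cube c l))%E.

Definition small_boundary (C : R) c (l : R) : Prop :=
  forall xi : R, 0 < xi ->
    (mu [set x | cube c (2 * l) x /\ (dist_set x (boundary (cube c l)) <= xi * l)%R]
      <= (C * xi)%:E * mu (cube c (2 * l)))%E.

End geometry.

Section complex_integration.
Context {d : measure_display} {T : measurableType d} {R : realType}.

Definition cmeasurable_fun (D : set T) (f : T -> R[i]) : Prop :=
  measurable_fun D (fun x => complex.Re (f x)) /\
  measurable_fun D (fun x => complex.Im (f x)).

Definition complexify (I : (T -> R) -> R) (f : T -> R[i]) : R[i] :=
  I (fun x => complex.Re (f x)) +i* I (fun x => complex.Im (f x)).

Definition cintegral (mu : {measure set T -> \bar R}) : (T -> R[i]) -> R[i] :=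
  complexify (Rintegral mu setT).

Section charge_integral.
Variable nu : {charge set T -> \bar R}.

Definition hahn_pos : set T := sval (cid (Hahn_decomposition nu)).
Definition hahn_neg : set T := sval (cid (svalP (cid (Hahn_decomposition nu)))).

Lemma hahn_posneg : hahn_decomposition nu hahn_pos hahn_neg.
Proof. exact: svalP (cid (svalP (cid (Hahn_decomposition nu)))). Qed.

Definition charge_integral (h : T -> R) : R :=
  Rintegral (jordan_pos hahn_posneg) setT h
  - Rintegral (jordan_neg hahn_posneg) setT h.

End charge_integral.

(* A complex measure, given by its real and imaginary parts; charges of the
   library are finite-valued on measurable sets. *)
Record complex_measure := ComplexMeasure {
  re_measure : {charge set T -> \bar R};
  im_measure : {charge set T -> \bar R} }.

Definition cmeasure_val (nu : complex_measure) (A : set T) : R[i] :=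
  fine (re_measure nu A) +i* fine (im_measure nu A).

Definition cmeasure_integral (nu : complex_measure) (f : T -> R[i]) : R[i] :=
  complexify (charge_integral (re_measure nu)) f
  + 'i%C * complexify (charge_integral (im_measure nu)) f.

Definition cvariation (nu : complex_measure) (A : set T) : \bar R :=
  ereal_sup [set (\sum_(0 <= k <oo) (cmod (cmeasure_val nu (F k)))%:E)%E
            | F in [set F : (set T)^nat |
                [/\ (forall k, measurable (F k)), trivIset setT F &
                    \bigcup_k F k = A]]].

Definition cmeasure_norm (nu : complex_measure) : \bar R := cvariation nu setT.

Definition cLnorm (mu : {measure set T -> \bar R}) (p : R) (f : T -> R[i])
    : \bar R :=
  Lnorm mu p%:E (fun x => (cmod (f x))%:E).

Definition in_cLp (mu : {measure set T -> \bar R}) (p : R) (f : T -> R[i])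
    : Prop :=
  cmeasurable_fun setT f /\ (cLnorm mu p f < +oo)%E.

End complex_integration.
Arguments complex_measure {d} T R.

(* Integral over T^k against a product, as an iterated integral: I i is
   integration against the i-th factor. *)
Fixpoint iterated_integral (T U : Type) (k : nat) :
    ('I_k -> (T -> U) -> U) -> (k.-tuple T -> U) -> U :=
  match k with
  | 0 => fun _ F => F [tuple]
  | k'.+1 => fun I F =>
      I ord0 (fun z => iterated_integral (fun i => I (lift ord0 i))
                         (fun zs : k'.-tuple T => F [tuple of z :: zs]))
  end.

Section kernels.
Context {R : realType} {n kappa : nat}.
Local Notation kernel := (R -> Rn R n -> kappa.-tuple (Rn R n) -> R[i]).
Implicit Type s : kernel.

Definition replace_coord (i : 'I_kappa) (z : Rn R n) (y : kappa.-tuple (Rn R n)) :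
    kappa.-tuple (Rn R n) :=
  [tuple if j == i then z else tnth y j | j < kappa].

(* Joint measurability in (t, x, y): the square functions integrate in t too. *)
Definition kernel_measurable s : Prop :=
  cmeasurable_fun
    [set q : measurableTypeR R * Rn R n * kappa.-tuple (Rn R n) | 0 < q.1.1]
    (fun q => s q.1.1 q.1.2 q.2).

Definition kernel_denom (m alpha t : R) (x : Rn R n)
    (y : kappa.-tuple (Rn R n)) : R :=
  \prod_(i < kappa) (t + eucl_dist x (tnth y i)) `^ (m + alpha).

Definition size_condition (m alpha C : R) s : Prop :=
  forall (t : R) (x : Rn R n) (y : kappa.-tuple (Rn R n)), 0 < t ->
    cmod (s t x y) <=
      C * (t `^ (kappa%:R * alpha) / kernel_denom m alpha t x y).

Definition holder_condition_x (m alpha C : R) s : Prop :=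
  forall (t : R) (x x' : Rn R n) (y : kappa.-tuple (Rn R n)), 0 < t ->
    eucl_dist x x' < t / 2 ->
    cmod (s t x y - s t x' y) <=
      C * (t `^ ((kappa%:R - 1) * alpha) * eucl_dist x x' `^ alpha
           / kernel_denom m alpha t x y).

Definition holder_condition_y (m alpha C : R) s : Prop :=
  forall (t : R) (x : Rn R n) (y : kappa.-tuple (Rn R n)) (i : 'I_kappa)
      (y' : Rn R n), 0 < t ->
    eucl_dist (tnth y i) y' < t / 2 ->
    cmod (s t x y - s t x (replace_coord i y' y)) <=
      C * (t `^ ((kappa%:R - 1) * alpha) * eucl_dist (tnth y i) y' `^ alpha
           / kernel_denom m alpha t x y).

Definition kernel_conditions (m alpha : R) s : Prop :=
  exists C : R, [/\ size_condition m alpha C s, holder_condition_x m alpha C s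
                  & holder_condition_y m alpha C s].

Definition Theta s (nu : 'I_kappa -> complex_measure (Rn R n) R)
    (t : R) (y : Rn R n) : R[i] :=
  iterated_integral (fun i => cmeasure_integral (nu i)) (s t y).

Definition Theta_mu s (mu : {measure set (Rn R n) -> \bar R})
    (f : 'I_kappa -> Rn R n -> R[i]) (t : R) (y : Rn R n) : R[i] :=
  iterated_integral (fun i : 'I_kappa => cintegral mu)
    (fun z => s t y z * \prod_(i < kappa) f i (tnth z i)).

(* The g*_lambda formula with Th in place of Theta; the values may be +oo. *)
Definition square_function (mu : {measure set (Rn R n) -> \bar R})
    (m lambda : R) (Th : R -> Rn R n -> R[i]) (x : Rn R n) : \bar R :=
  ((\int[lebesgue_measure]_(t in `]0%R, +oo[%classic) \int[mu]_y
      ((t / (t + eucl_dist x y)) `^ (m * lambda) * cmod (Th t y) ^+ 2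
       / t `^ (m + 1))%:E) `^ 2^-1)%E.

Definition gstar mu (m lambda : R) s nu : Rn R n -> \bar R :=
  square_function mu m lambda (Theta s nu).

Definition gstar_mu mu (m lambda : R) s f : Rn R n -> \bar R :=
  square_function mu m lambda (Theta_mu s mu f).

Definition weak_bounded (mu : {measure set (Rn R n) -> \bar R})
    (m lambda : R) s (G : set (Rn R n)) (A : R) : Prop :=
  forall nu : 'I_kappa -> complex_measure (Rn R n) R,
    (ereal_sup [set zeta%:E
        * mu [set x | G x /\ zeta%:E < gstar mu m lambda s nu x] ^+ kappa
      | zeta in [set zeta : R | (0 < zeta)%R]]
      <= A%:E * \prod_(i < kappa) cmeasure_norm (nu i))%E.

End kernels.

(* Main.v *)
(* Pointwise, Theta_t is dominated by a product of Poisson-type averages of the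
   f_i, so g*_lambda truncated to e <= t <= 1/e is at most a constant depending
   on e times the product of dyadic-type maximal functions of the f_i; these are
   bounded on L^(p_i), which makes all the quantities below finite.
   Let Om be the open set where the truncated function exceeds zeta, cut into
   Whitney cubes.  For x in a Whitney cube of side l, comparing with a point
   outside Om at distance ~ l and discarding the part of the f_i at distance
   >= l from x costs only a multiple of the product of maximal functions at x.
   What remains is g*_lambda of the measures f_i 1_A mu with A ~ the cube: if the
   cube is doubling, a slight dilate of it also has small boundary, and the weak
   type hypothesis controls this term on the set G.  The cubes that are not
   doubling carry at most half of mu(Om), by bounded overlap.  This is a
   good-lambda inequality with a factor < 1 independent of e; integrating it
   against powers of zeta gives the L^p bound, and e tends to 0. *)

Require Import Defs.
From HB Require Import structures.
From mathcomp Require Import all_boot all_order all_algebra.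
From mathcomp Require Import complex.
From mathcomp Require Import all_classical all_reals all_analysis.
From mathcomp Require Import measurable_realfun.
From mathcomp Require Import ring lra zify.

Set Implicit Arguments.
Unset Strict Implicit.
Unset Printing Implicit Defensive.

Import Order.TTheory GRing.Theory Num.Theory.
Import numFieldNormedType.Exports.

Local Open Scope classical_set_scope.
Local Open Scope ring_scope.

(** * Distances, cubes and balls *)

(** No doubling is assumed of [mu], which shapes the tools. The maximal function integrates over
    [3B] but divides by the measure of [9B]; Vitali's lemma then gives its bounds for [mu] as it is.
    Covering arguments use the sup norm, whose balls are cubes, and a countable dyadic grid of
    balls, so that suprema stay measurable. The exponent [lambda] is spent as follows. The square of
    a product of [kappa] averages has [2 * kappa] factors; all but one are estimated pointwise, each
    at the price of one weight to the power [- m], and the last one is integrated. What [lambda]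
    leaves beyond [2 * kappa] is at least [alpha / m], and [alpha] is shared out in thirds.
    Comparing the truncated function at [x] with its value outside [Om] must put the coefficient
    exactly 1 on that value: any larger factor would destroy the good-lambda inequality, whose
    levels differ by a factor close to 1. As [p] may be below 1, the argument runs on distribution
    functions of powers. The product of maximal functions is replaced by a weighted sum of their
    powers, and choosing the weights at the end plays the part of Hölder's inequality. *)

Section geometry.
Context {R : realType} {n : nat}.
Local Notation T := (Rn R n).
Implicit Types x y z c : T.

Definition Rn_coord (i : 'I_n) x : R := (x : 'rV[R]_n) 0 i.

Lemma open_Rn_measurable (A : set 'rV[R]_n) : open A ->
  measurable (A : set T).
Proof. exact: sub_gen_smallest. Qed.

Lemma measurable_Rn_coord i : measurable_fun setT (Rn_coord i).
Proof.
apply: (measurability _ (RGenOInfty.measurableE R)) => //= _ [_ [a ->] <-].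
rewrite setTI; apply: open_Rn_measurable.
move/continuousP : (@coord_continuous R 1 n 0 i) => /(_ [set x | a < x] (@open_gt R a)).
by congr (open _); apply/seteqP; split => x; rewrite /= in_itv/= andbT.
Qed.

(** The cubes of the statement are the closed balls of this distance, so coverings and Whitney cubes
    use it; it is comparable to the Euclidean distance with constants 1 and [n]. *)
Definition sup_dist x y : R := \big[Num.max/0]_(i < n) `|Rn_coord i x - Rn_coord i y|.

Lemma sup_dist_ge0 x y : 0 <= sup_dist x y.
Proof. by rewrite /sup_dist; elim/big_ind: _ => // a b; rewrite le_max => ->. Qed.

Lemma sup_dist_leP x y r : 0 <= r ->
  sup_dist x y <= r <-> forall i, `|Rn_coord i x - Rn_coord i y| <= r.
Proof.
move=> r0; split => [/bigmax_leP[_ h] i|h]; first exact: h.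
by apply/bigmax_leP; split.
Qed.

Lemma coord_le_sup_dist i x y : `|Rn_coord i x - Rn_coord i y| <= sup_dist x y.
Proof. exact: (sup_dist_leP x y (sup_dist_ge0 x y)).1. Qed.

Lemma sup_distC x y : sup_dist x y = sup_dist y x.
Proof. by apply: eq_bigr => i _; rewrite distrC. Qed.

Lemma sup_distxx x : sup_dist x x = 0.
Proof.
apply/eqP; rewrite eq_le sup_dist_ge0 andbT; apply/sup_dist_leP => // i.
by rewrite subrr normr0.
Qed.

Lemma sup_dist_triangle y x z : sup_dist x z <= sup_dist x y + sup_dist y z.
Proof.
apply/sup_dist_leP => [|i]; first by rewrite addr_ge0 ?sup_dist_ge0.
rewrite (le_trans (ler_distD (Rn_coord i y) _ _))// lerD// coord_le_sup_dist//.
Qed.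

Lemma cubeE c l : 0 <= l -> cube c l = [set x | sup_dist x c <= l / 2].
Proof.
move=> l0; apply/seteqP; split => x /=.
  by move=> h; apply/sup_dist_leP; rewrite ?divr_ge0.
by move=> /sup_dist_leP; apply; rewrite divr_ge0.
Qed.

Lemma eucl_distE x y :
  eucl_dist x y = Num.sqrt (\sum_(i < n) (Rn_coord i x - Rn_coord i y) ^+ 2).
Proof. by []. Qed.

Lemma eucl_dist_ge0 x y : 0 <= eucl_dist x y.
Proof. exact: sqrtr_ge0. Qed.

Lemma eucl_distC x y : eucl_dist x y = eucl_dist y x.
Proof.
by rewrite !eucl_distE; congr Num.sqrt; apply: eq_bigr => i _; rewrite -sqrrN opprB.
Qed.

Lemma eucl_distxx x : eucl_dist x x = 0.
Proof.
by rewrite eucl_distE big1 ?sqrtr0// => i _; rewrite subrr expr0n.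
Qed.

(** With [A], [B], [S] the three sums, the nonnegative quantity [\sum_i (A * b i - S * a i) ^+ 2]
    equals [A * (A * B - S ^+ 2)]; when [A = 0] all [a i] vanish. *)
Lemma cauchy_schwarz_sum (I : finType) (a b : I -> R) :
  (\sum_i a i * b i) ^+ 2 <= (\sum_i a i ^+ 2) * (\sum_i b i ^+ 2).
Proof.
have [A0|A0] := eqVneq (\sum_i a i ^+ 2) 0.
  have a0 i : a i = 0.
    apply/eqP; rewrite -sqrf_eq0.
    by move/psumr_eq0P : A0 => ->// j _; exact: sqr_ge0.
  by rewrite A0 mul0r big1 ?expr0n// => i _; rewrite a0 mul0r.
set A := \sum_i a i ^+ 2 in A0 *; set B := \sum_i b i ^+ 2; set S := \sum_i _.
have Agt0 : 0 < A by rewrite lt_neqAle eq_sym A0 sumr_ge0// => i _; exact: sqr_ge0.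
have : 0 <= \sum_i (A * b i - S * a i) ^+ 2 by rewrite sumr_ge0// => i _; exact: sqr_ge0.
suff -> : \sum_i (A * b i - S * a i) ^+ 2 = A * (A * B - S ^+ 2).
  by rewrite pmulr_rge0// subr_ge0.
rewrite (eq_bigr (fun i => A ^+ 2 * b i ^+ 2 +
  (- (2 * A * S) * (a i * b i) + S ^+ 2 * a i ^+ 2))); last by move=> i _; ring.
rewrite !big_split/= -!mulr_sumr -/A -/B -/S; ring.
Qed.

Lemma eucl_dist_triangle y x z : eucl_dist x z <= eucl_dist x y + eucl_dist y z.
Proof.
rewrite -(ler_pXn2r (_ : 0 < 2)%N) ?nnegrE ?addr_ge0 ?eucl_dist_ge0//.
rewrite sqrrD !eucl_distE.
set a := fun i => Rn_coord i x - Rn_coord i y; set b := fun i => Rn_coord i y - Rn_coord i z.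
have E w w' : 0 <= \sum_(i < n) (Rn_coord i w - Rn_coord i w') ^+ 2.
  by rewrite sumr_ge0// => i _; exact: sqr_ge0.
rewrite !sqr_sqrtr ?E//.
have -> : \sum_(i < n) (Rn_coord i x - Rn_coord i z) ^+ 2 =
    \sum_i a i ^+ 2 + (\sum_i a i * b i) *+ 2 + \sum_i b i ^+ 2.
  rewrite -sumrMnl -!big_split/=; apply: eq_bigr => i _; rewrite /a /b; ring.
rewrite lerD2r lerD2l lerMn2r/=.
rewrite -sqrtrM ?E// (le_trans (ler_norm _))// -sqrtr_sqr.
by apply: ler_wsqrtr; exact: cauchy_schwarz_sum.
Qed.

Lemma sup_dist_le_eucl x y : sup_dist x y <= eucl_dist x y.
Proof.
apply/sup_dist_leP => [|i]; first exact: eucl_dist_ge0.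
rewrite eucl_distE -sqrtr_sqr; apply: ler_wsqrtr.
by rewrite (bigD1 i)//= lerDl sumr_ge0// => j _; exact: sqr_ge0.
Qed.

Lemma eucl_dist_le_sup x y : eucl_dist x y <= n%:R * sup_dist x y.
Proof.
rewrite -[leRHS]ger0_norm ?mulr_ge0 ?sup_dist_ge0// -sqrtr_sqr eucl_distE.
apply: ler_wsqrtr; rewrite exprMn.
have H i : (Rn_coord i x - Rn_coord i y) ^+ 2 <= sup_dist x y ^+ 2.
  by rewrite -[leLHS]real_normK ?num_real// lerXn2r ?nnegrE ?sup_dist_ge0// coord_le_sup_dist.
apply: (le_trans (ler_sum _ (fun i _ => H i))).
rewrite sumr_const card_ord -[leLHS]mulr_natl ler_wpM2r ?sqr_ge0//.
by rewrite -natrX ler_nat; case: (n) => // k; rewrite -mulnn leq_pmulr.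
Qed.

Lemma measurable_Rn_coordB (i : 'I_n) :
  measurable_fun setT (fun p : T * T => Rn_coord i p.1 - Rn_coord i p.2).
Proof.
apply: measurable_funB.
- exact: (measurableT_comp (measurable_Rn_coord i) measurable_fst).
- exact: (measurableT_comp (measurable_Rn_coord i) measurable_snd).
Qed.

Lemma measurable_eucl_dist : measurable_fun setT (fun p : T * T => eucl_dist p.1 p.2).
Proof.
rewrite (_ : (fun _ => _) = (fun s => s `^ 2^-1) \o
    (fun p : T * T => \sum_(i < n) (Rn_coord i p.1 - Rn_coord i p.2) ^+ 2)); last first.
  by apply/funext => p /=; rewrite eucl_distE powR12_sqrt// sumr_ge0// => i _; exact: sqr_ge0.
apply: measurableT_comp; first exact: measurable_powR.
apply: measurable_sum => i; apply: measurable_funX; exact: measurable_Rn_coordB.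
Qed.

Lemma measurable_eucl_dist_l x : measurable_fun setT (eucl_dist x).
Proof. exact: (measurableT_comp measurable_eucl_dist (measurable_pair1 x)). Qed.

Lemma measurable_sup_dist : measurable_fun setT (fun p : T * T => sup_dist p.1 p.2).
Proof.
have H (s : seq 'I_n) : measurable_fun setT
    (fun p : T * T => \big[Num.max/0]_(i <- s) `|Rn_coord i p.1 - Rn_coord i p.2|).
  elim: s => [|i s ih].
    by rewrite (_ : (fun _ => _) = cst 0)//; apply/funext => p; rewrite big_nil.
  rewrite (_ : (fun _ => _) = (fun p : T * T => Num.max `|Rn_coord i p.1 - Rn_coord i p.2|
    (\big[Num.max/0]_(i <- s) `|Rn_coord i p.1 - Rn_coord i p.2|))); last first.
    by apply/funext => p; rewrite big_cons.
  apply: measurable_maxr => //.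
  exact: (measurableT_comp (@normr_measurable R setT) (measurable_Rn_coordB i)).
exact: H.
Qed.

Lemma measurable_sup_dist_l x : measurable_fun setT (sup_dist x).
Proof. exact: (measurableT_comp measurable_sup_dist (measurable_pair1 x)). Qed.

Lemma measurable_cube c l : measurable (cube c l : set T).
Proof.
have -> : cube c l = \bigcap_(i in [set: 'I_n])
    (Rn_coord i @^-1` `[Rn_coord i c - l / 2, Rn_coord i c + l / 2]%classic).
  apply/seteqP; split => x /= h i => [_|]; last first.
    by have /= := h i I; rewrite in_itv/= ler_distl.
  by rewrite /= in_itv/= -ler_distl; exact: h.
apply: fin_bigcap_measurable => [|i _].
  exact: finite_finset.
by rewrite -[X in measurable X]setTI; exact: measurable_Rn_coord.
Qed.

Lemma measurable_eball c r : measurable (eball c r : set T).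
Proof.
rewrite /eball (_ : [set y | _] = [set: T] `&` eucl_dist c @^-1` `]-oo, r[%classic).
  exact: (measurable_eucl_dist_l c measurableT).
by rewrite setTI; apply/seteqP; split => x; rewrite /= in_itv.
Qed.

End geometry.

(** * Covering lemmas and the layer-cake formula *)

Section vitali.
Context {T : Type} {R : realType} (dist : T -> T -> R) (c : nat -> T) (r : nat -> R).
Hypothesis distC : forall x y, dist x y = dist y x.
Hypothesis dist_triangle : forall y x z, dist x z <= dist x y + dist y z.

Definition family_ball (k : R) (i : nat) : set T := [set y | dist (c i) y <= k * r i].

(** Greedy selection: keep a ball of largest radius, discard the balls that meet it (its triple
    swallows them), and apply induction to the rest. *)
Lemma vitali_finite (s : seq nat) : exists D : seq nat,
  [/\ uniq D, {subset D <= s}, trivIset [set` D] (family_ball 1) &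
    forall i, i \in s -> exists2 j, j \in D & family_ball 1 i `<=` family_ball 3 j].
Proof.
have [N] := ubnP (size s); elim: N s => // N ih s; rewrite ltnS => sN.
have [->|s0] := eqVneq s [::].
  by exists [::]; split => // i j [].
have [i0 i0s i0max] : exists2 i0, i0 \in s & forall j, j \in s -> r j <= r i0.
  clear -s0; elim: s s0 => // a s ih _.
  have [->|s0] := eqVneq s [::].
    by exists a; rewrite ?mem_head// => j; rewrite inE => /eqP ->.
  have [b bs bmax] := ih s0.
  have [ab|ab] := leP (r a) (r b).
    by exists b; rewrite ?inE ?bs ?orbT// => j; rewrite inE => /orP[/eqP ->//|/bmax].
  exists a; rewrite ?mem_head// => j; rewrite inE => /orP[/eqP ->//|/bmax jb].
  by rewrite (le_trans jb)// ltW.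
pose s' := [seq j <- s | (j != i0) && `[< family_ball 1 j `&` family_ball 1 i0 = set0 >]].
have s's : (size s' < N)%N.
  apply: leq_trans sN; rewrite size_filter -[ltnRHS](count_predC (pred1 i0)) -addn1 addnC leq_add//.
    by rewrite -has_count has_pred1.
  by apply: sub_count => j /= /andP[].
have [D [uD Ds' tD cD]] := ih s' s's.
exists (i0 :: D); split.
- rewrite /= uD andbT; apply/negP => /Ds'; rewrite mem_filter eqxx//.
- move=> j; rewrite inE => /orP[/eqP ->//|/Ds']; by rewrite mem_filter => /andP[].
- have H j : j \in D -> family_ball 1 j `&` family_ball 1 i0 = set0.
    by move=> /Ds'; rewrite mem_filter => /andP[/andP[_ /asboolP]].
  move=> i j /=; rewrite !inE => /orP[/eqP ->|iD] /orP[/eqP ->|jD]//.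
  + by rewrite setIC H// => -[].
  + by rewrite H// => -[].
  + by move=> ij; exact: tD.
- move=> i si.
  have [->|ii0] := eqVneq i i0.
    exists i0; rewrite ?mem_head// => x; rewrite /family_ball/= mul1r => h.
    (* Radii may be negative, but this ball contains [x], and symmetry with the triangle inequality
       forces [dist] to be nonnegative. *)
    have r0 : 0 <= r i0.
      have := dist_triangle x (c i0) (c i0); have := dist_triangle (c i0) x x.
      by have := dist_triangle x x x; rewrite (distC x (c i0)); lra.
    lra.
  have [e|ne] := pselect (family_ball 1 i `&` family_ball 1 i0 = set0).
    have [|j jD ij] := cD i; first by rewrite mem_filter ii0 si andbT/=; apply/asboolP.
    by exists j => //; rewrite inE jD orbT.
  exists i0; rewrite ?mem_head//.
  have /set0P[z [iz i0z]] : family_ball 1 i `&` family_ball 1 i0 != set0 by apply/eqP.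
  move=> x ix; move: iz i0z ix (i0max _ si); rewrite /family_ball/= => iz i0z ix m.
  have := dist_triangle z (c i0) x; have := dist_triangle (c i) z x; rewrite (distC z (c i)); lra.
Qed.

End vitali.

Section weak_type.
Context {d} {T : measurableType d} {R : realType} (dist : T -> T -> R)
  (c : nat -> T) (r : nat -> R).
Hypothesis distC : forall x y, dist x y = dist y x.
Hypothesis dist_triangle : forall y x z, dist x z <= dist x y + dist y z.
Hypothesis measurable_family_ball : forall k i, measurable (family_ball dist c r k i).
Variables (mu : {measure set T -> \bar R}) (nu : set T -> \bar R) (V : \bar R).
Hypothesis nu_trivIset : forall D : seq nat, uniq D ->
  trivIset [set` D] (family_ball dist c r 1) ->
  (\sum_(i <- D) nu (family_ball dist c r 1 i) <= V)%E.

(* Vitali: disjoint bad balls [B] whose triples cover all the bad balls. *)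
Lemma vitali_weak_type (a : R) (P : set nat) : 0 <= a ->
  (forall i, P i -> (a%:E * mu (family_ball dist c r 3 i) <= nu (family_ball dist c r 1 i))%E) ->
  (a%:E * mu (\bigcup_(i in P) family_ball dist c r 1 i) <= V)%E.
Proof.
move=> a0 bad.
(* The selection lemma concerns finite families: the union is exhausted by finite ones and the bound
   passes to the limit by continuity from below. *)
pose F N := \bigcup_(i in [set i | (i < N)%N /\ P i]) family_ball dist c r 1 i.
have mF N : measurable (F N) by apply: bigcup_measurable.
have ndF : nondecreasing_seq F.
  move=> i j ij; apply/subsetPset => x [k [ki Pk] xk]; exists k => //; split => //.
  exact: leq_trans ki ij.
have -> : \bigcup_(i in P) family_ball dist c r 1 i = \bigcup_N F N.
  apply/seteqP; split => [x [i Pi xi]|x [N _ [i [_ Pi] xi]]]; last by exists i.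
  by exists i.+1 => //; exists i.
have H N : (a%:E * mu (F N) <= V)%E.
  pose s := [seq i <- iota 0 N | `[< P i >]].
  have [D [uD Ds tD cD]] := vitali_finite c r distC dist_triangle s.
  have DP i : i \in D -> P i by move=> /Ds; rewrite mem_filter => /andP[/asboolP].
  apply: le_trans (nu_trivIset uD tD).
  apply: (@le_trans _ _ (\sum_(i <- D) a%:E * mu (family_ball dist c r 3 i))%E); last first.
    by rewrite big_seq [leRHS]big_seq; apply: lee_sum => i /DP; exact: bad.
  rewrite -ge0_sume_distrr// lee_wpmul2l ?lee_fin//.
  apply: (@le_trans _ _ (mu (\big[setU/set0]_(i <- D) family_ball dist c r 3 i))).
    apply: le_measure; rewrite ?inE//; first exact: bigsetU_measurable.
    move=> x [i [iN Pi] xi].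
    have [|j jD ij] := cD i; first by rewrite mem_filter mem_iota add0n iN !andbT; apply/asboolP.
    by rewrite -bigcup_seq; exists j => //; exact: ij.
  rewrite (big_nth 0%N) [leRHS](big_nth 0%N) !big_mkord.
  apply: (@content_subadditive _ _ _ mu _ (fun i => family_ball dist c r 3 (nth 0%N D i))) => //.
  exact: bigsetU_measurable.
have /cvgeZl : mu (F N) @[N --> \oo] --> mu (\bigcup_N F N).
  by apply: nondecreasing_cvg_mu => //; exact: bigcupT_measurable.
move=> /(_ a%:E isT) h.
rewrite -(cvg_lim _ h)//; apply: lime_le; first by apply/cvg_ex; eexists; exact: h.
exact: nearW.
Qed.

End weak_type.

Section layer_cake.
Context {d} {T : measurableType d} {R : realType}
  (mu : {sigma_finite_measure set T -> \bar R}).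
Local Notation leb := (@lebesgue_measure R).

Lemma measurable_superlevel (u : T -> \bar R) : measurable_fun setT u ->
  measurable [set p : T * measurableTypeR R | (p.2%:E < u p.1)%E].
Proof.
move=> mu_; rewrite -[X in measurable X]setTI.
apply: emeasurable_fun_lt => //.
- by apply/measurable_EFinP; exact: measurable_snd.
- exact: (measurableT_comp mu_ measurable_fst).
Qed.

(** Tonelli's theorem for the indicator of the region between 0 and the graph of [u]. *)
Lemma layer_cake (u : T -> \bar R) : measurable_fun setT u -> (forall x, 0 <= u x)%E ->
  (\int[mu]_x u x = \int[leb]_(s in `]0%R, +oo[) mu [set x | s%:E < u x])%E.
Proof.
move=> mu_ u0.
pose g (p : T * measurableTypeR R) : \bar R :=
  (\1_([set p : T * measurableTypeR R | (0 < p.2)%R /\ (p.2%:E < u p.1)%E]) p)%:E.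
have mA : measurable ([set p : T * measurableTypeR R | (0 < p.2)%R /\ (p.2%:E < u p.1)%E]).
  rewrite (_ : [set p | _] = [set p | (0 < p.2)%R] `&` [set p | (p.2%:E < u p.1)%E]); last by [].
  apply: measurableI; last exact: measurable_superlevel.
  rewrite (_ : [set p | _] = [set: T * measurableTypeR R] `&` snd @^-1` `]0, +oo[%classic).
    exact: measurable_snd.
  by rewrite setTI; apply/seteqP; split => p; rewrite /= in_itv/= andbT.
have mg : measurable_fun setT g by apply/measurable_EFinP; exact: measurable_indic.
have g0 p : (0 <= g p)%E by rewrite lee_fin.
have := @fubini_tonelli _ _ _ _ R mu leb g mg g0.
have -> : (\int[mu]_x \int[leb]_y g (x, y) = \int[mu]_x u x)%E.
  apply: eq_integral => x _.
  transitivity (\int[leb]_y (\1_([set y : measurableTypeR R | (0 < y)%R /\ (y%:E < u x)%E]) y)%:E)%E.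
    by apply: eq_integral => y _; rewrite /g !indicE.
  (* The slice over [x] is an interval starting at 0; its right end is [u x], or absent when [u x]
     is infinite. *)
  have E : [set y : measurableTypeR R | (0 < y)%R /\ (y%:E < u x)%E] =
      [set` Interval (BRight 0) (if u x is a%:E then BLeft a else if u x is +oo%E then +oo%O else BLeft 0)].
    apply/seteqP; split => y /=; move: (u0 x); case: (u x) => [a a0| |]//=;
      rewrite in_itv/= ?andbT ?lte_fin ?ltry//.
    - by case=> -> ->.
    - by move=> _ [->].
    - by move=> /andP.
  rewrite E; set itv := Interval _ _.
  transitivity (leb ([set` itv] : set R)).
    by rewrite integral_indic// setIT.
  rewrite lebesgue_measure_itv /itv/=; move: (u0 x); case: (u x) => [a a0| _|//]/=.
    rewrite lte_fin; case: ltP => [_|a0']; first by rewrite -EFinB subr0.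
    by congr EFin; apply/eqP; rewrite eq_le a0' -lee_fin a0.
  by rewrite ltry.
move=> ->; rewrite [RHS]integral_mkcond; apply: eq_integral => y _.
rewrite patchE; case: ifPn => [|]; rewrite mem_setE in_itv/= andbT => y0.
  transitivity (\int[mu]_x (\1_([set x | (y%:E < u x)%E]) x)%:E)%E.
    apply: eq_integral => x _; rewrite /g !indicE.
    have [h|h] := pselect (y%:E < u x)%E; first by rewrite !mem_set.
    by rewrite !memNset// => -[].
  rewrite integral_indic ?setIT//.
  rewrite -[X in measurable X]setTI; exact: emeasurable_fun_o_infty.
rewrite integral0_eq// => x _; rewrite /g indicE memNset//= => -[].
by move: y0 => /negP.
Qed.

End layer_cake.

(** * Integrals of powers near zero and at infinity *)

Section power_integral.
Context {R : realType}.
Local Notation leb := (@lebesgue_measure R).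
Implicit Types a b q : R.

Lemma integral_powR_itv q a b : q != 0 -> 0 < a -> a < b ->
  (\int[leb]_(s in `[a, b]) (s `^ (q - 1))%:E = ((b `^ q - a `^ q) / q)%:E)%E.
Proof.
move=> q0 a0 ab.
have D (x : R) : 0 < x -> is_derive x 1 (fun s : R => s `^ q / q : R) (x `^ (q - 1)).
  move=> x0.
  have -> : x `^ (q - 1) = q^-1 *: (q * x `^ (q - 1)) by rewrite /GRing.scale/= mulrA mulVf// mul1r.
  rewrite (_ : (fun _ => _) = q^-1 \*: (@powR R ^~ q)); last first.
    by apply/funext => s /=; rewrite mulrC.
  have h := is_derive1_powR q x0.
  exact: (is_deriveZ q^-1 h).
have C (x : R) : 0 < x -> {for x, continuous (fun s : R => s `^ q / q)}.
  by move=> x0; apply/differentiable_continuous/derivable1_diffP; exact: (@ex_derive _ _ _ _ _ _ _ (D x x0)).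
have C' (x : R) : 0 < x -> {for x, continuous (fun s : R => s `^ (q - 1))}.
  move=> x0; apply/differentiable_continuous/derivable1_diffP.
  by apply: derivable_powR; rewrite in_itv/= x0.
have b0 : 0 < b by exact: lt_trans ab.
rewrite (@continuous_FTC2 _ _ (fun s : R => s `^ q / q))//.
- by rewrite -EFinB mulrBl.
- apply: continuous_in_subspaceT => x; rewrite inE/= in_itv/= => /andP[ax _].
  by apply: C'; exact: lt_le_trans ax.
- split.
  + move=> x; rewrite in_itv/= => /andP[ax _].
    by apply: (@ex_derive _ _ _ _ _ _ _ (D x _)); exact: lt_trans ax.
  + by apply: cvg_at_right_filter; exact: C.
  + by apply: cvg_at_left_filter; exact: C.
- move=> x; rewrite in_itv/= => /andP[ax _].
  by rewrite derive1E; apply: (@derive_val _ _ _ _ _ _ _ (D x _)); exact: lt_trans ax.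
Qed.

Lemma measurable_powR_EFin q (D : set R) : measurable_fun D (fun s : R => (s `^ q)%:E).
Proof. by apply/measurable_EFinP; apply: measurable_funTS; exact: measurable_powR. Qed.

(** The fundamental theorem of calculus gives the integral on compact intervals away from 0;
    improper integrals are reached through an increasing union of such intervals. *)
Lemma le_integral_powR_bigcup q (B : \bar R) (a b : nat -> R) (D : set R) :
  measurable D ->
  nondecreasing_seq (fun k => `[a k, b k]%classic) ->
  D `<=` \bigcup_k `[a k, b k]%classic ->
  (forall k, \int[leb]_(s in `[a k, b k]) (s `^ q)%:E <= B)%E ->
  (\int[leb]_(s in D) (s `^ q)%:E <= B)%E.
Proof.
move=> mD nd sub le.
have mU : measurable (\bigcup_k `[a k, b k]%classic) by apply: bigcup_measurable.
apply: (@le_trans _ _ (\int[leb]_(s in \bigcup_k `[a k, b k]%classic) (s `^ q)%:E)%E).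
  apply: ge0_subset_integral => //; first exact: measurable_powR_EFin.
  by move=> x _; rewrite lee_fin powR_ge0.
have h : (\int[leb]_(s in `[a i, b i]) (s `^ q)%:E)%E @[i --> \oo] -->
    (\int[leb]_(s in \bigcup_k `[a k, b k]%classic) (s `^ q)%:E)%E.
  refine (@ge0_nondecreasing_set_cvg_integral _ (measurableTypeR R) R (fun k => `[a k, b k]%classic)
    (fun s : R => (s `^ q)%:E) (@lebesgue_measure R) nd _ _ _) => //.
    by move=> i; exact: measurable_powR_EFin.
  by move=> i x _; rewrite lee_fin powR_ge0.
rewrite -(cvg_lim _ h)//; apply: lime_le; first by apply/cvg_ex; eexists; exact: h.
exact: nearW.
Qed.

Lemma integral_powR_near0 q b : 0 < q -> 0 <= b ->
  (\int[leb]_(s in `]0%R, b[) (s `^ (q - 1))%:E <= (b `^ q / q)%:E)%E.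
Proof.
move=> q0; rewrite le_eqVlt => /predU1P[<-|b0].
  by rewrite set_itvoo0 integral_set0 lee_fin mulr_ge0 ?powR_ge0// invr_ge0 ltW.
apply: (le_integral_powR_bigcup (a := fun k => b / k.+2%:R) (b := fun=> b)) => //.
- move=> i j ij; apply/subsetPset => x; rewrite /= !in_itv/= => /andP[h ->]; rewrite andbT.
  by apply: le_trans h; rewrite ler_wpM2l ?(ltW b0)// lef_pV2 ?posrE// ler_nat.
- move=> x; rewrite /= in_itv/= => /andP[x0 xb].
  exists (Num.truncn (b / x)) => //; rewrite /= in_itv/= (ltW xb) andbT.
  rewrite ler_pdivrMr// mulrC -ler_pdivrMr//.
  by rewrite (le_trans (ltW (truncnS_gt _)))// ler_nat.
- move=> k; rewrite integral_powR_itv ?gt_eqF ?divr_gt0//; last first.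
    by rewrite ltr_pdivrMr// ltr_pMr// ltr1n.
  by rewrite lee_fin ler_pM2r ?invr_gt0// gerBl powR_ge0.
Qed.

Lemma integral_powR_infty q b : 0 < q -> 0 < b ->
  (\int[leb]_(s in `[b, +oo[) (s `^ (- q - 1))%:E <= (b `^ (- q) / q)%:E)%E.
Proof.
move=> q0 b0.
apply: (le_integral_powR_bigcup (a := fun=> b) (b := fun k => b * k.+2%:R)) => //.
- move=> i j ij; apply/subsetPset => x; rewrite /= !in_itv/= => /andP[-> h]/=.
  by apply: (le_trans h); rewrite ler_wpM2l ?(ltW b0)// ler_nat.
- move=> x; rewrite /= in_itv/= andbT => bx.
  exists (Num.truncn (x / b)) => //; rewrite /= in_itv/= bx/= mulrC -ler_pdivrMr//.
  by rewrite (le_trans (ltW (truncnS_gt _)))// ler_nat.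
- move=> k; rewrite integral_powR_itv ?lt_eqF ?oppr_lt0//; last first.
    by rewrite ltr_pMr// ltr1n.
  rewrite lee_fin invrN mulrN -mulNr opprB ler_pM2r ?invr_gt0// gerBl powR_ge0//.
Qed.

End power_integral.

(** * The maximal function *)

Section grid.
Context {R : realType} {n : nat}.
Local Notation T := (Rn R n).

Definition dyadic (k : int) : R := 2 `^ k%:~R.

Lemma dyadic_gt0 k : 0 < dyadic k. Proof. exact: powR_gt0. Qed.

Lemma dyadicS k : dyadic (k + 1) = 2 * dyadic k.
Proof. rewrite /dyadic intrD powRD; last by rewrite pnatr_eq0 implybT.
by rewrite mulr1z powRr1// mulrC. Qed.

Lemma dyadic_near (r : R) : 0 < r -> exists k, dyadic k <= r < dyadic (k + 1).
Proof.
move=> r0; exists (Num.floor (ln r / ln 2)).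
have l2 : 0 < ln (2 : R) by rewrite ln_gt0// ltr1n.
have E x : (2 : R) `^ x = expR (x * ln 2) by rewrite /powR pnatr_eq0.
have Er : r = expR (ln r / ln 2 * ln 2) by rewrite divfK ?gt_eqF// lnK.
rewrite /dyadic !E; apply/andP; split.
  by rewrite [leRHS]Er ler_expR ler_pM2r// floor_le_tmp.
by rewrite [ltLHS]Er ltr_expR ltr_pM2r// floorD1_gt.
Qed.

Definition grid_pt (p : int * {ffun 'I_n -> int}) : T :=
  \row_i (dyadic p.1 * (p.2 i)%:~R).

Lemma grid_near (k : int) (x : T) : exists j, sup_dist (grid_pt (k, j)) x <= dyadic k.
Proof.
have d0 := dyadic_gt0 k.
exists [ffun i : 'I_n => Num.floor (Rn_coord i x / dyadic k)].
apply/sup_dist_leP => [|i]; first exact: ltW.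
rewrite /Rn_coord mxE ffunE/= ler_distl.
set z := (x : 'rV_n) 0 i.
have /andP[h1 h2] := floor_itv (z / dyadic k).
have -> : z = dyadic k * (z / dyadic k) by rewrite mulrC divfK ?gt_eqF.
rewrite [X in Num.floor X](_ : _ = z / dyadic k); last by rewrite (mulrC (dyadic k)) divfK// gt_eqF.
set w := z / dyadic k in h1 h2 *; set F := Num.floor w in h1 h2 *.
by rewrite intrD in h2; apply/andP; split; nra.
Qed.

(** Enumerates pairs of a scale and a lattice point. Numbers that code nothing are sent to the
    default pair, so that one ball may be repeated: this changes no supremum, but matters when cubes
    are counted. *)
Definition grid_nth (i : nat) : int * {ffun 'I_n -> int} :=
  odflt (0, [ffun=> 0]) (unpickle i).

Definition grid_center i : T := grid_pt (grid_nth i).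
Definition grid_radius i : R := dyadic (grid_nth i).1.

Lemma grid_radius_gt0 i : 0 < grid_radius i. Proof. exact: dyadic_gt0. Qed.

Definition grid_ball := family_ball sup_dist grid_center grid_radius.

(** With [dyadic k <= r < dyadic (k + 1)] the scale [k + 1] is used, so that the radius exceeds [r]
    but stays below [2 * r]. *)
Lemma grid_cover (x : T) (r : R) : 0 < r ->
  exists i, [/\ grid_ball 1 i x, r <= grid_radius i & grid_radius i <= 2 * r].
Proof.
move=> r0; have [k /andP[kr rk]] := dyadic_near r0.
have [j kj] := grid_near (k + 1) x.
exists (pickle (k + 1, j)); rewrite /grid_ball/family_ball/= /grid_center /grid_radius /grid_nth pickleK/=.
by rewrite mul1r kj; split => //; [exact: ltW|rewrite dyadicS ler_pM2l].
Qed.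

Lemma measurable_grid_ball k i : measurable (grid_ball k i).
Proof.
rewrite /grid_ball /family_ball (_ : [set y | _] =
  [set: T] `&` sup_dist (grid_center i) @^-1` `]-oo, k * grid_radius i]%classic).
  exact: (measurable_sup_dist_l _ measurableT).
by rewrite setTI; apply/seteqP; split => x; rewrite /= in_itv.
Qed.

End grid.

Section maximal.
Context {R : realType} {n : nat}.
Local Notation T := (Rn R n).
Variable mu : {sigma_finite_measure set T -> \bar R}.
Hypothesis mu_ball : forall (x : T) r, (mu [set y | (sup_dist x y <= r)%R] < +oo)%E.
Variable f : T -> R.
Hypothesis mf : measurable_fun setT f.
Hypothesis f0 : forall x, 0 <= f x.
Local Open Scope ereal_scope.

Definition locint := forall (x : T) r, \int[mu]_(y in [set y | (sup_dist x y <= r)%R]) (f y)%:E < +oo.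
Hypothesis fint : locint.

(** The integral is over [3B] and the normalisation by [9B]: applied to the tripled balls, Vitali's
    lemma meets exactly these two sets, and no doubling of [mu] is called for. *)
Definition grid_avg i : R :=
  (fine (\int[mu]_(y in grid_ball 3 i) (f y)%:E) / fine (mu (grid_ball 9 i)))%R.

(** A ball of the grid competes at every point that it contains, not only at its centre; countably
    many compete, which makes the supremum measurable. *)
Definition maximal (x : T) : \bar R :=
  ereal_sup (range (fun i => (grid_avg i * \1_(grid_ball 1 i) x)%:E)).

Lemma grid_ball_ltoo k i : mu (grid_ball k i) < +oo.
Proof. exact: mu_ball. Qed.

Lemma grid_avg_ge0 i : (0 <= grid_avg i)%R.
Proof. by rewrite /grid_avg divr_ge0 ?fine_ge0//; apply: integral_ge0 => x _; rewrite lee_fin. Qed.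

Lemma maximal_ge0 x : 0 <= maximal x.
Proof.
apply: (@le_trans _ _ ((grid_avg 0 * \1_(grid_ball 1 0) x)%:E)).
  by rewrite lee_fin mulr_ge0 ?grid_avg_ge0.
by apply: ereal_sup_ubound; exists 0%N.
Qed.

Lemma measurable_maximal : measurable_fun setT maximal.
Proof.
rewrite (_ : maximal = fun x => esups (fun i => (grid_avg i * \1_(grid_ball 1 i) x)%:E) 0%N); last first.
  apply/funext => x; rewrite /maximal /esups /sdrop/=; congr ereal_sup.
  by apply/seteqP; split => y [i _ <-]; exists i.
apply: (measurable_fun_esups (f := fun i x => (grid_avg i * \1_(grid_ball 1 i) x)%:E)) => i.
apply/measurable_EFinP; apply: measurable_funM => //.
by apply: measurable_indic; exact: measurable_grid_ball.
Qed.

Lemma integral_grid_ball_le i :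
  \int[mu]_(y in grid_ball 3 i) (f y)%:E = (grid_avg i)%:E * mu (grid_ball 9 i).
Proof.
have fin9 : mu (grid_ball 9 i) \is a fin_num by rewrite ge0_fin_numE// grid_ball_ltoo.
have fin3 : \int[mu]_(y in grid_ball 3 i) (f y)%:E \is a fin_num.
  by rewrite ge0_fin_numE ?fint// integral_ge0// => x _; rewrite lee_fin.
(* If [9B] is null then so is [3B], and both sides vanish. *)
have [z|nz] := eqVneq (mu (grid_ball 9 i)) 0.
  rewrite z mule0; apply: null_set_integral.
  - exact: measurable_grid_ball.
  - by apply/measurable_EFinP; exact: measurable_funTS.
  - apply/eqP; rewrite eq_le measure_ge0 andbT -z; apply: le_measure; rewrite ?inE;
      try exact: measurable_grid_ball.
    move=> x; rewrite /grid_ball /family_ball/= => h; apply: (le_trans h).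
    by rewrite ler_pM2r ?grid_radius_gt0// ler_nat.
rewrite -[LHS]fineK// -[X in _ * X]fineK// -EFinM /grid_avg divfK//.
by rewrite fine_eq0.
Qed.

(** Take a grid ball [B] through [x] of radius between [r] and [2 * r]: its triple contains the ball
    of radius [r] about [x], and [9B] lies within [(1 + 9) * 2 * r] of [x], hence the factor 20. *)
Lemma integral_ball_le_maximal (x : T) (r K : R) : (0 < r)%R -> maximal x <= K%:E ->
  \int[mu]_(y in [set y | (sup_dist x y <= r)%R]) (f y)%:E <=
    K%:E * mu [set y | (sup_dist x y <= 20 * r)%R].
Proof.
move=> r0 xK; have [i [xi ri ir]] := grid_cover x r0.
have mball s : measurable [set y | (sup_dist x y <= s)%R].
  rewrite (_ : [set y | _] = [set: T] `&` sup_dist x @^-1` `]-oo, s]%classic).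
    exact: (measurable_sup_dist_l _ measurableT).
  by rewrite setTI; apply/seteqP; split => y; rewrite /= in_itv.
move: (xi); rewrite /grid_ball /family_ball/= mul1r => xi'.
have r1 := grid_radius_gt0 (R := R) (n := n) i.
apply: (@le_trans _ _ (\int[mu]_(y in grid_ball 3 i) (f y)%:E)).
  apply: ge0_subset_integral => //; first exact: measurable_grid_ball.
    by apply/measurable_EFinP; exact: measurable_funTS.
    by move=> y _; rewrite lee_fin.
  move=> y /= xy; rewrite /grid_ball /family_ball/=.
  by have := sup_dist_triangle x (grid_center i) y; lra.
rewrite integral_grid_ball_le; apply: lee_pmul => //.
- by rewrite lee_fin grid_avg_ge0.
- apply: le_trans xK; apply: ereal_sup_ubound; exists i => //.
  by rewrite indicE mem_set// mulr1.
- apply: le_measure; rewrite ?inE//; first exact: measurable_grid_ball.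
  move=> y; rewrite /grid_ball /family_ball/= => h.
  by have := sup_dist_triangle (grid_center i) x y; rewrite (sup_distC x (grid_center i)); lra.
Qed.

(** The part of [f] below the level [a] contributes at most [a * mu (9B)] to the integral over [3B].
    A ball with average above [2 * a] therefore has [a * mu (9B)] at most the integral over [3B] of
    the part above [a], and disjoint [3B] are summed. *)
Lemma maximal_weak_type (a : R) : (0 < a)%R ->
  a%:E * mu [set x | (2 * a)%:E < maximal x] <=
    \int[mu]_x (f x * \1_[set x | (a < f x)%R] x)%:E.
Proof.
move=> a0.
have mh : measurable [set x | (a < f x)%R].
  rewrite (_ : [set y | _] = [set: T] `&` f @^-1` `]a, +oo[%classic); first exact: mf.
  by rewrite setTI; apply/seteqP; split => y; rewrite /= in_itv/= andbT.
pose h x := (f x * \1_[set x | (a < f x)%R] x)%R.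
have mH : measurable_fun setT h by apply: measurable_funM => //; exact: measurable_indic.
have h0 x : (0 <= h x)%R by rewrite /h mulr_ge0.
have mEh (D : set T) : measurable_fun D (EFin \o h) by apply/measurable_EFinP; exact: measurable_funTS.
pose P := [set i | (2 * a < grid_avg i)%R].
have E : [set x | (2 * a)%:E < maximal x] = \bigcup_(i in P) grid_ball 1 i.
  apply/seteqP; split => [x|x [i Pi xi]].
    move=> /ereal_sup_gt[_ [i _ <-]]; rewrite lte_fin indicE.
    have [xi|xi] := pselect (grid_ball 1 i x).
      by rewrite mem_set// mulr1 => h1; exists i.
    by rewrite memNset// mulr0 => h1; exfalso; lra.
  apply: (@lt_le_trans _ _ (grid_avg i)%:E) => //.
  by apply: ereal_sup_ubound; exists i => //; rewrite indicE mem_set// mulr1.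
rewrite E.
(* The selection is run on the tripled balls, whose triples are the [9B] of the normalisation. *)
pose c3 := @grid_center R n; pose r3 i := (3 * @grid_radius R n i)%R.
have E3 k i : family_ball sup_dist c3 r3 k i = grid_ball (k * 3) i.
  by rewrite /grid_ball /family_ball /r3; apply/seteqP; split => x /=; rewrite mulrA.
have m3 k i : measurable (family_ball sup_dist c3 r3 k i) by rewrite E3; exact: measurable_grid_ball.
apply: (@le_trans _ _ (a%:E * mu (\bigcup_(i in P) family_ball sup_dist c3 r3 1 i))).
  rewrite lee_wpmul2l ?lee_fin ?(ltW a0)//; apply: le_measure; rewrite ?inE.
  - by apply: bigcup_measurable => i _; exact: measurable_grid_ball.
  - exact: bigcup_measurable.
  - move=> x [i Pi xi]; exists i => //; rewrite E3; move: xi; rewrite /grid_ball /family_ball/= => xi.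
    by have := grid_radius_gt0 (R := R) (n := n) i; lra.
apply: (vitali_weak_type (nu := fun A => \int[mu]_(x in A) (h x)%:E) _ _ m3) => //.
- exact: sup_distC.
- exact: sup_dist_triangle.
- move=> D uD tD.
  rewrite -(@ge0_integral_bigsetU _ _ _ mu nat (family_ball sup_dist c3 r3 1)
    (fun x => (h x)%:E) D (m3 1%R) uD tD)//.
  + by apply: ge0_subset_integral => //;
      [exact: bigsetU_measurable | move=> x _; rewrite lee_fin].
  + by move=> x _; rewrite lee_fin.
- by rewrite ltW.
- move=> i Pi; rewrite !E3 mul1r (_ : 3 * 3 = 9)%R; last by rewrite -natrM.
  have fin9 : mu (grid_ball 9 i) \is a fin_num by rewrite ge0_fin_numE// grid_ball_ltoo.
  have fin3 : mu (grid_ball 3 i) \is a fin_num by rewrite ge0_fin_numE// grid_ball_ltoo.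
  have le39 : mu (grid_ball 3 i) <= mu (grid_ball 9 i).
    apply: le_measure; rewrite ?inE; try exact: measurable_grid_ball.
    move=> x; rewrite /grid_ball /family_ball/= => h1; apply: (le_trans h1).
    by rewrite ler_pM2r ?grid_radius_gt0// ler_nat.
  have : \int[mu]_(y in grid_ball 3 i) (f y)%:E <=
      \int[mu]_(y in grid_ball 3 i) (h y)%:E + a%:E * mu (grid_ball 3 i).
    rewrite -(integral_cst mu (measurable_grid_ball 3 i)).
    have h0' x : grid_ball 3 i x -> 0 <= (h x)%:E by rewrite lee_fin.
    have a0' (x : T) : grid_ball 3 i x -> 0 <= cst a%:E x by rewrite lee_fin ltW.
    rewrite -(@ge0_integralD _ _ _ mu _ (measurable_grid_ball 3 i) (fun y => (h y)%:E)
      (cst a%:E) h0' (mEh _) a0' (measurable_cst _)).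
    apply: ge0_le_integral => //; first exact: measurable_grid_ball.
    - by move=> x _; rewrite lee_fin.
    - by apply/measurable_EFinP; exact: measurable_funTS.
    - by apply: emeasurable_funD.
    - move=> x _; rewrite -EFinD lee_fin /h indicE; have [H|H] := ltP a (f x).
        by rewrite mem_set// mulr1 lerDl ltW.
      by rewrite memNset ?mulr0 ?add0r//=; apply/negP; rewrite -leNgt.
  rewrite integral_grid_ball_le; move: Pi; rewrite /P/= => Pi le1.
  have : (2 * a)%:E * mu (grid_ball 9 i) <= \int[mu]_(y in grid_ball 3 i) (h y)%:E + a%:E * mu (grid_ball 9 i).
    apply: (@le_trans _ _ ((grid_avg i)%:E * mu (grid_ball 9 i))).
      by rewrite lee_wpmul2r// lee_fin ltW.
    by apply: (le_trans le1); rewrite leeD2l// lee_wpmul2l// lee_fin ltW.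
  rewrite -(fineK fin9) -!EFinM.
  case: (\int[mu]_(y in _) _) => [u| |]//=; rewrite -?EFinD ?lee_fin ?leey// => le2.
  lra.
Qed.

End maximal.

Section integral_extra.
Context {d} {T : measurableType d} {R : realType} (mu : {measure set T -> \bar R}).
Local Open Scope ereal_scope.

Import HBNNSimple.

(* The integral of a nonnegative function is a supremum over simple functions,
   so monotonicity needs no measurability. *)
Lemma le_nonneg_integral (D : set T) (f1 f2 : T -> \bar R) :
  (forall x, D x -> 0 <= f1 x) -> (forall x, D x -> f1 x <= f2 x) ->
  \int[mu]_(x in D) f1 x <= \int[mu]_(x in D) f2 x.
Proof.
move=> f10 f12.
have f20 x : D x -> 0 <= f2 x by move=> Dx; apply: le_trans (f12 _ Dx); exact: f10.
rewrite !ge0_integralE//; apply: ereal_sup_le => _ [h hf <-]; exists h => // x.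
apply: (le_trans (hf x)); rewrite !patchE; case: ifPn => //; rewrite inE; exact: f12.
Qed.

Lemma chebyshev_poweR (f : T -> \bar R) : measurable_fun setT f -> (forall x, 0 <= f x) ->
  \int[mu]_x f x < +oo -> forall a : R, (0 < a)%R -> mu [set x | a%:E < f x] < +oo.
Proof.
move=> mf f0 ifoo a a0.
pose A : set T := [set x | a%:E < f x].
have mA : measurable A.
  by rewrite -[X in measurable X]setTI; exact: emeasurable_fun_o_infty.
rewrite -/A -(@lte_pmul2l _ a%:E)// mulry gtr0_sg// mul1e.
apply: le_lt_trans ifoo.
have -> : a%:E * mu A = \int[mu]_x (a%:E * (\1_A x)%:E).
  rewrite ge0_integralZl//; last 2 first.
  - by apply/measurable_EFinP; exact: measurable_indic.
  - by rewrite lee_fin ltW.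
  by rewrite integral_indic// setIT.
apply: le_nonneg_integral => x _; rewrite indicE.
  by rewrite mule_ge0// lee_fin// ltW.
have [h|h] := pselect (A x); first by rewrite mem_set// mule1 ltW.
by rewrite memNset// mule0.
Qed.

End integral_extra.

(** * Strong type bound for the maximal function *)

Section maximal_Lp.
Context {R : realType} {n : nat}.
Local Notation T := (Rn R n).
Variable mu : {sigma_finite_measure set T -> \bar R}.
Hypothesis mu_ball : forall (x : T) r, (mu [set y | (sup_dist x y <= r)%R] < +oo)%E.
Variable f : T -> R.
Hypothesis mf : measurable_fun setT f.
Hypothesis f0 : forall x, 0 <= f x.
Hypothesis fint : locint mu f.
Local Notation leb := (@lebesgue_measure R).
Local Open Scope ereal_scope.

Lemma lt_poweR_invr (p s : R) (u : \bar R) : (0 < p)%R -> (0 < s)%R -> 0 <= u ->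
  (s%:E < u `^ p) = ((s `^ p^-1)%:E < u).
Proof.
move=> p0 s0; case: u => [u| |]//= u0; last by rewrite gt_eqF// !ltry.
rewrite !lte_fin; have E : s = ((s `^ p^-1) `^ p)%R.
  by rewrite -powRrM mulVf ?gt_eqF// powRr1// ltW.
rewrite [in LHS]E; apply/idP/idP.
  by apply: contraTT; rewrite -!leNgt => h; apply: ge0_ler_powR => //; rewrite ?nnegrE ?powR_ge0// ltW.
by apply: gt0_ltr_powR => //; rewrite nnegrE powR_ge0.
Qed.

Lemma maximal_Lp (p : R) : (1 < p)%R ->
  \int[mu]_x (maximal mu f x `^ p) <=
    (2 `^ p / (1 - p^-1))%:E * \int[mu]_x (f x `^ p)%:E.
Proof.
move=> p1; have p0 : (0 < p)%R by exact: lt_trans p1.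
have q0 : (0 < 1 - p^-1)%R by rewrite subr_gt0 invf_lt1.
set q := (1 - p^-1)%R in q0 *.
have mM := measurable_maximal mu f.
pose S := [set z : T * measurableTypeR R | (z.2%:E < ((2 * f z.1) `^ p)%:E)%E].
have mS : measurable S.
  apply: (@measurable_superlevel _ _ _ (fun x => ((2 * f x) `^ p)%:E)).
  apply/measurable_EFinP; apply: (measurableT_comp (measurable_powR p)).
  exact: measurable_funM.
pose S0 := [set z : T * measurableTypeR R | (0 < z.2)%R].
have mS0 : measurable S0.
  rewrite (_ : S0 = [set: T * measurableTypeR R] `&` snd @^-1` `]0%R, +oo[%classic).
    exact: measurable_snd.
  by rewrite setTI; apply/seteqP; split => y; rewrite /= in_itv/= andbT.
pose G (z : T * measurableTypeR R) : \bar R :=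
  (2 * z.2 `^ (q - 1) * f z.1 * \1_(S `&` S0) z)%:E.
have mG : measurable_fun setT G.
  apply/measurable_EFinP; apply: measurable_funM; last first.
    by apply: measurable_indic; exact: measurableI.
  apply: measurable_funM; last exact: (measurableT_comp mf measurable_fst).
  apply: measurable_funM => //.
  exact: (measurableT_comp (measurable_powR (q - 1)) measurable_snd).
have G0 z : 0 <= G z by rewrite lee_fin !mulr_ge0// powR_ge0.
rewrite layer_cake; last 2 first.
- exact: (measurableT_comp (measurable_poweR p) mM).
- by move=> x; exact: poweR_ge0.
apply: (@le_trans _ _ (\int[leb]_s \int[mu]_x G (x, s))).
  rewrite integral_mkcond; apply: le_nonneg_integral => s _.
    by rewrite patchE; case: ifPn.
  rewrite patchE; case: ifPn; last by move=> _; exact: integral_ge0.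
  rewrite inE/= in_itv/= andbT => s0.
  pose a := (s `^ p^-1 / 2)%R.
  have a0 : (0 < a)%R by rewrite divr_gt0// powR_gt0.
  have -> : [set x | s%:E < maximal mu f x `^ p] = [set x | (2 * a)%:E < maximal mu f x].
    apply/seteqP; split => x /=; rewrite lt_poweR_invr ?maximal_ge0// /a mulrC divfK//.
  set A := [set x | _ < _].
  have -> : mu A = a^-1%:E * (a%:E * mu A) by rewrite muleA -EFinM mulVf ?gt_eqF// mul1e.
  apply: (@le_trans _ _ (a^-1%:E * \int[mu]_x (f x * \1_[set x | (a < f x)%R] x)%:E)).
    by rewrite lee_wpmul2l ?lee_fin ?invr_ge0 ?(ltW a0)//; exact: maximal_weak_type.
  have mh : measurable [set x | (a < f x)%R].
    rewrite (_ : [set y | _] = [set: T] `&` f @^-1` `]a, +oo[%classic); first exact: mf.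
    by rewrite setTI; apply/seteqP; split => y; rewrite /= in_itv/= andbT.
  rewrite -ge0_integralZl//; first last.
  - by rewrite lee_fin invr_ge0 ltW.
  - by move=> x _; rewrite lee_fin mulr_ge0.
  - apply/measurable_EFinP; apply: measurable_funM => //; exact: measurable_indic.
  apply: le_nonneg_integral => x _; rewrite -EFinM lee_fin.
    by rewrite !mulr_ge0 ?invr_ge0 ?(ltW a0).
  rewrite /G/= !indicE; have [h|h] := ltP a (f x); last first.
    rewrite [X in (a^-1 * (f x * (nat_of_bool X)%:R) <= _)%R](_ : _ = false); last first.
      by apply: memNset => /=; apply/negP; rewrite -leNgt.
    by rewrite !mulr0 !mulr_ge0 ?powR_ge0.
  rewrite mem_set//= mem_set ?mulr1; last first.
    split => //; rewrite /S/= lte_fin.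
    rewrite (_ : s = ((s `^ p^-1) `^ p)%R); last by rewrite -powRrM mulVf ?gt_eqF// powRr1// ltW.
    apply: gt0_ltr_powR => //; rewrite ?nnegrE ?powR_ge0 ?mulr_ge0//.
    by rewrite mulrC -ltr_pdivrMr.
  by rewrite /a invf_div -powRN (_ : q - 1 = - p^-1)%R// /q addrAC subrr add0r.
rewrite -(fubini_tonelli G mG G0).
rewrite -ge0_integralZl//; first last.
- by rewrite lee_fin divr_ge0 ?powR_ge0// ltW.
- by move=> x _; rewrite lee_fin powR_ge0.
- by apply/measurable_EFinP; exact: (measurableT_comp (measurable_powR p) mf).
apply: le_nonneg_integral => x _; first exact: integral_ge0.
have -> : \int[leb]_y G (x, y) = (2 * f x)%:E * \int[leb]_(s in `]0%R, ((2 * f x) `^ p)%R[) (s `^ (q - 1))%:E.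
  rewrite -ge0_integralZl//; first last.
  - by rewrite lee_fin mulr_ge0.
  - by move=> s _; rewrite lee_fin powR_ge0.
  - exact: measurable_powR_EFin.
  rewrite [RHS]integral_mkcond; apply: eq_integral => s _.
  rewrite patchE /G indicE; case: ifPn => h.
    rewrite mem_set ?mulr1 -?EFinM; first by congr EFin; ring.
    by move: h; rewrite inE/= in_itv/= => /andP[].
  rewrite memNset ?mulr0//; apply: contraNnot h => -[h1 h2]; rewrite inE/= in_itv/=.
  by apply/andP.
apply: (@le_trans _ _ ((2 * f x)%:E * ((((2 * f x) `^ p) `^ q) / q)%:E)).
  by rewrite lee_wpmul2l ?lee_fin ?mulr_ge0//; apply: integral_powR_near0; rewrite ?powR_ge0.
rewrite -!EFinM lee_fin -powRrM /q mulrBr mulr1 divff ?gt_eqF// -/q.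
rewrite mulrA [leRHS]mulrAC ler_pM2r ?invr_gt0//.
have [->|fx] := eqVneq (f x) 0%R; first by rewrite mulr0 mul0r mulr_ge0 ?powR_ge0.
have f2 : (0 < 2 * f x)%R by rewrite mulr_gt0// lt_neqAle eq_sym fx f0.
by rewrite -powRM// mulr_powRB1// ltW.
Qed.

End maximal_Lp.

(** * Averages against the decaying weight *)

Section weight.
Context {R : realType} {n : nat}.
Local Notation T := (Rn R n).
Implicit Types (t : R) (x y z : T).

Definition wt t x y : R := t / (t + eucl_dist x y).

Lemma wt_denom_gt0 t x y : 0 < t -> 0 < t + eucl_dist x y.
Proof. by move=> t0; rewrite ltr_pwDl// eucl_dist_ge0. Qed.

Lemma wt_gt0 t x y : 0 < t -> 0 < wt t x y.
Proof. by move=> t0; rewrite divr_gt0// wt_denom_gt0. Qed.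

Lemma wt_le1 t x y : 0 < t -> wt t x y <= 1.
Proof. by move=> t0; rewrite ler_pdivrMr ?wt_denom_gt0// mul1r lerDl eucl_dist_ge0. Qed.

Lemma wtC t x y : wt t x y = wt t y x.
Proof. by rewrite /wt eucl_distC. Qed.

(** From [(t + d) * (t + d') >= t * (t + d + d')] and the triangle inequality. *)
Lemma wtM_le t x y z : 0 < t -> wt t x y * wt t y z <= wt t x z.
Proof.
move=> t0; rewrite /wt mulf_div ler_pdivrMr ?mulr_gt0 ?wt_denom_gt0//.
rewrite mulrAC ler_pdivlMr ?wt_denom_gt0// -mulrA ler_pM2l//.
have d1 := eucl_dist_ge0 x y; have d2 := eucl_dist_ge0 y z.
have := eucl_dist_triangle y x z; nra.
Qed.

(** One of the two legs from [x] to [z] through [y] is at least half of the distance from [x] to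
    [z]. *)
Lemma wt_min_le t x y z : 0 < t ->
  wt t x y <= 2 * wt t x z \/ wt t y z <= 2 * wt t x z.
Proof.
move=> t0; have h := eucl_dist_triangle y x z.
have [h1|h1] := leP (eucl_dist x z / 2) (eucl_dist x y); [left|right];
  rewrite /wt mulrA ler_pdivrMr ?wt_denom_gt0// mulrAC ler_pdivlMr ?wt_denom_gt0//;
  rewrite -mulrA [2 * _]mulrCA ler_pM2l//; lra.
Qed.

Lemma wt_shift t x x' y : 0 < t -> wt t x y <= wt t x' y * (1 + eucl_dist x x' / t).
Proof.
move=> t0; have A0 := wt_denom_gt0 x y t0; have B0 := wt_denom_gt0 x' y t0.
rewrite (_ : wt t x' y * _ = (t + eucl_dist x x') / (t + eucl_dist x' y)); last first.
  by rewrite /wt; field; rewrite !gt_eqF.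
rewrite /wt ler_pdivrMr// mulrAC ler_pdivlMr//.
have := eucl_dist_triangle x x' y; rewrite (eucl_distC x' x).
have d1 := eucl_dist_ge0 x y; have d2 := eucl_dist_ge0 x x'; nra.
Qed.

Lemma wtE t x y : 0 < t -> wt t x y = t * (t + eucl_dist x y) `^ (-1).
Proof. by move=> t0; rewrite powR_inv1// ltW// wt_denom_gt0. Qed.

End weight.

Section decay.
Context {R : realType} {n : nat}.
Local Notation T := (Rn R n).
Variable mu : {measure set T -> \bar R}.
Local Open Scope ereal_scope.

Definition decay_cst (m a : R) : R := locked (2 `^ m / (1 - 2 `^ (- a)))%R.

Lemma measurable_wt_r (t : R) (x : T) e : (0 < t)%R -> measurable_fun setT (fun y : T => wt t x y `^ e)%R.
Proof.
move=> t0; apply: (measurableT_comp (measurable_powR e)).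
rewrite (_ : wt t x = fun y => t * (t + eucl_dist x y) `^ (-1))%R; last first.
  by apply/funext => y; rewrite wtE.
apply: measurable_funM => //; apply: (measurableT_comp (measurable_powR (-1))).
by apply: measurable_funD => //; exact: measurable_eucl_dist_l.
Qed.

Lemma integral_decay (h : T -> R) (x : T) (t m a K : R) :
  measurable_fun setT h -> (forall y, 0 <= h y)%R -> (0 < t)%R -> (0 <= m)%R -> (0 < a)%R -> (0 <= K)%R ->
  (forall r, (t <= r)%R -> \int[mu]_(y in eball x r) (h y)%:E <= (K * r `^ m)%:E) ->
  \int[mu]_y (wt t x y `^ (m + a) * h y)%:E <= (decay_cst m a * K * t `^ m)%:E.
Proof.
move=> mh h0 t0 m0 a0 K0 hK.
pose c k : R := (2 `^ (- (k%:R * (m + a))))%R.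
pose B k : set T := eball x (2 `^ (k.+1%:R) * t)%R.
have mB k : measurable (B k) by exact: measurable_eball.
pose g k y : \bar R := (c k * (h y * \1_(B k) y))%:E.
have c0 k : (0 <= c k)%R by exact: powR_ge0.
have g0 k y : 0 <= g k y by rewrite lee_fin !mulr_ge0.
have mg k : measurable_fun setT (g k).
  apply/measurable_EFinP; apply: measurable_funM => //; apply: measurable_funM => //.
have q1 : (2 `^ (- a) < 1 :> R)%R.
  rewrite powRN invf_lt1 ?powR_gt0// /powR pnatr_eq0/= -[ltLHS]expR0 ltr_expR.
  by rewrite mulr_gt0// ln_gt0// ltr1n.
apply: (@le_trans _ _ (\int[mu]_y (\sum_(k <oo) g k y))).
  apply: le_nonneg_integral => y _; first by rewrite lee_fin mulr_ge0// powR_ge0.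
  pose v := ((t + eucl_dist x y) / t)%R.
  have v1 : (1 <= v)%R by rewrite ler_pdivlMr// mul1r lerDl eucl_dist_ge0.
  have v0 : (0 < v)%R by exact: lt_le_trans v1.
  have [j /andP[jv vj]] := dyadic_near v0.
  (* Since [1 <= v], the dyadic scale of [v] is nonnegative and indexes the shell of [y]. *)
  have [k kj] : exists k : nat, j = k%:Z.
    case: j jv vj => [k _ _|k _]; first by exists k.
    rewrite /dyadic => vk; exfalso; move: vk.
    apply/negP; rewrite -leNgt; apply: le_trans v1; rewrite -[leRHS](powRr0 2) ler_powR ?ler1n//.
  subst j.
  have wv : wt t x y = (v^-1)%R by rewrite /wt /v invf_div.
  have yB : B k y.
    rewrite /B /eball/=; move: vj; rewrite /dyadic intrD => hv.
    rewrite (_ : k.+1%:R = k%:~R + 1%:~R :> R)%R; last by rewrite -[LHS]natr1.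
    rewrite -ltr_pdivrMr//; apply: le_lt_trans hv.
    by rewrite ler_pM2r ?invr_gt0// lerDr ltW.
  apply: (@le_trans _ _ (g k y)).
    rewrite lee_fin /g indicE mem_set// mulr1 ler_wpM2r//.
    rewrite wv /c -powR_inv1 ?(ltW v0)// -powRrM mulN1r !powRN lef_pV2 ?posrE ?powR_gt0//.
    rewrite powRrM; apply: ge0_ler_powR; rewrite ?nnegrE ?powR_ge0 ?(ltW v0)//.
    by rewrite addr_ge0// ltW.
  apply: (@le_trans _ _ (\sum_(0 <= i < k.+1) g i y)).
    by rewrite big_nat_recr//= leeDr// sume_ge0.
  by apply: nneseries_lim_ge => i _ _.
rewrite integral_nneseries//.
apply: lime_le; first by apply: is_cvg_nneseries => k *; exact: integral_ge0.
apply: nearW => N.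
apply: (@le_trans _ _ (\sum_(0 <= k < N) (K * t `^ m * 2 `^ m * (2 `^ (- a)) ^+ k)%:E)).
  apply: lee_sum => k _.
  have -> : \int[mu]_y g k y = (c k)%:E * \int[mu]_(y in B k) (h y)%:E.
    have mhB : measurable_fun (B k) (fun y => (h y)%:E).
      by apply/measurable_EFinP; exact: measurable_funTS.
    have h0E y : B k y -> 0 <= (h y)%:E by rewrite lee_fin.
    rewrite -ge0_integralZl// ?lee_fin//.
    rewrite [RHS]integral_mkcond; apply: eq_integral => y _.
    rewrite patchE /g indicE; case: ifPn => _; last by rewrite !mulr0.
    by rewrite mulr1.
  apply: (@le_trans _ _ ((c k)%:E * (K * (2 `^ k.+1%:R * t) `^ m)%:E)).
    rewrite lee_wpmul2l ?lee_fin//; apply: hK.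
    rewrite ler_peMl ?(ltW t0)// -[leLHS](powRr0 2) ler_powR ?ler1n//.
  rewrite -EFinM lee_fin powRM ?powR_ge0 ?(ltW t0)//.
  rewrite le_eqVlt; apply/orP; left; apply/eqP.
  rewrite -powR_mulrn ?powR_ge0// -!powRrM /c.
  have -> : (2 `^ (- a * k%:R) = 2 `^ (- (k%:R * (m + a))) * 2 `^ (k.+1%:R * m) * 2 `^ (- m) :> R)%R.
    rewrite -!powRD; try by rewrite pnatr_eq0 implybT.
    by congr (_ `^ _)%R; rewrite -natr1; ring.
  by rewrite [(2 `^ (- m))%R]powRN; field; rewrite gt_eqF// powR_gt0.
rewrite sumEFin lee_fin -mulr_sumr /decay_cst -lock.
rewrite [leRHS](_ : _ = K * t `^ m * 2 `^ m * (1 - 2 `^ (- a))^-1)%R; last by ring.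
rewrite ler_wpM2l ?mulr_ge0 ?powR_ge0//.
have := subrX1 (2 `^ (- a) : R) N.
rewrite -[leRHS]mul1r ler_pdivlMr ?subr_gt0// big_mkord => e.
have : (0 <= (2 `^ (- a)) ^+ N :> R)%R by rewrite exprn_ge0// powR_ge0.
set S := (\sum_(i < N) _)%R in e *; nra.
Qed.

End decay.

Section average.
Context {R : realType} {n : nat}.
Local Notation T := (Rn R n).
Variable mu : {sigma_finite_measure set T -> \bar R}.
Variables m a Cm : R.
Hypotheses (m0 : 0 < m) (a0 : 0 < a) (Cm0 : 0 <= Cm).
Hypothesis mu_power : forall (x : T) r, 0 < r ->
  (mu [set y | (sup_dist x y <= r)%R] <= (Cm * r `^ m)%:E)%E.
Local Open Scope ereal_scope.

Lemma measurable_sup_ball (x : T) s : measurable [set y : T | (sup_dist x y <= s)%R].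
Proof.
rewrite (_ : [set y | _] = [set: T] `&` sup_dist x @^-1` `]-oo, s]%classic).
  exact: (measurable_sup_dist_l _ measurableT).
by rewrite setTI; apply/seteqP; split => y; rewrite /= in_itv.
Qed.

Lemma mu_sup_ball_lty (x : T) r : mu [set y | (sup_dist x y <= r)%R] < +oo.
Proof.
apply: (@le_lt_trans _ _ (mu [set y | (sup_dist x y <= Num.max 1 r)%R])).
  apply: le_measure; rewrite ?inE; try exact: measurable_sup_ball.
  by move=> y /= h; rewrite (le_trans h)// le_max lexx orbT.
apply: le_lt_trans (mu_power _ _) _; last by rewrite ltry.
by rewrite lt_max ltr01.
Qed.

Definition avg_cst : R := locked (decay_cst m a * Cm * 20 `^ m)%R.

Lemma decay_cst_ge0 : (0 <= decay_cst m a)%R.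
Proof.
rewrite /decay_cst -lock divr_ge0 ?powR_ge0// subr_ge0 powRN invf_le1 ?powR_gt0//.
by rewrite -[leLHS](powRr0 2) ler_powR ?ler1n// ltW.
Qed.

Lemma avg_cst_ge0 : (0 <= avg_cst)%R.
Proof. by rewrite /avg_cst -lock !mulr_ge0 ?powR_ge0 ?decay_cst_ge0. Qed.

Definition pavg (f : T -> R) (t : R) (y : T) : \bar R :=
  \int[mu]_z (wt t y z `^ (m + a) * f z)%:E.

Lemma pavg_ge0 f t y : (forall z, 0 <= f z)%R -> 0 <= pavg f t y.
Proof. by move=> f0; apply: integral_ge0 => z _; rewrite lee_fin mulr_ge0 ?powR_ge0. Qed.

Lemma measurable_wt2 (t e : R) : (0 < t)%R ->
  measurable_fun setT (fun p : T * T => wt t p.1 p.2 `^ e)%R.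
Proof.
move=> t0; apply: (measurableT_comp (measurable_powR e)).
rewrite (_ : (fun _ => _) = fun p : T * T => t * (t + eucl_dist p.1 p.2) `^ (-1))%R; last first.
  by apply/funext => y; rewrite wtE.
apply: measurable_funM => //; apply: (measurableT_comp (measurable_powR (-1))).
by apply: measurable_funD => //; exact: measurable_eucl_dist.
Qed.

Lemma integral_wt_le (t : R) (x : T) : (0 < t)%R ->
  \int[mu]_y (wt t x y `^ (m + a))%:E <= (decay_cst m a * Cm * t `^ m)%:E.
Proof.
move=> t0.
have := @integral_decay R n mu (fun=> 1%R) x t m a Cm.
under eq_integral do rewrite mulr1.
apply => //; first exact: ltW.
move=> r tr; have r0 : (0 < r)%R by exact: lt_le_trans tr.
rewrite integral_cst; last exact: measurable_eball.
rewrite mul1e; apply: le_trans (mu_power x r0).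
apply: le_measure; rewrite ?inE; [exact: measurable_eball|exact: measurable_sup_ball|].
by move=> y; rewrite /eball/= => h; rewrite (le_trans (sup_dist_le_eucl _ _))// ltW.
Qed.

Section one_function.
Variable f : T -> R.
Hypotheses (mf : measurable_fun setT f) (f0 : forall x, (0 <= f x)%R) (fint : locint mu f).
Variables (x : T) (K : R).
Hypotheses (K0 : (0 <= K)%R) (MK : maximal mu f x <= K%:E).

(** The ball about [y] lies in the ball of radius [r + eucl_dist x y] about [x]. As [t <= r], that
    radius is at most [r / wt t x y], which explains the power [- m] of the weight. *)
Lemma integral_eball_le_maximal (t r : R) (y : T) : (0 < t)%R -> (t <= r)%R ->
  \int[mu]_(z in eball y r) (f z)%:E <= (K * Cm * 20 `^ m * wt t x y `^ (- m) * r `^ m)%:E.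
Proof.
move=> t0 tr; have r0 : (0 < r)%R by exact: lt_le_trans tr.
have d0 := eucl_dist_ge0 x y.
have rd0 : (0 < r + eucl_dist x y)%R by rewrite ltr_pwDl.
apply: (@le_trans _ _ (\int[mu]_(z in [set z | (sup_dist x z <= r + eucl_dist x y)%R]) (f z)%:E)).
  apply: ge0_subset_integral => //; [exact: measurable_eball|exact: measurable_sup_ball| | |].
  - by apply/measurable_EFinP; exact: measurable_funTS.
  - by move=> z _; rewrite lee_fin.
  - move=> z; rewrite /eball/= => yz.
    rewrite (le_trans (sup_dist_triangle y _ _))// addrC lerD ?sup_dist_le_eucl//.
    by rewrite (le_trans (sup_dist_le_eucl _ _))// ltW.
have h := integral_ball_le_maximal mu_sup_ball_lty mf f0 fint rd0 MK.
apply: (le_trans h).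
apply: (@le_trans _ _ (K%:E * (Cm * (20 * (r + eucl_dist x y)) `^ m)%:E)).
  by rewrite lee_wpmul2l ?lee_fin// mu_power// mulr_gt0.
rewrite -EFinM lee_fin powRM ?(ltW rd0)// -!mulrA ler_wpM2l// ler_wpM2l// ler_wpM2l ?powR_ge0//.
have w0 := wt_gt0 x y t0.
rewrite powRN -powR_inv1 ?powR_ge0// -powRrM mulrN1 -mulN1r powRrM powR_inv1 ?(ltW w0)//.
rewrite -powRM ?invr_ge0 ?(ltW w0) ?(ltW r0)//.
apply: ge0_ler_powR; rewrite ?nnegrE ?mulr_ge0 ?invr_ge0 ?(ltW w0) ?(ltW r0) ?(ltW rd0) ?(ltW m0)//.
rewrite /wt invf_div mulrAC ler_pdivlMr//; nra.
Qed.

Lemma pavg_le (t : R) (y : T) : (0 < t)%R ->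
  pavg f t y <= (avg_cst * K * wt t x y `^ (- m) * t `^ m)%:E.
Proof.
move=> t0.
have := @integral_decay R n mu f y t m a (K * Cm * 20 `^ m * wt t x y `^ (- m))%R mf f0 t0 (ltW m0) a0.
rewrite (_ : decay_cst m a * _ = avg_cst * K * wt t x y `^ (- m))%R; last by rewrite /avg_cst -lock; ring.
apply; first by rewrite !mulr_ge0 ?powR_ge0.
by move=> r tr; exact: integral_eball_le_maximal.
Qed.

Definition conv_cst : R := locked (2 `^ (m + a) * 2 * decay_cst m a * Cm * avg_cst)%R.

Lemma conv_cst_ge0 : (0 <= conv_cst)%R.
Proof. by rewrite /conv_cst -lock !mulr_ge0 ?powR_ge0 ?decay_cst_ge0 ?avg_cst_ge0. Qed.

Lemma conv_pavg_le (t : R) : (0 < t)%R ->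
  \int[mu]_y ((wt t x y `^ (m + a))%:E * pavg f t y) <= (conv_cst * K * t `^ m * t `^ m)%:E.
Proof.
move=> t0; set e := (m + a)%R.
have e0 : (0 <= e)%R by rewrite addr_ge0// ltW.
pose G (p : T * T) : \bar R := (wt t x p.1 `^ e * wt t p.1 p.2 `^ e * f p.2)%:E.
have mG : measurable_fun setT G.
  apply/measurable_EFinP; apply: measurable_funM; last exact: (measurableT_comp mf measurable_snd).
  apply: measurable_funM; last exact: measurable_wt2.
  exact: (measurableT_comp (measurable_wt_r x e t0) measurable_fst).
have G0 p : 0 <= G p by rewrite lee_fin !mulr_ge0// powR_ge0.
have mW y : measurable_fun setT (fun z : T => wt t y z `^ e)%R by exact: measurable_wt_r.
have -> : \int[mu]_y ((wt t x y `^ e)%:E * pavg f t y) = \int[mu]_y \int[mu]_z G (y, z).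
  apply: eq_integral => y _; rewrite /pavg -ge0_integralZl//; first last.
  - by rewrite lee_fin powR_ge0.
  - by move=> z _; rewrite lee_fin mulr_ge0 ?powR_ge0.
  - by apply/measurable_EFinP; apply: measurable_funM.
  by apply: eq_integral => z _; rewrite /G/= -EFinM mulrA.
rewrite (fubini_tonelli G mG G0).
pose D := (decay_cst m a * Cm * t `^ m)%R.
have D0 : (0 <= D)%R by rewrite !mulr_ge0 ?decay_cst_ge0 ?powR_ge0.
have cD0 : (0 <= 2 `^ e * 2 * D)%R by rewrite mulr_ge0// mulr_ge0 ?powR_ge0.
apply: (@le_trans _ _ (\int[mu]_z ((2 `^ e * 2 * D)%:E * (wt t x z `^ e * f z)%:E))).
  apply: le_nonneg_integral => z _; first exact: integral_ge0.
  apply: (@le_trans _ _ (\int[mu]_y (((2 * wt t x z) `^ e * f z)%:E *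
      ((wt t x y `^ e)%:E + (wt t z y `^ e)%:E)))).
    apply: le_nonneg_integral => y _; first exact: G0.
    rewrite /G/= -EFinD -EFinM lee_fin [leRHS]mulrAC ler_wpM2r//.
    rewrite (wtC t z y).
    have wp u v : (0 <= wt t u v)%R by rewrite ltW// wt_gt0.
    have [h|h] := wt_min_le x y z t0.
      apply: (@le_trans _ _ ((2 * wt t x z) `^ e * wt t y z `^ e)%R).
        rewrite ler_wpM2r ?powR_ge0//; apply: ge0_ler_powR => //;
        by rewrite nnegrE ?wp// mulr_ge0 ?wp.
      by rewrite ler_wpM2l ?powR_ge0// lerDr powR_ge0.
    apply: (@le_trans _ _ ((2 * wt t x z) `^ e * wt t x y `^ e)%R).
      rewrite mulrC ler_wpM2r ?powR_ge0//; apply: ge0_ler_powR => //;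
      by rewrite nnegrE ?wp// mulr_ge0 ?wp.
    by rewrite ler_wpM2l ?powR_ge0// lerDl powR_ge0.
  rewrite ge0_integralZl//; first last.
  - by rewrite lee_fin mulr_ge0 ?powR_ge0.
  - by move=> y _; rewrite adde_ge0// lee_fin powR_ge0.
  - by apply: emeasurable_funD; apply/measurable_EFinP.
  rewrite ge0_integralD//; first last.
  - by apply/measurable_EFinP.
  - by move=> y _; rewrite lee_fin powR_ge0.
  - by apply/measurable_EFinP.
  - by move=> y _; rewrite lee_fin powR_ge0.
  apply: (@le_trans _ _ (((2 * wt t x z) `^ e * f z)%:E * (D%:E + D%:E))).
    rewrite lee_wpmul2l ?lee_fin ?mulr_ge0 ?powR_ge0//; apply: leeD; exact: integral_wt_le.
  rewrite -EFinD -!EFinM lee_fin powRM ?(ltW (wt_gt0 _ _ _))//.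
  by rewrite le_eqVlt; apply/orP; left; apply/eqP; ring.
rewrite ge0_integralZl//; first last.
- by move=> z _; rewrite lee_fin mulr_ge0 ?powR_ge0.
- by apply/measurable_EFinP; apply: measurable_funM.
apply: (@le_trans _ _ ((2 `^ e * 2 * D)%:E * (avg_cst * K * wt t x x `^ (- m) * t `^ m)%:E)).
  by rewrite lee_wpmul2l ?lee_fin//; exact: pavg_le.
rewrite -EFinM lee_fin /wt eucl_distxx addr0 divff ?gt_eqF// powR1 mulr1 /conv_cst -lock /D -/e.
by rewrite le_eqVlt; apply/orP; left; apply/eqP; ring.
Qed.

End one_function.

(** * Products of averages against the weight of the square function *)

Section key.
Variables (k : nat) (f : 'I_k.+1 -> T -> R).
Hypotheses (mf : forall i, measurable_fun setT (f i)) (f0 : forall i x, (0 <= f i x)%R)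
  (fint : forall i, locint mu (f i)).
Variables (x : T) (K : 'I_k.+1 -> R).
Hypotheses (K0 : forall i, (0 <= K i)%R) (MK : forall i, maximal mu (f i) x <= (K i)%:E).

Definition key_cst : R := (conv_cst * avg_cst ^+ k.+1 * avg_cst ^+ k)%R.

Lemma pavg_fin i t y : (0 < t)%R -> pavg (f i) t y \is a fin_num.
Proof.
move=> t0; rewrite ge0_fin_numE; last exact: pavg_ge0.
by apply: (le_lt_trans (pavg_le (mf i) (f0 i) (fint i) (K0 i) (MK i) y t0)); rewrite ltry.
Qed.

(** The square of the product has [2 * k.+1] factors. All but one are bounded by [pavg_le], each
    costing the weight to the power [- m]; the last is integrated by [conv_pavg_le], which consumes
    the weight to the power [m + a]. With the loss [2 * g] from the square of the prefactor this
    adds up to the exponent required of [m * lam]. *)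
Lemma key_estimate (t D g lam : R) (Th : T -> R) : (0 < t)%R -> (0 <= D)%R -> (0 <= g)%R ->
  (2 * g + 2 * k.+1%:R * m + a <= m * lam)%R ->
  (forall y, 0 <= Th y)%R ->
  (forall y, Th y <= D * wt t x y `^ (- g) * \prod_i (fine (pavg (f i) t y) / t `^ m))%R ->
  \int[mu]_y (wt t x y `^ (m * lam) * Th y ^+ 2)%:E <=
    (key_cst * D ^+ 2 * (\prod_i K i) ^+ 2 * t `^ m)%:E.
Proof.
move=> t0 D0 g0 hlam Th0 Thle.
pose q i y := (fine (pavg (f i) t y) / t `^ m)%R.
pose v y := (wt t x y `^ (- m))%R.
have tm0 : (0 < t `^ m)%R by exact: powR_gt0.
have q0 i y : (0 <= q i y)%R by rewrite divr_ge0 ?fine_ge0 ?pavg_ge0// ltW.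
have v0 y : (0 <= v y)%R by exact: powR_ge0.
have qle i y : (q i y <= avg_cst * K i * v y)%R.
  rewrite /q ler_pdivrMr// -lee_fin fineK ?pavg_fin//.
  exact: pavg_le.
have c0 := avg_cst_ge0.
pose P0 := (\prod_(i < k) K (lift ord0 i))%R.
have P00 : (0 <= P0)%R by exact: prodr_ge0.
pose E := (D ^+ 2 * (avg_cst ^+ k.+1 * (K ord0 * P0)) * (avg_cst ^+ k * P0))%R.
have E0 : (0 <= E)%R by rewrite !mulr_ge0 ?exprn_ge0.
have pt y : (wt t x y `^ (m * lam) * Th y ^+ 2 <= E * (wt t x y `^ (m + a) * q ord0 y))%R.
  have w0 := wt_gt0 x y t0; have w1 := wt_le1 x y t0.
  have pr1 : (\prod_i q i y <= avg_cst ^+ k.+1 * (K ord0 * P0) * v y ^+ k.+1)%R.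
    apply: (@le_trans _ _ (\prod_i (avg_cst * K i * v y))%R).
      by apply: ler_prod => i _; rewrite q0 qle.
    rewrite !big_split/= !prodr_const !card_ord big_ord_recl//.
  have pr2 : (\prod_i q i y <= q ord0 y * (avg_cst ^+ k * P0 * v y ^+ k))%R.
    rewrite big_ord_recl ler_wpM2l//.
    apply: (@le_trans _ _ (\prod_(i < k) (avg_cst * K (lift ord0 i) * v y))%R).
      by apply: ler_prod => i _; rewrite q0 qle.
    by rewrite !big_split/= !prodr_const !card_ord.
  have pr0 : (0 <= \prod_i q i y)%R by exact: prodr_ge0.
  have Th2 : (Th y ^+ 2 <= (D * wt t x y `^ (- g)) ^+ 2 *
     ((avg_cst ^+ k.+1 * (K ord0 * P0) * v y ^+ k.+1) * (q ord0 y * (avg_cst ^+ k * P0 * v y ^+ k))))%R.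
    apply: (@le_trans _ _ ((D * wt t x y `^ (- g) * \prod_i q i y) ^+ 2)%R).
      by rewrite lerXn2r ?nnegrE ?mulr_ge0 ?powR_ge0//; exact: Thle.
    rewrite exprMn [in leLHS](expr2 (\prod_i _)) ler_wpM2l ?sqr_ge0// ler_pM//.
  apply: (le_trans (ler_wpM2l (powR_ge0 _ _) Th2)).
  have -> : (wt t x y `^ (m * lam) * ((D * wt t x y `^ (- g)) ^+ 2 *
     ((avg_cst ^+ k.+1 * (K ord0 * P0) * v y ^+ k.+1) * (q ord0 y * (avg_cst ^+ k * P0 * v y ^+ k)))) =
     E * (wt t x y `^ (m * lam) * (wt t x y `^ (- g)) ^+ 2 * v y ^+ k.+1 * v y ^+ k * q ord0 y))%R.
    by rewrite /E; ring.
  rewrite ler_wpM2l// ler_wpM2r//.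
  rewrite /v -!powR_mulrn ?powR_ge0// -!powRrM -!powRD; try by rewrite (gt_eqF w0) implybT.
  rewrite /powR !gt_eqF// ler_expR; apply: ler_wnM2r; first by rewrite ln_le0.
  by move: hlam; rewrite -natr1; lra.
apply: (@le_trans _ _ (\int[mu]_y ((E / t `^ m)%:E * ((wt t x y `^ (m + a))%:E * pavg (f ord0) t y)))).
  apply: le_nonneg_integral => y _; first by rewrite lee_fin mulr_ge0 ?powR_ge0 ?sqr_ge0.
  rewrite -(fineK (pavg_fin ord0 y t0)) -!EFinM lee_fin; apply: (le_trans (pt y)).
  by rewrite /q le_eqVlt; apply/orP; left; apply/eqP; field; rewrite gt_eqF.
rewrite ge0_integralZl//; first last.
- by rewrite lee_fin divr_ge0// ltW.
- by move=> y _; rewrite mule_ge0 ?lee_fin ?powR_ge0 ?pavg_ge0.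
- apply: emeasurable_funM; first by apply/measurable_EFinP; exact: measurable_wt_r.
  pose G (p : T * T) : \bar R := (wt t p.1 p.2 `^ (m + a) * f ord0 p.2)%:E.
  apply: (@measurable_fun_fubini_tonelli_F _ _ _ _ _ mu G).
    apply/measurable_EFinP; apply: measurable_funM; first exact: measurable_wt2.
    exact: (measurableT_comp (mf ord0) measurable_snd).
  by move=> p; rewrite lee_fin mulr_ge0 ?powR_ge0.
apply: (@le_trans _ _ ((E / t `^ m)%:E * (conv_cst * K ord0 * t `^ m * t `^ m)%:E)).
  by rewrite lee_wpmul2l ?lee_fin ?divr_ge0 ?(ltW tm0)//; exact: conv_pavg_le.
rewrite -EFinM lee_fin /E /key_cst big_ord_recl -/P0.
by rewrite le_eqVlt; apply/orP; left; apply/eqP; field; rewrite gt_eqF.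
Qed.

End key.
End average.

(** * Iterated complex integrals and measures with a density *)

Section cmod_lemmas.
Context {R : realType}.
Implicit Types z w : R[i].

Lemma cmodE z : cmod z = Num.sqrt (complex.Re z ^+ 2 + complex.Im z ^+ 2).
Proof. by case: z. Qed.

Lemma cmod_ge0 z : 0 <= cmod z.
Proof. by rewrite cmodE sqrtr_ge0. Qed.

Lemma normr_Re_le_cmod z : `|complex.Re z| <= cmod z.
Proof. by rewrite cmodE -sqrtr_sqr ler_wsqrtr// lerDl sqr_ge0. Qed.

Lemma normr_Im_le_cmod z : `|complex.Im z| <= cmod z.
Proof. by rewrite cmodE -sqrtr_sqr ler_wsqrtr// lerDr sqr_ge0. Qed.

Lemma cmod_le_normr z : cmod z <= `|complex.Re z| + `|complex.Im z|.
Proof.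
rewrite cmodE -(ler_pXn2r (_ : 0 < 2)%N) ?nnegrE ?sqrtr_ge0 ?addr_ge0//.
rewrite sqr_sqrtr ?addr_ge0 ?sqr_ge0// sqrrD !real_normK ?num_real//.
by rewrite lerD2r lerDl mulrn_wge0// mulr_ge0.
Qed.

Lemma ReD z w : complex.Re (z + w) = complex.Re z + complex.Re w. Proof. by case: z w => ? ? []. Qed.
Lemma ImD z w : complex.Im (z + w) = complex.Im z + complex.Im w. Proof. by case: z w => ? ? []. Qed.
Lemma ReM z w : complex.Re (z * w) =
  complex.Re z * complex.Re w - complex.Im z * complex.Im w.
Proof. by case: z w => ? ? []. Qed.
Lemma ImM z w : complex.Im (z * w) =
  complex.Re z * complex.Im w + complex.Im z * complex.Re w.
Proof. by case: z w => a b [c d] /=. Qed.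

Lemma cmodM z w : cmod (z * w) = cmod z * cmod w.
Proof. exact: ComplexField.Normc.normcM. Qed.

Lemma cmodD z w : cmod (z + w) <= cmod z + cmod w.
Proof. exact: le_normcD. Qed.

Lemma cmod_prod (I : finType) (f : I -> R[i]) : cmod (\prod_i f i) = \prod_i cmod (f i).
Proof.
elim/big_ind2 : _ => //; first exact: ComplexField.Normc.normc1.
by move=> x1 x2 y1 y2 <- <-; exact: cmodM.
Qed.

Lemma cmod0 : cmod (0 : R[i]) = 0.
Proof. exact: ComplexField.Normc.normc0. Qed.

End cmod_lemmas.

Section cmeasurable.
Context {d} {T : measurableType d} {R : realType}.
Implicit Types (D : set T) (f g : T -> R[i]).

Lemma cmeasurable_cmod D f : cmeasurable_fun D f -> measurable_fun D (fun x => cmod (f x)).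
Proof.
move=> [mr mi]; rewrite (_ : (fun _ => _) =
  fun x => ((complex.Re (f x)) ^+ 2 + (complex.Im (f x)) ^+ 2) `^ 2^-1); last first.
  by apply/funext => x; rewrite cmodE powR12_sqrt// addr_ge0 ?sqr_ge0.
apply: (measurableT_comp (measurable_powR _)).
by apply: measurable_funD; apply: measurable_funX.
Qed.

Lemma cmeasurable_funM D f g : cmeasurable_fun D f -> cmeasurable_fun D g ->
  cmeasurable_fun D (fun x => f x * g x).
Proof.
move=> [fr fi] [gr gi]; split.
- rewrite (_ : (fun _ => _) = fun x => complex.Re (f x) * complex.Re (g x) -
    complex.Im (f x) * complex.Im (g x)).
    by apply: measurable_funB; apply: measurable_funM.
  by apply/funext => x; rewrite ReM.
- rewrite (_ : (fun _ => _) = fun x => complex.Re (f x) * complex.Im (g x) +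
    complex.Im (f x) * complex.Re (g x)).
    by apply: measurable_funD; apply: measurable_funM.
  by apply/funext => x; rewrite ImM.
Qed.

Lemma cmeasurable_cst D (c : R[i]) : cmeasurable_fun D (fun=> c).
Proof. by split; exact: measurable_cst. Qed.

Lemma cmeasurable_prod D k (h : 'I_k -> T -> R[i]) :
  (forall i, cmeasurable_fun D (h i)) -> cmeasurable_fun D (fun x => \prod_i h i x).
Proof.
elim: k h => [|k ih] h mh.
  rewrite (_ : (fun _ => _) = fun=> 1); first exact: cmeasurable_cst.
  by apply/funext => x; rewrite big_ord0.
rewrite (_ : (fun _ => _) = fun x => h ord0 x * \prod_(i < k) h (lift ord0 i) x); last first.
  by apply/funext => x; rewrite big_ord_recl.
by apply: cmeasurable_funM => //; apply: ih => i.
Qed.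

End cmeasurable.

Lemma cmeasurable_comp {d1 d2} {T1 : measurableType d1} {T2 : measurableType d2} {R : realType}
    (f : T2 -> R[i]) (g : T1 -> T2) :
  cmeasurable_fun setT f -> measurable_fun setT g -> cmeasurable_fun setT (fun x => f (g x)).
Proof. by move=> [fr fi] mg; split; [exact: (measurableT_comp fr mg)|exact: (measurableT_comp fi mg)]. Qed.

Section cintegral.
Context {d} {T : measurableType d} {R : realType} (mu : {sigma_finite_measure set T -> \bar R}).

(** Tonelli for the positive and the negative part, followed by the measurable map [fine]; the
    slices may fail to be integrable. *)
Lemma measurable_Rintegral {dP} {P : measurableType dP} (G : P * T -> R) :
  measurable_fun setT G -> measurable_fun setT (fun p => Rintegral mu setT (fun z => G (p, z))).
Proof.
move=> mG; apply: (measurableT_comp (fine_measurable measurableT)).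
have mG' : measurable_fun setT (EFin \o G) by exact/measurable_EFinP.
rewrite (_ : (fun _ => _) = (fun p => (\int[mu]_z ((EFin \o G)^\+ (p, z)) -
    \int[mu]_z ((EFin \o G)^\- (p, z)))%E)); last first.
  apply/funext => p; rewrite integralE; congr (_ - _)%E; apply: eq_integral => z _.
    by rewrite !funeposE.
  by rewrite !funenegE.
apply: emeasurable_funB.
- apply: (measurable_fun_fubini_tonelli_F (m2 := mu) ((EFin \o G)^\+)%E).
    exact: measurable_funepos.
  by move=> ?; exact: funepos_ge0.
- apply: (measurable_fun_fubini_tonelli_F (m2 := mu) ((EFin \o G)^\-)%E).
    exact: measurable_funeneg.
  by move=> ?; exact: funeneg_ge0.
Qed.

Lemma measurable_cintegral {dP} {P : measurableType dP} (F : P * T -> R[i]) :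
  cmeasurable_fun setT F -> cmeasurable_fun setT (fun p => cintegral mu (fun z => F (p, z))).
Proof.
by move=> [mr mi]; split; [exact: (measurable_Rintegral mr)|exact: (measurable_Rintegral mi)].
Qed.

Definition dominated (k : T -> R) (F : T -> R[i]) :=
  cmeasurable_fun setT F /\ forall z, cmod (F z) <= k z.

Variable k : T -> R.
Hypothesis ik : mu.-integrable setT (EFin \o k).

Lemma dominated_integrable F : dominated k F ->
  mu.-integrable setT (EFin \o (fun z => complex.Re (F z))) /\
  mu.-integrable setT (EFin \o (fun z => complex.Im (F z))).
Proof.
move=> [[mr mi] Fk]; split; apply: le_integrable ik => //; try exact/measurable_EFinP.
- move=> z _ /=; rewrite lee_fin; apply: le_trans (normr_Re_le_cmod _) _.
  by rewrite (le_trans (Fk _))// ler_norm.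
- move=> z _ /=; rewrite lee_fin; apply: le_trans (normr_Im_le_cmod _) _.
  by rewrite (le_trans (Fk _))// ler_norm.
Qed.

(** The factor 2 comes from treating real and imaginary parts separately; it becomes [2 ^+ k] for
    iterated integrals. *)
Lemma cmod_cintegral_le F : dominated k F -> cmod (cintegral mu F) <= 2 * Rintegral mu setT k.
Proof.
move=> dF; have [ir ii] := dominated_integrable dF; have [_ Fk] := dF.
apply: (le_trans (cmod_le_normr _)) => /=; rewrite mulr_natl mulr2n; apply: lerD.
- apply: (le_trans (le_normr_Rintegral measurableT ir)); apply: le_Rintegral => //.
    exact: integrable_norm.
  by move=> z _; exact: le_trans (normr_Re_le_cmod _) (Fk z).
- apply: (le_trans (le_normr_Rintegral measurableT ii)); apply: le_Rintegral => //.
    exact: integrable_norm.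
  by move=> z _; exact: le_trans (normr_Im_le_cmod _) (Fk z).
Qed.

Lemma cintegralD F G k' : mu.-integrable setT (EFin \o k') -> dominated k F ->
  mu.-integrable setT (EFin \o (fun z => complex.Re (G z))) /\
  mu.-integrable setT (EFin \o (fun z => complex.Im (G z))) ->
  cintegral mu (fun z => F z + G z) = cintegral mu F + cintegral mu G.
Proof.
move=> ik' dF [gr gi]; have [fr fi] := dominated_integrable dF.
apply/eqP; rewrite eq_complex; apply/andP; split; apply/eqP; rewrite ?ReD ?ImD/=.
- rewrite -RintegralD//; apply: eq_Rintegral => z _; exact: ReD.
- rewrite -RintegralD//; apply: eq_Rintegral => z _; exact: ImD.
Qed.

Lemma cintegralZ (c : R[i]) F : dominated k F ->
  cintegral mu (fun z => c * F z) = c * cintegral mu F.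
Proof.
move=> dF; have [fr fi] := dominated_integrable dF.
have I (r : R) (g : T -> R) : mu.-integrable setT (EFin \o g) -> mu.-integrable setT (EFin \o (fun z => r * g z)).
  move=> ig; rewrite (_ : _ \o _ = fun x => r%:E * (EFin \o g) x)%E; last by [].
  exact: integrableZl.
apply/eqP; rewrite eq_complex; apply/andP; split; apply/eqP; rewrite ?ReM ?ImM/=.
- rewrite -!RintegralZl// -RintegralB//; try exact: I.
  by apply: eq_Rintegral => z _; exact: ReM.
- rewrite -!RintegralZl// -RintegralD//; try exact: I.
  by apply: eq_Rintegral => z _; exact: ImM.
Qed.

End cintegral.

Section iterated.
Context {d} {T : measurableType d} {R : realType} (mu : {sigma_finite_measure set T -> \bar R}).

Local Notation it k F := (iterated_integral (fun _ : 'I_k => cintegral mu) F).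

(** The parameter space is generalised in the induction, because each integration moves one more
    coordinate into it. *)
Lemma measurable_iterated k {dP} {P : measurableType dP} (F : P * k.-tuple T -> R[i]) :
  cmeasurable_fun setT F -> cmeasurable_fun setT (fun p => it k (fun zs => F (p, zs))).
Proof.
elim: k dP P F => [|k ih] dP P F mF /=.
  apply: (cmeasurable_comp mF); apply: measurable_fun_pair => //; exact: measurable_cst.
apply: (@measurable_cintegral _ _ _ mu _ _ (fun pz : P * T => it k (fun zs => F (pz.1, [tuple of pz.2 :: zs])))).
apply: (ih _ _ (fun q : (P * T) * k.-tuple T => F (q.1.1, [tuple of q.1.2 :: q.2]))).
apply: (cmeasurable_comp mF (g := fun q : (P * T) * k.-tuple T => (q.1.1, [tuple of q.1.2 :: q.2]))).
apply: measurable_fun_pair.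
  exact: (measurableT_comp measurable_fst measurable_fst).
apply: (measurable_cons (f := fun q : (P * T) * k.-tuple T => q.1.2)).
  exact: (measurableT_comp measurable_snd measurable_fst).
exact: measurable_snd.
Qed.

Lemma cmeasurable_cons k (F : k.+1.-tuple T -> R[i]) : cmeasurable_fun setT F ->
  cmeasurable_fun setT (fun p : T * k.-tuple T => F [tuple of p.1 :: p.2]).
Proof.
move=> mF; apply: (cmeasurable_comp mF); apply: measurable_cons.
  exact: measurable_fst.
exact: measurable_snd.
Qed.

(** A majorant of product form keeps this form when the first variable is frozen, so inductions on
    the number of variables only need each [q i] integrable. *)
Definition tuple_dominated k (D : R) (q : 'I_k -> T -> R) (F : k.-tuple T -> R[i]) :=
  cmeasurable_fun setT F /\ forall zs, cmod (F zs) <= D * \prod_i q i (tnth zs i).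

Lemma tuple_dominated_cons k D (q : 'I_k.+1 -> T -> R) F z : tuple_dominated D q F ->
  tuple_dominated (D * q ord0 z) (fun i => q (lift ord0 i)) (fun zs => F [tuple of z :: zs]).
Proof.
move=> [mF Fq]; split.
  apply: (cmeasurable_comp mF); apply: measurable_cons => //; exact: measurable_cst.
move=> zs; apply: le_trans (Fq _) _; rewrite big_ord_recl tnth0 mulrA.
rewrite le_eqVlt; apply/orP; left; apply/eqP; congr (_ * _).
by apply: eq_bigr => i _; rewrite tnthS.
Qed.

Lemma cmod_iterated_le k (q : 'I_k -> T -> R) D F :
  (forall i z, 0 <= q i z) -> (forall i, mu.-integrable setT (EFin \o q i)) -> 0 <= D ->
  tuple_dominated D q F ->
  cmod (it k F) <= 2 ^+ k * D * \prod_i Rintegral mu setT (q i).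
Proof.
elim: k q D F => [|k ih] q D F q0 iq D0 dF /=.
  by have := dF.2 [tuple]; rewrite !big_ord0 expr0 mul1r.
pose c := 2 ^+ k * D * \prod_(i < k) Rintegral mu setT (q (lift ord0 i)).
have step z : cmod (it k (fun zs => F [tuple of z :: zs])) <= c * q ord0 z.
  have := ih (fun i => q (lift ord0 i)) (D * q ord0 z) _ (fun i => q0 _) (fun i => iq _)
    (mulr_ge0 D0 (q0 _ _)) (tuple_dominated_cons z dF).
  by move=> h; apply: (le_trans h); rewrite /c le_eqVlt; apply/orP; left; apply/eqP; ring.
have icq : mu.-integrable setT (EFin \o (fun z => c * q ord0 z)).
  rewrite (_ : _ \o _ = fun x => c%:E * (EFin \o q ord0) x)%E; last by [].
  exact: integrableZl.
apply: (le_trans (cmod_cintegral_le icq _)).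
  split=> //; apply: (measurable_iterated (F := fun p : T * k.-tuple T => F [tuple of p.1 :: p.2])).
  exact: cmeasurable_cons dF.1.
rewrite RintegralZl// /c [in leRHS]big_ord_recl exprS le_eqVlt; apply/orP; left; apply/eqP; ring.
Qed.

Lemma iterated_dominated k (q : 'I_k.+1 -> T -> R) D F :
  (forall i z, 0 <= q i z) -> (forall i, mu.-integrable setT (EFin \o q i)) -> 0 <= D ->
  tuple_dominated D q F ->
  dominated (fun z => 2 ^+ k * D * (\prod_(i < k) Rintegral mu setT (q (lift ord0 i))) * q ord0 z)
   (fun z => it k (fun zs => F [tuple of z :: zs])).
Proof.
move=> q0 iq D0 dF; split.
  apply: (measurable_iterated (F := fun p : T * k.-tuple T => F [tuple of p.1 :: p.2])).
  exact: cmeasurable_cons dF.1.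
move=> z.
have := cmod_iterated_le (fun i => q0 _) (fun i => iq _)
    (mulr_ge0 D0 (q0 _ _)) (tuple_dominated_cons z dF).
by move=> h; apply: (le_trans h); rewrite le_eqVlt; apply/orP; left; apply/eqP; ring.
Qed.

Lemma integrableZq (q : T -> R) c : mu.-integrable setT (EFin \o q) ->
  mu.-integrable setT (EFin \o (fun z => c * q z)).
Proof.
move=> iq; rewrite (_ : _ \o _ = fun x => c%:E * (EFin \o q) x)%E; last by [].
exact: integrableZl.
Qed.

Lemma iteratedD k (q : 'I_k -> T -> R) D F G :
  (forall i z, 0 <= q i z) -> (forall i, mu.-integrable setT (EFin \o q i)) -> 0 <= D ->
  tuple_dominated D q F -> tuple_dominated D q G ->
  it k (fun zs => F zs + G zs) = it k F + it k G.
Proof.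
elim: k q D F G => [//|k ih] q D F G q0 iq D0 dF dG /=.
rewrite (_ : (fun z => _) = (fun z => it k (fun zs => F [tuple of z :: zs]) +
    it k (fun zs => G [tuple of z :: zs]))); last first.
  apply/funext => z.
  exact: (ih _ _ _ _ (fun i => q0 _) (fun i => iq _) (mulr_ge0 D0 (q0 _ _))
    (tuple_dominated_cons z dF) (tuple_dominated_cons z dG)).
have h1 := iterated_dominated q0 iq D0 dF.
have h2 := iterated_dominated q0 iq D0 dG.
have i1 := integrableZq (2 ^+ k * D * (\prod_(i < k) Rintegral mu setT (q (lift ord0 i)))) (iq ord0).
by apply: (cintegralD i1 i1 h1); exact: (dominated_integrable i1 h2).
Qed.

Lemma iteratedZ k (q : 'I_k -> T -> R) D F (c : R[i]) :
  (forall i z, 0 <= q i z) -> (forall i, mu.-integrable setT (EFin \o q i)) -> 0 <= D ->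
  tuple_dominated D q F ->
  it k (fun zs => c * F zs) = c * it k F.
Proof.
elim: k q D F => [//|k ih] q D F q0 iq D0 dF /=.
rewrite (_ : (fun z => _) = (fun z => c * it k (fun zs => F [tuple of z :: zs]))); last first.
  apply/funext => z.
  exact: (ih _ _ _ (fun i => q0 _) (fun i => iq _) (mulr_ge0 D0 (q0 _ _))
    (tuple_dominated_cons z dF)).
have h1 := iterated_dominated q0 iq D0 dF.
have i1 := integrableZq (2 ^+ k * D * (\prod_(i < k) Rintegral mu setT (q (lift ord0 i)))) (iq ord0).
exact: (cintegralZ i1 c h1).
Qed.

End iterated.

(** * Complex measures with a density *)

Section density.
Context {d} {T : measurableType d} {R : realType} (mu : {sigma_finite_measure set T -> \bar R}).
Local Open Scope ereal_scope.
Local Open Scope charge_scope.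

(** [g] and the Radon-Nikodym derivative have the same integral over every measurable set, hence
    agree almost everywhere. *)
Lemma integral_density (nu : {finite_measure set T -> \bar R}) (g : T -> R) (phi : T -> R) :
  mu.-integrable setT (EFin \o g) ->
  (forall A, measurable A -> nu A = \int[mu]_(x in A) (g x)%:E) ->
  nu.-integrable setT (EFin \o phi) ->
  \int[nu]_x (phi x)%:E = \int[mu]_x (phi x * g x)%:E.
Proof.
move=> ig nug iphi.
have mphi : measurable_fun setT (EFin \o phi) by exact: measurable_int iphi.
have mg : measurable_fun setT (EFin \o g) by exact: measurable_int ig.
have numu : nu `<< mu.
  apply/null_content_dominatesP => A mA muA0; rewrite nug//.
  by apply: null_set_integral => //; exact: measurable_funTS.
have iRN := Radon_Nikodym_integrable (nu := charge_of_finite_measure nu) numu.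
have ae : ae_eq mu setT ('d (charge_of_finite_measure nu) '/d mu) (EFin \o g).
  apply: integral_ae_eq => // E _ mE.
  by rewrite -Radon_Nikodym_integral// [LHS]nug.
rewrite -[LHS](Radon_Nikodym_change_of_variables numu measurableT iphi).
apply: ae_eq_integral => //.
- by apply: emeasurable_funM => //; exact: measurable_int iRN.
- rewrite (_ : (fun x => (phi x * g x)%:E) = (EFin \o phi) \* (EFin \o g)).
    exact: emeasurable_funM.
  by apply/funext => x /=; rewrite EFinM.
- have := ae_eqe_mul2l (EFin \o phi) ae.
  by rewrite (_ : (fun x => (phi x * g x)%:E) = (EFin \o phi) \* (EFin \o g)).
Qed.

(** On a Hahn decomposition [P], [N] the Jordan parts have densities [h * \1_P] and [- h * \1_N],
    whose difference is [h]. Boundedness of [phi] makes it integrable against both parts. *)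
Lemma charge_integral_induced (h phi : T -> R) (B : R)
    (ih : mu.-integrable setT (EFin \o h)) :
  measurable_fun setT phi -> (forall x, `|phi x| <= B)%R ->
  charge_integral (induced_charge ih) phi = Rintegral mu setT (fun x => phi x * h x)%R.
Proof.
move=> mphi phiB; rewrite /charge_integral.
set nu := (X in hahn_posneg X).
have [[mP _] [mN _] PNT PN0] := hahn_posneg nu.
set P := hahn_pos nu in mP PNT PN0 *; set N := hahn_neg nu in mN PNT PN0 *.
have mh : measurable_fun setT h by apply/measurable_EFinP; exact: measurable_int ih.
have ind (A : set T) (mA : measurable A) : mu.-integrable setT (EFin \o (fun x => h x * \1_A x))%R.
  apply: (le_integrable measurableT _ _ ih).
    by apply/measurable_EFinP; apply: measurable_funM.
  move=> x _ /=; rewrite lee_fin normrM indicE.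
  by case: (x \in A); rewrite ?normr1 ?mulr1// normr0 mulr0.
have iphi (rho : {finite_measure set T -> \bar R}) : rho.-integrable setT (EFin \o phi).
  apply: (le_integrable measurableT (g := cst B%:E)) => //.
  - exact/measurable_EFinP.
  - by move=> x _ /=; rewrite lee_fin (le_trans (phiB x))// ler_norm.
  - exact: finite_measure_integrable_cst.
have E (A D : set T) (mA : measurable A) (mD : measurable D) :
    nu (D `&` A) = \int[mu]_(x in D) (h x * \1_A x)%:E.
  rewrite /nu /= /induced_charge integral_mkcondr; apply: eq_integral => x _.
  by rewrite patchE indicE; case: ifPn => _; rewrite ?mulr1 ?mulr0.
have EP D : measurable D -> jordan_pos (hahn_posneg nu) D = \int[mu]_(x in D) (h x * \1_P x)%:E.
  move=> mD; rewrite jordan_posE cjordan_posE /crestr0 mem_set// /crestr; exact: E.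
have EN D : measurable D -> jordan_neg (hahn_posneg nu) D = \int[mu]_(x in D) (- h x * \1_N x)%:E.
  move=> mD; rewrite jordan_negE cjordan_negE /crestr0 mem_set// /crestr E//.
  under [RHS]eq_integral do rewrite mulNr EFinN.
  rewrite integralN// fin_num_adde_defl// fin_numN integrable_neg_fin_num//.
  by apply: (integrableS measurableT) => //; exact: ind.
have indN : mu.-integrable setT (EFin \o (fun x => - h x * \1_N x))%R.
  rewrite (_ : _ \o _ = -%E \o (EFin \o (fun x => h x * \1_N x)%R)); last first.
    by apply/funext => x /=; rewrite mulNr EFinN.
  exact: integrableN (ind N mN).
rewrite /Rintegral (integral_density (ind P mP) EP (iphi _)).
rewrite (integral_density indN EN (iphi _)).
have bd (g : T -> R) : mu.-integrable setT (EFin \o g) -> mu.-integrable setT (EFin \o (fun x => phi x * g x))%R.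
  move=> ig.
  have iBg : mu.-integrable setT (EFin \o (fun x => B * g x))%R by exact: integrableZq.
  apply: (le_integrable measurableT _ _ iBg).
    by apply/measurable_EFinP; apply: measurable_funM => //; apply/measurable_EFinP; exact: measurable_int ig.
  move=> x _ /=; rewrite lee_fin !normrM ler_wpM2r//.
  by rewrite (le_trans (phiB x))// ler_norm.
rewrite -RintegralB//; [|exact: (bd _ (ind P mP))|exact: (bd _ indN)].
apply: eq_Rintegral => x _; rewrite -mulrBr mulNr opprK -mulrDr.
suff -> : (\1_P x + \1_N x = 1 :> R)%R by rewrite mulr1.
rewrite !indicE; have [Px|nPx] := pselect (P x).
  rewrite mem_set// memNset ?addr0// => Nx.
  by have : (P `&` N) x by []; rewrite PN0.
rewrite memNset// mem_set ?add0r//.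
have : (P `|` N) x by rewrite PNT.
by case.
Qed.

End density.

Section induced_cmeasure.
Context {d} {T : measurableType d} {R : realType} (mu : {sigma_finite_measure set T -> \bar R}).

Definition induced_cmeasure (f : T -> R[i])
    (fr : mu.-integrable setT (EFin \o (fun x => complex.Re (f x))))
    (fi : mu.-integrable setT (EFin \o (fun x => complex.Im (f x)))) : complex_measure T R :=
  ComplexMeasure (induced_charge fr) (induced_charge fi).

Lemma cmeasure_integral_induced f fr fi (phi : T -> R[i]) (B : R) :
  cmeasurable_fun setT phi -> (forall x, cmod (phi x) <= B) ->
  cmeasure_integral (@induced_cmeasure f fr fi) phi = cintegral mu (fun x => f x * phi x).
Proof.
move=> [mr mi] phiB.
have br x : `|complex.Re (phi x)| <= B by exact: le_trans (normr_Re_le_cmod _) (phiB x).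
have bi x : `|complex.Im (phi x)| <= B by exact: le_trans (normr_Im_le_cmod _) (phiB x).
have bd (p g : T -> R) : measurable_fun setT p -> (forall x, `|p x| <= B) ->
    mu.-integrable setT (EFin \o g) -> mu.-integrable setT (EFin \o (fun x => p x * g x)).
  move=> mp pB ig.
  have iBg : mu.-integrable setT (EFin \o (fun x => B * g x)) by exact: integrableZq.
  apply: (le_integrable measurableT _ _ iBg).
    by apply/measurable_EFinP; apply: measurable_funM => //; apply/measurable_EFinP; exact: measurable_int ig.
  move=> x _ /=; rewrite lee_fin !normrM ler_wpM2r//.
  by rewrite (le_trans (pB x))// ler_norm.
apply/eqP; rewrite eq_complex; apply/andP; split; apply/eqP;
  rewrite /cmeasure_integral /complexify ?ReD ?ImD ?ReM ?ImM/=
    !(charge_integral_induced _ mr br) !(charge_integral_induced _ mi bi) !mul0r !mul1r ?sub0r ?add0r.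
- rewrite -RintegralB//; [|exact: bd|exact: bd]; apply: eq_Rintegral => x _.
  by rewrite ReM mulrC [in X in _ - X]mulrC.
- rewrite -RintegralD//; [|exact: bd|exact: bd]; apply: eq_Rintegral => x _.
  by rewrite ImM; ring.
Qed.

(** On each piece of a partition, the real and the imaginary part are both bounded by the integral
    of the modulus over that piece, whence the factor 2. *)
Lemma cmeasure_norm_induced f fr fi :
  (cmeasure_norm (@induced_cmeasure f fr fi) <= 2%:E * \int[mu]_x (cmod (f x))%:E)%E.
Proof.
have mf : cmeasurable_fun setT f.
  by split; apply/measurable_EFinP; [exact: measurable_int fr|exact: measurable_int fi].
have mc := cmeasurable_cmod mf.
have mEc : measurable_fun setT (fun x => (cmod (f x))%:E) by exact/measurable_EFinP.
have c0 x : (0 <= (cmod (f x))%:E)%E by rewrite lee_fin cmod_ge0.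
apply: ge_ereal_sup => _ [F [mF tF UF] <-].
have bnd (g : T -> R) A : measurable A -> mu.-integrable setT (EFin \o g) ->
    (forall x, `|g x| <= cmod (f x)) ->
    (`|fine (\int[mu]_(x in A) (g x)%:E)|%:E <= \int[mu]_(x in A) (cmod (f x))%:E)%E.
  move=> mA ig gf.
  have igA : mu.-integrable A (EFin \o g) by exact: (integrableS measurableT).
  rewrite EFin_normr_Rintegral//.
  apply: (le_trans (le_abse_integral mu mA (measurable_int mu igA))).
  by apply: le_nonneg_integral => x _ /=; rewrite lee_fin.
have step k : ((cmod (cmeasure_val (induced_cmeasure fr fi) (F k)))%:E <=
    \int[mu]_(x in F k) (2%:E * (cmod (f x))%:E))%E.
  rewrite ge0_integralZl//; last exact: measurable_funTS.
  apply: (@le_trans _ _ (\int[mu]_(x in F k) (cmod (f x))%:E + \int[mu]_(x in F k) (cmod (f x))%:E)%E).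
    apply: le_trans (leeD (bnd _ _ (mF k) fr _) (bnd _ _ (mF k) fi _)).
    - rewrite -EFinD lee_fin; exact: cmod_le_normr.
    - by move=> x; exact: normr_Re_le_cmod.
    - by move=> x; exact: normr_Im_le_cmod.
  by rewrite mule_natl mule2n.
rewrite -ge0_integralZl//.
apply: (@le_trans _ _ (\sum_(0 <= k <oo) \int[mu]_(x in F k) (2%:E * (cmod (f x))%:E))%E).
  by apply: lee_nneseries => k *; rewrite ?lee_fin ?cmod_ge0//; exact: step.
rewrite -ge0_integral_bigcup//; last 2 first.
- by rewrite UF; apply: measurable_funeM.
- by move=> x _; rewrite mule_ge0.
by rewrite UF.
Qed.

(** Links the hypothesis on measures to the operator on functions. In the induction the factor
    [f ord0 z] leaves the inner integrals by linearity, and boundedness of [F] gives the bounded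
    inner integral that the change of measure demands. *)
Lemma iterated_integral_induced k (f : 'I_k -> T -> R[i]) fr fi (F : k.-tuple T -> R[i]) (D : R) :
  0 <= D -> cmeasurable_fun setT F -> (forall zs, cmod (F zs) <= D) ->
  iterated_integral (fun i => cmeasure_integral (@induced_cmeasure (f i) (fr i) (fi i))) F =
  iterated_integral (fun _ : 'I_k => cintegral mu) (fun zs => F zs * \prod_i f i (tnth zs i)).
Proof.
move=> D0.
elim: k f fr fi F => [|k ih] f fr fi F mF FD /=; first by rewrite big_ord0 mulr1.
have mfc i : cmeasurable_fun setT (f i).
  by split; apply/measurable_EFinP; [exact: measurable_int (fr i)|exact: measurable_int (fi i)].
have ic i : mu.-integrable setT (EFin \o (fun z => cmod (f i z))).
  have : mu.-integrable setT (fun z => `|(complex.Re (f i z))%:E| + `|(complex.Im (f i z))%:E|)%E.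
    exact: (integrableD measurableT (integrable_abse (fr i)) (integrable_abse (fi i))).
  apply: le_integrable => //.
    by apply/measurable_EFinP; exact: cmeasurable_cmod.
  move=> z _; rewrite (_ : `|(complex.Re (f i z))%:E| + `|(complex.Im (f i z))%:E| =
    (`|complex.Re (f i z)| + `|complex.Im (f i z)|)%:E)%E//=.
  by rewrite lee_fin (ger0_norm (cmod_ge0 _)) ger0_norm ?addr_ge0//; exact: cmod_le_normr.
have c0 i z : 0 <= cmod (f i z) by exact: cmod_ge0.
rewrite (_ : (fun z => _) = (fun z => iterated_integral (fun _ : 'I_k => cintegral mu)
    (fun zs => F [tuple of z :: zs] * \prod_i f (lift ord0 i) (tnth zs i)))); last first.
  apply/funext => z; apply: ih => //.
  by apply: (cmeasurable_comp mF); apply: measurable_cons => //; exact: measurable_cst.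
have td z : tuple_dominated D (fun i z => cmod (f (lift ord0 i) z))
    (fun zs : k.-tuple T => F [tuple of z :: zs] * \prod_i f (lift ord0 i) (tnth zs i)).
  split.
    apply: cmeasurable_funM.
      by apply: (cmeasurable_comp mF); apply: measurable_cons => //; exact: measurable_cst.
    by apply: cmeasurable_prod => i; apply: (cmeasurable_comp (mfc _)); exact: measurable_tnth.
  by move=> zs; rewrite cmodM cmod_prod ler_wpM2r// prodr_ge0.
rewrite (@cmeasure_integral_induced (f ord0) (fr ord0) (fi ord0) _
  (2 ^+ k * D * \prod_(i < k) Rintegral mu setT (fun z => cmod (f (lift ord0 i) z)))).
- congr cintegral; apply/funext => z.
  rewrite -(iteratedZ (f ord0 z) (fun i => c0 (lift ord0 i)) (fun i => ic (lift ord0 i)) D0 (td z)).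
  congr iterated_integral; apply/funext => zs.
  rewrite big_ord_recl tnth0 mulrCA; congr (_ * _); congr (_ * _).
  by apply: eq_bigr => i _; rewrite tnthS.
- apply: (@measurable_iterated _ _ _ mu k _ T (fun p : T * k.-tuple T => F [tuple of p.1 :: p.2] *
    \prod_i f (lift ord0 i) (tnth p.2 i))).
  apply: cmeasurable_funM; first exact: cmeasurable_cons.
  apply: cmeasurable_prod => i; apply: (cmeasurable_comp (mfc _)).
  exact: (measurableT_comp (measurable_tnth _) measurable_snd).
- move=> z; exact: (cmod_iterated_le (fun i => c0 (lift ord0 i)) (fun i => ic (lift ord0 i)) D0 (td z)).
Qed.

End induced_cmeasure.

(** * Cubes with small boundary *)

Section boundary.
Context {R : realType} {n : nat}.
Local Notation T := (Rn R n).
Implicit Types (x y c : T) (A : set T).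

Lemma ball_Rn (x y : T) (e : R) : 0 < e ->
  ball (x : 'rV[R]_n) e (y : 'rV[R]_n) <-> sup_dist x y < e.
Proof.
move=> e0; split => [[_ h]|h].
  by apply/bigmax_ltP; split => // i _; exact: (h 0 i).
split=> // i j; rewrite ord1; apply: le_lt_trans h; exact: coord_le_sup_dist.
Qed.

(** Writing the side as [r *+ 2] makes [r] the radius of the cube in the sup distance. *)
Lemma sup_dist_boundary c r y : 0 < r -> boundary (cube c (r *+ 2)) y -> sup_dist c y = r.
Proof.
move=> r0; have r2 : 0 <= r *+ 2 by rewrite mulrn_wge0// ltW.
have e2 : r *+ 2 / 2 = r by lra.
rewrite /boundary cubeE// e2 => -[cy iy].
apply/eqP; rewrite eq_le; apply/andP; split.
- apply/ler_addgt0Pr => e e0.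
  have [z [/= hz]] := cy _ (nbhsx_ballx (y : 'rV[R]_n) e e0).
  move=> /ball_Rn-/(_ e0) yz.
  by rewrite (le_trans (sup_dist_triangle z _ _))// lerD// ?(sup_distC c)// sup_distC ltW.
- rewrite leNgt; apply/negP => yr; apply: iy; rewrite /interior /=.
  have e0 : 0 < r - sup_dist c y by rewrite subr_gt0.
  apply/nbhs_ballP; exists (r - sup_dist c y) => //= z /ball_Rn-/(_ e0) yz.
  by have := sup_dist_triangle y c z; rewrite /= (sup_distC z c); lra.
Qed.

(** Without a boundary point the infimum in [dist_set] would say nothing about the radius. The
    corner [c + (r, ..., r)] is one as soon as there is a coordinate. *)
Lemma boundary_cube_nonempty c r : (0 < n)%N -> 0 < r -> boundary (cube c (r *+ 2)) !=set0.
Proof.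
move=> n0 r0; have r2 : 0 <= r *+ 2 by rewrite mulrn_wge0// ltW.
have e2 : r *+ 2 / 2 = r by lra.
pose pt (e : R) : T := (c : 'rV[R]_n) + const_mx (r + e).
have ptE e i : Rn_coord i (pt e) = Rn_coord i c + (r + e) by rewrite /Rn_coord !mxE.
have pt_dist e e' : sup_dist (pt e) (pt e') <= `|e - e'|.
  apply/sup_dist_leP => // i; rewrite !ptE.
  by rewrite (_ : _ - _ = e - e')//; ring.
exists (pt 0); rewrite /boundary cubeE// e2; split.
  apply: subset_closure => /=; apply/sup_dist_leP; first exact: ltW.
  by move=> i; rewrite ptE addr0 addrAC subrr add0r ger0_norm// ltW.
rewrite /interior/= => /nbhs_ballP[e /= e0 h].
have : sup_dist (pt (e / 2)) c <= r.
  apply: (h (pt (e / 2))); apply/ball_Rn => //; apply: le_lt_trans (pt_dist _ _) _.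
  by rewrite sub0r normrN ger0_norm ?divr_ge0// ?(ltW e0)//; lra.
move=> /(sup_dist_leP _ _ (ltW r0))/(_ (Ordinal n0)); rewrite ptE.
rewrite addrAC subrr add0r ger0_norm; first by lra.
by rewrite addr_ge0 ?divr_ge0 ?ltW.
Qed.

Lemma sup_radius_dist_set c r x s : (0 < n)%N -> 0 < r ->
  dist_set x (boundary (cube c (r *+ 2))) <= s -> `|sup_dist c x - r| <= s.
Proof.
move=> n0 r0; apply: le_trans; apply: lb_le_inf.
  by have [y yb] := boundary_cube_nonempty c n0 r0; exists (eucl_dist x y), y.
move=> _ [y yb <-]; rewrite -(sup_dist_boundary r0 yb).
apply: le_trans (sup_dist_le_eucl x y).
rewrite ler_distl; have := sup_dist_triangle x c y; have := sup_dist_triangle y c x.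
by rewrite (sup_distC y x); lra.
Qed.

(** The complement is open, since the distance to [A] is Lipschitz with constant [n] in the sup
    distance. *)
Lemma measurable_dist_set A s : A !=set0 -> measurable [set x | dist_set x A <= s].
Proof.
move=> A0.
have Ai x : has_inf [set eucl_dist x y | y in A].
  split; first by have [y Ay] := A0; exists (eucl_dist x y), y.
  by exists 0 => _ [y _ <-]; exact: eucl_dist_ge0.
rewrite -[X in measurable X]setCK; apply: measurableC; apply: open_Rn_measurable.
rewrite openE => x /=; move/negP; rewrite -ltNge => sx; rewrite /interior/=.
pose e := (dist_set x A - s) / (2 * n.+1%:R).
have e0 : 0 < e by rewrite divr_gt0 ?subr_gt0// mulr_gt0.
apply/nbhs_ballP; exists e => //= z /ball_Rn-/(_ e0) xz; apply/negP; rewrite -ltNge.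
have : dist_set x A <= dist_set z A + n%:R * sup_dist x z.
  rewrite -lerBlDr; apply: lb_le_inf; first exact: (Ai z).1.
  move=> _ [y Ay <-]; rewrite lerBlDr.
  apply: (@le_trans _ _ (eucl_dist x y)); first by apply: ge_inf; [exact: (Ai x).2|exists y].
  by have := eucl_dist_triangle z x y; have := eucl_dist_le_sup x z; lra.
have : n%:R * sup_dist x z <= (dist_set x A - s) / 2.
  apply: (@le_trans _ _ (n.+1%:R * e)).
    by apply: ler_pM => //; [exact: sup_dist_ge0|rewrite ler_nat|exact: ltW].
  have N0 : n.+1%:R != 0 :> R by rewrite pnatr_eq0.
    by rewrite /e invfM mulrC !mulrA mulfVK.
by move: sx; lra.
Qed.

End boundary.

Section small_boundary.
Context {R : realType} {n : nat}.
Local Notation T := (Rn R n).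
Local Notation leb := (@lebesgue_measure R).
Variable mu : {measure set T -> \bar R}.
Hypothesis n0 : (0 < n)%N.
Hypothesis mu_ball : forall (x : T) r, (mu [set y | (sup_dist x y <= r)%R] < +oo)%E.

Definition rat_nth (i : nat) : rat * rat := odflt (0, 0) (unpickle i).
Definition rat_center i : R := ratr (rat_nth i).1.
Definition rat_radius i : R := ratr (rat_nth i).2.
Definition dist_line (x y : R) : R := `|x - y|.

Lemma measurable_shell c (a b : R) :
  measurable [set x : T | a <= sup_dist c x <= b].
Proof.
rewrite (_ : [set y | _] = [set: T] `&` sup_dist c @^-1` `[a, b]%classic).
  exact: (measurable_sup_dist_l _ measurableT).
by rewrite setTI; apply/seteqP; split => y; rewrite /= in_itv.
Qed.

(* A one-dimensional weak-type bound for the distribution of the sup-norm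
   distance to [c] under the measure restricted to the ball of radius [l]. *)
Lemma exists_regular_radius (c : T) (l : R) : 0 < l ->
  exists2 r, l / 2 <= r <= 3 * l / 4 &
    forall s, 0 < s -> r + s <= l ->
      (mu [set x | (r - s <= sup_dist c x <= r + s)%R] <=
        (100 * s / l)%:E * mu [set x | (sup_dist c x <= l)%R])%E.
Proof.
move=> l0; set V := mu [set x | (sup_dist c x <= l)%R].
have Vfin : V \is a fin_num by rewrite ge0_fin_numE ?measure_ge0//; exact: mu_ball.
have [V0|V0] := eqVneq V 0%E.
  exists (l / 2); first by apply/andP; split; lra.
  move=> s s0 sl; rewrite V0 mule0 -[leRHS]V0; apply: le_measure; rewrite ?inE.
  - exact: measurable_shell.
  - rewrite (_ : [set x | _] = [set x | 0 <= sup_dist c x <= l]); first exact: measurable_shell.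
    by apply/seteqP; split => x /=; rewrite sup_dist_ge0.
  - by move=> x /= /andP[_ h]; rewrite (le_trans h).
have V0' : 0 < fine V by rewrite fine_gt0// lt0e V0 measure_ge0 ltey_eq Vfin.
pose S (A : set R) := [set x : T | sup_dist c x <= l /\ A (sup_dist c x)].
(* The law of the sup distance to [c] under [mu] on the ball of radius [l]; its total mass is
   [V]. *)
pose nu (A : set R) : \bar R := (\int[mu]_(x in S A) 1)%E.
pose B k i : set R := family_ball dist_line rat_center rat_radius k i.
have BE k i : B k i = `[rat_center i - k * rat_radius i, rat_center i + k * rat_radius i]%classic.
  by apply/seteqP; split => x; rewrite /B /family_ball /dist_line/= in_itv/= distrC ler_distl.
have mB k i : measurable (B k i : set (measurableTypeR R)) by rewrite BE; exact: measurable_itv.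
have mS k i : measurable (S (B k i)).
  rewrite (_ : S _ = [set x | 0 <= sup_dist c x <= l] `&`
    [set x | rat_center i - k * rat_radius i <= sup_dist c x <= rat_center i + k * rat_radius i]).
    by apply: measurableI; exact: measurable_shell.
  by apply/seteqP; split => x; rewrite /S BE/= in_itv/= sup_dist_ge0.
(* Two requirements meet here: [a * (l / 4)] exceeds [V], so that the bad intervals cannot cover
   [[l / 2, 3 * l / 4]], and [a * (18 * s)] is the claimed bound, [18 * s] dominating the length of
   the tripled interval used below. *)
pose a := 100 * fine V / (18 * l).
have a0 : 0 <= a by rewrite divr_ge0// ?mulr_ge0// ltW.
pose P := [set i | (a%:E * leb (B 3%R i) <= nu (B 1%R i))%E].
have weak : (a%:E * leb (\bigcup_(i in P) B 1%R i) <= V)%E.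
  apply: (@vitali_weak_type _ (measurableTypeR R) R dist_line rat_center rat_radius _ _ mB
    (@lebesgue_measure R) nu V _ a P a0) => //.
  - by move=> x y; rewrite /dist_line distrC.
  - by move=> y x z; rewrite /dist_line ler_distD.
  - move=> D uD tD; rewrite /nu.
    have tD' : trivIset [set` D] (fun i => S (B 1 i)).
      by move=> i j Di Dj [x [[_ xi] [_ xj]]]; apply: tD => //; exists (sup_dist c x).
    rewrite -(@ge0_integral_bigsetU _ _ _ mu nat (fun i => S (B 1 i)) (fun=> 1%E) D (mS 1) uD tD')//.
    rewrite -[V]mul1e -integral_cst; last first.
      rewrite (_ : [set x | _] = [set x | 0 <= sup_dist c x <= l]); first exact: measurable_shell.
      by apply/seteqP; split => x /=; rewrite sup_dist_ge0.
    apply: ge0_subset_integral => //.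
    + by apply: bigsetU_measurable => i _; exact: mS.
    + rewrite (_ : [set x | _] = [set x | 0 <= sup_dist c x <= l]); first exact: measurable_shell.
      by apply/seteqP; split => x /=; rewrite sup_dist_ge0.
    + by rewrite -bigcup_seq => x [i _ []].
have [r rI rP] : exists2 r, l / 2 <= r <= 3 * l / 4 & ~ (\bigcup_(i in P) B 1 i) r.
  apply: contrapT => H.
  have sub : `[l / 2, 3 * l / 4]%classic `<=` \bigcup_(i in P) B 1 i.
    by move=> r rI; apply: contrapT => rP; apply: H; exists r.
  have : (a%:E * (l / 4)%:E <= V)%E.
    apply: le_trans weak; rewrite lee_wpmul2l ?lee_fin//.
    have <- : leb (`[l / 2, 3 * l / 4]%classic : set R) = (l / 4)%:E.
      rewrite lebesgue_measure_itv/= lte_fin ifT; last by lra.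
      by rewrite -EFinB; congr EFin; field.
    apply: le_measure; rewrite ?inE//.
    by apply: bigcup_measurable => i _; exact: mB.
  rewrite -(fineK Vfin) -EFinM lee_fin; apply/negP; rewrite -ltNge.
  rewrite /a (_ : _ * _ = 100 / 72 * fine V); last by field; rewrite gt_eqF.
  by rewrite ltr_pMl//; lra.
exists r => // s s0 rsl.
(* A member of the countable family around [r]: its centre is within [s] of [r] and its radius is
   above [2 * s], so it contains all of [[r - s, r + s]]. *)
have [q1 /itvP q1I] : exists q, ratr q \in `]r - s, r + s[.
  by apply: rat_in_itvoo; lra.
have [q2 /itvP q2I] : exists q, ratr q \in `]2 * s, 3 * s[.
  by apply: rat_in_itvoo; lra.
pose i := pickle (q1, q2).
have ci : rat_center i = ratr q1 by rewrite /rat_center /rat_nth pickleK.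
have ri : rat_radius i = ratr q2 by rewrite /rat_radius /rat_nth pickleK.
have q1a : r - s < ratr q1 by rewrite q1I.
have q1b : ratr q1 < r + s by rewrite q1I.
have q2a : 2 * s < ratr q2 by rewrite q2I.
have q2b : ratr q2 < 3 * s by rewrite q2I.
have iP : ~ P i.
  by move=> Pi; apply: rP; exists i => //; rewrite BE ci ri/= in_itv/=; lra.
have {iP} : (nu (B 1%R i) <= a%:E * leb (B 3%R i))%E by rewrite leNgt; apply/negP => h; apply: iP; exact: ltW.
have -> : leb (B 3 i) = (6 * ratr q2)%:E.
  rewrite BE ci ri lebesgue_measure_itv/= lte_fin ifT; last by lra.
  by rewrite -EFinB; congr EFin; ring.
move=> h; apply: (@le_trans _ _ (nu (B 1 i))).
  rewrite /nu integral_cst// mul1e; apply: le_measure; rewrite ?inE//; first exact: measurable_shell.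
  move=> x /= /andP[h1 h2]; split; first by rewrite (le_trans h2).
  by rewrite BE ci ri/= in_itv/=; lra.
apply: (le_trans h); rewrite -(fineK Vfin) -!EFinM lee_fin /a.
rewrite (_ : 100 * s / l * fine V = 100 * fine V / (18 * l) * (18 * s)); last by field; rewrite gt_eqF.
by rewrite ler_wpM2l//; lra.
Qed.

(** The cube of regular radius [r]. For [xi < 1/6] the shell of half-width [2 * r * xi] stays in the
    ball of radius [l] because [r <= 3 * l / 4], and [100 * 2 * r / l <= 150]. For larger [xi] the
    factor [150 * xi] exceeds 1 and the inequality is trivial. *)
Lemma exists_small_boundary (c : T) (l : R) : 0 < l ->
  exists2 l', l <= l' <= 3 * l / 2 & small_boundary mu 150 c l'.
Proof.
move=> l0; have [r /andP[r1 r2] H] := exists_regular_radius c l0.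
exists (r *+ 2); first by apply/andP; split; lra.
have r0 : 0 < r by lra.
move=> xi xi0.
set E := [set x | _].
have b0 := boundary_cube_nonempty c n0 r0.
have mE : measurable E.
  rewrite (_ : E = cube c (2 * (r *+ 2)) `&` [set x | dist_set x (boundary (cube c (r *+ 2))) <= xi * (r *+ 2)]).
    by apply: measurableI; [exact: measurable_cube|exact: measurable_dist_set].
  by [].
have mC := measurable_cube c (2 * (r *+ 2)).
have sub2 : [set x | sup_dist c x <= l] `<=` cube c (2 * (r *+ 2)).
  rewrite cubeE; last by lra.
  by move=> x /=; rewrite sup_distC; lra.
have ml : measurable [set x : T | sup_dist c x <= l].
  rewrite (_ : [set x | _] = [set x | 0 <= sup_dist c x <= l]); first exact: measurable_shell.
  by apply/seteqP; split => x /=; rewrite sup_dist_ge0.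
have [xb|xs] := leP (6^-1) xi.
  apply: (@le_trans _ _ (mu (cube c (2 * (r *+ 2))))).
    by apply: le_measure; rewrite ?inE// => x [].
  by rewrite -[leLHS]mul1e lee_wpmul2r// lee_fin; lra.
have s0 : 0 < xi * (r *+ 2) by rewrite mulr_gt0//; lra.
apply: (@le_trans _ _ (mu [set x | (r - xi * (r *+ 2) <= sup_dist c x <= r + xi * (r *+ 2))%R])).
  apply: le_measure; rewrite ?inE//; first exact: measurable_shell.
  by move=> x [_ /(sup_radius_dist_set n0 r0)]; rewrite ler_distl.
apply: (@le_trans _ _ ((100 * (xi * (r *+ 2)) / l)%:E * mu [set x | (sup_dist c x <= l)%R])%E).
  by apply: H => //; nra.
apply: (@le_trans _ _ ((150 * xi)%:E * mu [set x | (sup_dist c x <= l)%R])%E).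
  rewrite lee_wpmul2r// lee_fin ler_pdivrMr//; nra.
rewrite lee_wpmul2l ?lee_fin ?mulr_ge0 ?(ltW xi0)//.
by apply: le_measure; rewrite ?inE.
Qed.

End small_boundary.

(** * Whitney cubes *)

Section whitney.
Context {R : realType} {n : nat}.
Local Notation T := (Rn R n).
Variables (Om : set T) (d : T -> R).
Hypothesis d_lip : forall x y, d x <= d y + sup_dist x y.
Hypothesis d_gt0 : forall x, Om x <-> 0 < d x.

Local Notation side := (@grid_radius R n).

(* Each index is used for one grid cube only, namely when [i] is the code of
   that cube; the cube meets the layer of [Om] whose depth is comparable to it. *)
Definition whitney (i : nat) : Prop :=
  pickle (@grid_nth n i) = i /\
  exists x, [/\ grid_ball 1 i x, 512 * side i <= d x & d x < 1024 * side i].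

(** The scale is nine steps below that of [d x], as [512 = 2 ^ 9]. *)
Lemma whitney_cover x : Om x -> exists2 i, whitney i & grid_ball 1 i x.
Proof.
move=> /d_gt0 dx; have [K /andP[K1 K2]] := dyadic_near dx.
have [j kj] := grid_near (K - 9) x.
have E : dyadic K = 512 * dyadic (K - 9) :> R.
  by rewrite {1}(_ : K = K - 9 + 1 + 1 + 1 + 1 + 1 + 1 + 1 + 1 + 1)%Z ?dyadicS; [ring|lia].
have E' : side (pickle (K - 9, j)) = dyadic (K - 9).
  by rewrite /grid_radius /grid_nth pickleK.
have gx : grid_ball 1 (pickle (K - 9, j)) x.
  by rewrite /grid_ball /family_ball/= mul1r /grid_center /grid_radius /grid_nth pickleK.
exists (pickle (K - 9, j)) => //; split; first by rewrite /grid_nth pickleK.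
by exists x; rewrite E'; split => //; [rewrite -E|move: K2; rewrite dyadicS E; lra].
Qed.

(** A point of the 128-dilate is within [129] sides of the witness [x], and [512 - 129 = 383],
    [1024 + 129 = 1153]. The large ratio 512 is what lets so wide a dilate remain in [Om]. *)
Lemma whitney_depth i y : whitney i -> grid_ball 128 i y ->
  383 * side i <= d y /\ d y <= 1153 * side i.
Proof.
move=> [_ [x [xi x1 x2]]] yi; move: xi yi; rewrite /grid_ball /family_ball/= mul1r => xi yi.
have := sup_dist_triangle (grid_center i) x y; rewrite (sup_distC x (grid_center i)).
have := d_lip x y; have := d_lip y x; rewrite (sup_distC y x).
by have := grid_radius_gt0 (R := R) (n := n) i; split; lra.
Qed.

Lemma whitney_sub i : whitney i -> grid_ball 128 i `<=` Om.
Proof.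
move=> wi y /(whitney_depth wi)[h _]; apply/d_gt0.
by have := grid_radius_gt0 (R := R) (n := n) i; lra.
Qed.

(** Three scales times 259 positions per coordinate. It depends on [n] alone, as the threshold for
    [beta] must. *)
Definition overlap_cst : nat := locked #|{: 'I_3 * {ffun 'I_n -> 'I_259}}|.

Lemma dyadic_lt (k l : int) : dyadic k < dyadic l :> R -> (k < l)%R.
Proof.
by rewrite /dyadic /powR pnatr_eq0/= ltr_expR ltr_pM2r ?ltr_int// ln_gt0// ltr1n.
Qed.

(** The depth of [y] leaves three possible scales to a cube whose 128-dilate contains [y]; at a
    given scale each lattice coordinate of its centre differs by at most 129 from the rounded
    coordinate of [y]. The pair of these data determines the cube. *)
Lemma whitney_overlap (s : seq nat) (y : T) : uniq s ->
  (forall i, i \in s -> whitney i /\ grid_ball 128 i y) -> (size s <= overlap_cst)%N.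
Proof.
move=> us hs.
have [-> //|[i0 i0s]] : s = [::] \/ exists i, i \in s.
  by case: (s) => [|a l]; [left|right; exists a; rewrite mem_head].
have dy : 0 < d y.
  have [w g] := hs _ i0s; have [h _] := whitney_depth w g.
  by have := grid_radius_gt0 (R := R) (n := n) i0; lra.
have [K /andP[K1 K2]] := dyadic_near dy.
pose kk i : int := (@grid_nth n i).1.
pose jj i (a : 'I_n) : int := (@grid_nth n i).2 a.
have kP i : i \in s -> (8 <= K - kk i <= 10)%R.
  move=> /hs[w g]; have [h1 h2] := whitney_depth w g.
  have s0 := grid_radius_gt0 (R := R) (n := n) i.
  have E7 : dyadic (kk i + 8) = 256 * side i.
    by rewrite (_ : kk i + 8 = kk i + 1 + 1 + 1 + 1 + 1 + 1 + 1 + 1)%Z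
      ?dyadicS /grid_radius; [ring|lia].
  have E10 : dyadic (kk i + 11) = 2048 * side i.
    by rewrite (_ : kk i + 11 = kk i + 1 + 1 + 1 + 1 + 1 + 1 + 1 + 1 + 1 + 1 + 1)%Z ?dyadicS /grid_radius; [ring|lia].
  have a1 : (kk i + 8 < K + 1)%R by apply: dyadic_lt; rewrite E7; lra.
  have a2 : (K < kk i + 11)%R by apply: dyadic_lt; rewrite E10; lra.
  move: a1 a2; clear; lia.
pose fl i (a : 'I_n) : int := Num.floor (Rn_coord a y / side i).
have jP i a : i \in s -> (0 <= jj i a - fl i a + 129 <= 258)%R.
  move=> /hs[w g]; have s0 := grid_radius_gt0 (R := R) (n := n) i.
  have : `|Rn_coord a (grid_center i) - Rn_coord a y| <= 128 * side i.
    exact: le_trans (coord_le_sup_dist _ _ _) g.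
  have -> : Rn_coord a (grid_center i) = side i * (jj i a)%:~R.
    by rewrite /Rn_coord mxE.
  have /andP[f1 f2] := floor_itv (Rn_coord a y / side i).
  rewrite -/(fl i a) in f1 f2.
  have -> : Rn_coord a y = side i * (Rn_coord a y / side i) by rewrite mulrC divfK ?gt_eqF.
  rewrite -mulrBr normrM gtr0_norm// mulrC ler_pM2r// ler_norml => /andP[h1 h2].
  rewrite intrD in f2.
  have b1 : ((fl i a - 129)%:~R < (jj i a)%:~R + 1 :> R)%R by rewrite intrB; lra.
  have b2 : ((jj i a)%:~R < (fl i a + 129)%:~R + 1 :> R)%R by rewrite intrD; lra.
  rewrite -[1]/(1%:~R) -intrD ltr_int in b1.
  rewrite -[1]/(1%:~R) -intrD ltr_int in b2.
  move: b1 b2; clear; lia.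
pose code i : 'I_3 * {ffun 'I_n -> 'I_259} :=
  (inord (absz (K - kk i - 8)%R), [ffun a => inord (absz (jj i a - fl i a + 129)%R)]).
have inj : {in s &, injective code}.
  move=> i i' si si' [/(congr1 val)/= e1 e2].
  have k1 := kP _ si; have k2 := kP _ si'.
  rewrite !inordK in e1; [|by move: k2; clear; lia|by move: k1; clear; lia].
  have ek : kk i = kk i' by move: e1 k1 k2; clear; lia.
  have es : side i = side i' by rewrite /grid_radius -/(kk i) -/(kk i') ek.
  have ej : (@grid_nth n i).2 = (@grid_nth n i').2.
    apply/ffunP => a; move/ffunP/(_ a) : e2; rewrite !ffunE => /(congr1 val)/=.
    have j1 := jP i a si; have j2 := jP i' a si'.
    rewrite !inordK; [|by move: j2; clear; lia|by move: j1; clear; lia].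
    have ef : fl i a = fl i' a by rewrite /fl es.
    move: j1 j2; rewrite /jj ef; clear; lia.
  have [[p1 _] _] := hs _ si; have [[p2 _] _] := hs _ si'.
  rewrite -p1 -p2; congr pickle.
  by move: ek ej; rewrite /kk; case: (grid_nth i) => ? ?; case: (grid_nth i') => ? ? /= -> ->.
rewrite /overlap_cst -lock -(size_map code).
have /card_uniqP <- : uniq (map code s) by rewrite map_inj_in_uniq.
exact: max_card.
Qed.

End whitney.

Section overlap.
Context {d} {T : measurableType d} {R : realType} (mu : {measure set T -> \bar R}).
Local Open Scope ereal_scope.

(** Integrates the pointwise bound of the sum of the indicators by [N] times the indicator of
    [Om]. *)
Lemma overlap_series_le (A : (set T)^nat) (N : nat) (Om : set T) :
  measurable Om -> (forall i, measurable (A i)) -> (forall i, A i `<=` Om) ->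
  (forall (s : seq nat) y, uniq s -> (forall i, i \in s -> A i y) -> (size s <= N)%N) ->
  \sum_(i <oo) mu (A i) <= N%:R%:E * mu Om.
Proof.
move=> mOm mA AOm H.
have E i : mu (A i) = \int[mu]_x (\1_(A i) x)%:E by rewrite integral_indic// setIT.
under eq_eseriesr do rewrite E.
rewrite -integral_nneseries//; last by move=> i; apply/measurable_EFinP; exact: measurable_indic.
have -> : N%:R%:E * mu Om = \int[mu]_x (N%:R%:E * (\1_Om x)%:E).
  rewrite ge0_integralZl//.
    by rewrite integral_indic// setIT.
  by apply/measurable_EFinP; exact: measurable_indic.
apply: le_nonneg_integral => x _; first by apply: nneseries_ge0.
apply: lime_le; first by apply: is_cvg_nneseries => *; rewrite lee_fin.
apply: nearW => m; rewrite sumEFin -EFinM lee_fin.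
pose s := [seq i <- iota 0 m | `[< A i x >]].
have -> : (\sum_(0 <= i < m) \1_(A i) x = (size s)%:R :> R)%R.
  rewrite /s size_filter -sum1_count natr_sum [RHS]big_mkcond/= /index_iota subn0.
  apply: eq_bigr => i _; rewrite indicE; case: asboolP => h; first by rewrite mem_set.
  by rewrite memNset.
have hs : (size s <= N)%N.
  apply: (H s x); first by rewrite filter_uniq// iota_uniq.
  by move=> i; rewrite mem_filter => /andP[/asboolP].
rewrite indicE; have [Omx|nOm] := pselect (Om x); first by rewrite mem_set// mulr1 ler_nat.
rewrite memNset// mulr0 (_ : s = [::])//.
apply/eqP; rewrite -size_eq0 size_filter -leqn0 leqNgt -has_count; apply/negP => /hasP[i _ /asboolP Ax].
by apply: nOm; exact: AOm Ax.
Qed.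

Lemma measure_bigcup_le_series (A : (set T)^nat) : (forall i, measurable (A i)) ->
  mu (\bigcup_i A i) <= \sum_(i <oo) mu (A i).
Proof.
move=> mA; apply: measure_sigma_subadditive => //; exact: bigcupT_measurable.
Qed.

End overlap.

Local Open Scope complex_scope.

Lemma wt_powR_le1 {R : realType} {n : nat} (t e : R) (x y : Rn R n) :
  0 < t -> 0 <= e -> wt t x y `^ e <= 1.
Proof.
move=> t0 e0; rewrite -[leRHS](congr1 (@^~ e) (powR1 R)).
apply: ge0_ler_powR => //; rewrite ?nnegrE ?(ltW (wt_gt0 _ _ t0)) ?wt_le1//.
Qed.

Lemma powR_wt_shift {R : realType} {n : nat} (q t : R) (x w y : Rn R n) : 0 <= q -> 0 < t ->
  wt t x y `^ q <= wt t w y `^ q + q * (eucl_dist x w / t) * wt t x y `^ q.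
Proof.
move=> q0 t0.
set u := eucl_dist x w / t.
have u0 : 0 <= u by rewrite divr_ge0 ?eucl_dist_ge0 ?(ltW t0).
have u1 : 0 < 1 + u by rewrite ltr_pwDl.
have wx := wt_gt0 x y t0; have ww := wt_gt0 w y t0.
have h : wt t x y `^ q <= wt t w y `^ q * (1 + u) `^ q.
  rewrite -powRM ?(ltW ww) ?(ltW u1)//; apply: ge0_ler_powR; rewrite ?nnegrE ?(ltW wx)//.
    by rewrite mulr_ge0 ?(ltW ww) ?(ltW u1).
  exact: wt_shift.
have h2 : 1 - q * u <= ((1 + u) `^ q)^-1.
  rewrite -powRN /powR gt_eqF//; apply: le_trans (expR_ge1Dx _).
  rewrite lerD2l mulNr lerN2 ler_wpM2l//.
  by have := le_ln1Dx (x := u); apply; lra.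
have p0 : 0 < (1 + u) `^ q by exact: powR_gt0.
have h3 : wt t x y `^ q * ((1 + u) `^ q)^-1 <= wt t w y `^ q by rewrite ler_pdivrMr.
have := ler_wpM2l (powR_ge0 (wt t x y) q) h2; lra.
Qed.

Lemma sqr_le_2sqrD {R : realType} (s a b : R) :
  0 <= s -> s <= a + b -> s ^+ 2 <= 2 * a ^+ 2 + 2 * b ^+ 2.
Proof.
move=> s0 sab; have ab0 := le_trans s0 sab.
apply: (@le_trans _ _ ((a + b) ^+ 2)); first by rewrite ler_pXn2r ?nnegrE.
have := sqr_ge0 (a - b); rewrite sqrrB sqrrD; lra.
Qed.

Section linear_bounds.
Context {d} {T : measurableType d} {R : realType} (nu : {measure set T -> \bar R}).
Variable D : set T.
Hypothesis mD : measurable D.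
Local Open Scope ereal_scope.

Lemma le_integral_scale (f g : T -> \bar R) (c : R) : (0 <= c)%R ->
  measurable_fun D g -> (forall x, D x -> 0 <= g x) -> (forall x, D x -> 0 <= f x) ->
  (forall x, D x -> f x <= c%:E * g x) ->
  \int[nu]_(x in D) f x <= c%:E * \int[nu]_(x in D) g x.
Proof.
move=> c0 mg g0 f0 fg; rewrite -ge0_integralZl//.
exact: le_nonneg_integral.
Qed.

Lemma le_integral_lincomb (f g h : T -> \bar R) (b c : R) : (0 <= b)%R -> (0 <= c)%R ->
  measurable_fun D g -> (forall x, D x -> 0 <= g x) ->
  measurable_fun D h -> (forall x, D x -> 0 <= h x) -> (forall x, D x -> 0 <= f x) ->
  (forall x, D x -> f x <= b%:E * g x + c%:E * h x) ->
  \int[nu]_(x in D) f x <= b%:E * \int[nu]_(x in D) g x + c%:E * \int[nu]_(x in D) h x.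
Proof.
move=> b0 c0 mg g0 mh h0 f0 fgh; rewrite -!ge0_integralZl// -ge0_integralD//; first last.
- exact: measurable_funeM.
- by move=> x Dx; rewrite mule_ge0 ?lee_fin ?h0.
- exact: measurable_funeM.
- by move=> x Dx; rewrite mule_ge0 ?lee_fin ?g0.
exact: le_nonneg_integral.
Qed.

End linear_bounds.

Lemma lee_prod {R : realType} (I : finType) (f g : I -> \bar R) :
  (forall i, 0 <= f i <= g i)%E -> (\prod_i f i <= \prod_i g i)%E.
Proof.
move=> fg; suff : (0 <= \prod_i f i <= \prod_i g i)%E by case/andP.
elim/big_ind2 : _ => [|x1 x2 y1 y2 /andP[x0 x12] /andP[y0 y12]|i _]; last exact: fg.
  by rewrite lexx andbT.
by rewrite mule_ge0//= lee_pmul.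
Qed.

Lemma cmeasure_norm_ge0 {d} {T : measurableType d} {R : realType} (nu : complex_measure T R) :
  (0 <= cmeasure_norm nu)%E.
Proof.
apply: (@le_trans _ _ (\sum_(0 <= k <oo) (cmod (cmeasure_val nu (bigcup2 setT set0 k)))%:E)%E).
  by apply: nneseries_ge0 => i _ _; rewrite lee_fin cmod_ge0.
apply: ereal_sup_ubound; exists (bigcup2 setT set0) => //; split.
- by case=> [|[|i]] /=.
- apply/trivIsetP => i j _ _ ij; case: i j ij => [|[|i]] [|[|j]]//= _; rewrite ?setI0 ?set0I//.
- by rewrite bigcup2E setU0.
Qed.

(** * Measure of a set that is small on a fixed share of the good cubes *)

Section covering.
Context {d} {T : measurableType d} {R : realType} (mu : {measure set T -> \bar R}).
Variables (Om E : set T) (W : set nat) (B1 B : (set T)^nat) (N : nat) (theta tau : R).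
Hypotheses (mOm : measurable Om) (mE : measurable E) (EOm : E `<=` Om).
Hypothesis Om_fin : (mu Om < +oo)%E.
Hypotheses (N0 : (0 < N)%N) (theta0 : 0 <= theta) (tau0 : 0 <= tau).
Hypotheses (mB1 : forall i, measurable (B1 i)) (mB : forall i, measurable (B i)).
Hypothesis B1B : forall i, B1 i `<=` B i.
Hypothesis BOm : forall i, W i -> B i `<=` Om.
Hypothesis OmB1 : forall x, Om x -> exists2 i, W i & B1 i x.
Hypothesis overlapB : forall (s : seq nat) (y : T), uniq s ->
  (forall i, i \in s -> W i /\ B i y) -> (size s <= N)%N.
Hypothesis good_sub : forall i, W i -> (mu (B i) <= (2 * N%:R)%:E * mu (B1 i))%E ->
  exists G, [/\ measurable G, G `<=` B i, (theta%:E * mu (B1 i) <= mu G)%E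
    & (mu (E `&` G) <= tau%:E * mu (B i))%E].

Let good i := W i /\ (mu (B i) <= (2 * N%:R)%:E * mu (B1 i))%E.
(** Discarded indices carry the empty set, so that every family stays indexed by all natural numbers
    and series can be compared term by term. *)
Let sel (P : nat -> Prop) (A : (set T)^nat) i : set T := if `[< P i >] then A i else set0.

Let mem_sel P A i y : sel P A i y <-> P i /\ A i y.
Proof. by rewrite /sel; case: asboolP => Pi; split => // -[]. Qed.

Let measurable_sel P A i : (P i -> measurable (A i)) -> measurable (sel P A i).
Proof. by rewrite /sel; case: asboolP => // Pi; exact. Qed.

(** At least half of [Om] is covered by good [B1 i]. Their sets [G] overlap at most [N] times, so
    their union has measure at least [theta / (2 * N)] times that of [Om]. Off this union [E] is
    bounded by what is left of [Om]; on it, by [tau] times the sum of the [mu (B i)], at most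
    [tau * N] times [mu Om]. *)
Lemma cover_estimate :
  (mu E <= (1 - theta / (2 * N%:R) + tau * N%:R)%:E * mu Om)%E.
Proof.
have Nr0 : 0 < N%:R :> R by rewrite ltr0n.
have /boolp.choice[G HG] : forall i, exists Gi : set T, good i ->
    [/\ measurable Gi, Gi `<=` B i, (theta%:E * mu (B1 i) <= mu Gi)%E
    & (mu (E `&` Gi) <= tau%:E * mu (B i))%E].
  move=> i; have [[Wi gi]|ni] := pselect (good i); last by exists set0.
  by have [Gi h] := good_sub Wi gi; exists Gi.
have fin A : measurable A -> A `<=` Om -> mu A \is a fin_num.
  by move=> mA AOm; rewrite ge0_fin_numE// (le_lt_trans _ Om_fin)// le_measure ?inE.
pose bad i := W i /\ ~ (mu (B i) <= (2 * N%:R)%:E * mu (B1 i))%E.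
have mW i : measurable (sel W B i) by apply: measurable_sel.
have mg i : measurable (sel good B1 i) by apply: measurable_sel.
have mb i : measurable (sel bad B1 i) by apply: measurable_sel.
have mG i : measurable (sel good G i) by apply: measurable_sel => /HG[].
have WOm i : sel W B i `<=` Om by move=> y /mem_sel[Wi By]; exact: BOm By.
have gOm i : sel good B1 i `<=` Om by move=> y /mem_sel[[Wi _] By]; exact/(BOm Wi)/B1B.
have bOm i : sel bad B1 i `<=` Om by move=> y /mem_sel[[Wi _] By]; exact/(BOm Wi)/B1B.
have GOm i : sel good G i `<=` Om.
  by move=> y /mem_sel[gi Gy]; have [_ GB _ _] := HG _ gi; exact/(BOm gi.1)/GB.
have SW : (\sum_(i <oo) mu (sel W B i) <= N%:R%:E * mu Om)%E.
  apply: overlap_series_le => // s y us hs; apply: (overlapB (y := y) us) => i /hs; exact: (mem_sel _ _ _ _).1.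
set UG := \bigcup_i sel good G i; set Ug := \bigcup_i sel good B1 i; set Ub := \bigcup_i sel bad B1 i.
have mUG : measurable UG by exact: bigcupT_measurable.
have mUg : measurable Ug by exact: bigcupT_measurable.
have mUb : measurable Ub by exact: bigcupT_measurable.
have UGOm : UG `<=` Om by apply: bigcup_sub => i _; exact: GOm.
have UgOm : Ug `<=` Om by apply: bigcup_sub => i _; exact: gOm.
have UbOm : Ub `<=` Om by apply: bigcup_sub => i _; exact: bOm.
have h1 : (mu Om <= mu Ug + mu Ub)%E.
  apply: le_trans (measureU2 _ mUg mUb); apply: le_measure; rewrite ?inE//; first exact: measurableU.
  move=> x /OmB1[i Wi xi].
  have [gi|bi] := pselect (mu (B i) <= (2 * N%:R)%:E * mu (B1 i))%E; [left|right];
    by exists i => //; apply/mem_sel; split.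
have h2 : (mu Ub <= 2^-1%:E * mu Om)%E.
  apply: (le_trans (measure_bigcup_le_series _ mb)).
  apply: (@le_trans _ _ (\sum_(i <oo) (2 * N%:R)^-1%:E * mu (sel W B i))%E).
    apply: lee_nneseries => i _ //; rewrite /sel.
    case: asboolP => [[Wi /negP]|_]; last by rewrite measure0 mule_ge0// lee_fin invr_ge0 mulr_ge0.
    rewrite -ltNge; case: asboolP => // _ /ltW h.
    by rewrite lee_pdivlMl// mulr_gt0.
  rewrite nneseriesZl//.
  apply: (@le_trans _ _ ((2 * N%:R)^-1%:E * (N%:R%:E * mu Om))%E).
    by apply: lee_wpmul2l => //; rewrite lee_fin invr_ge0 mulr_ge0.
  rewrite muleA -EFinM; apply: lee_wpmul2r => //; rewrite lee_fin.
  by rewrite invfM -mulrA mulVf ?gt_eqF// mulr1.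
have h3 : (theta%:E * mu Ug <= N%:R%:E * mu UG)%E.
  apply: (@le_trans _ _ (theta%:E * \sum_(i <oo) mu (sel good B1 i))%E).
    by apply: lee_wpmul2l => //; exact: measure_bigcup_le_series.
  rewrite -nneseriesZl//; apply: (@le_trans _ _ (\sum_(i <oo) mu (sel good G i))%E).
    apply: lee_nneseries => i _; first by rewrite mule_ge0.
    rewrite /sel; case: asboolP => [gi|_]; last by rewrite !measure0 mule0.
    by have [_ _ ? _] := HG _ gi.
  apply: overlap_series_le => //; first by move=> i; exact: bigcup_sup.
  move=> s y us hs; apply: (overlapB (y := y) us) => i /hs /mem_sel[gi Gy].
  by have [_ GB _ _] := HG _ gi; split; [exact: gi.1|exact: GB].
have h4 : (mu E <= (tau * N%:R)%:E * mu Om + (mu Om - mu UG))%E.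
  have -> : E = (E `&` UG) `|` (E `\` UG) by rewrite setUIDK.
  have mEU : measurable (E `&` UG) by exact: measurableI.
  have mED : measurable (E `\` UG) by exact: measurableD.
  apply: (le_trans (measureU2 _ mEU mED)); apply: leeD.
    rewrite setI_bigcupr; apply: (le_trans (measure_bigcup_le_series _ _)).
      by move=> i; exact: measurableI.
    apply: (@le_trans _ _ (\sum_(i <oo) tau%:E * mu (sel W B i))%E).
      apply: lee_nneseries => i _ //; rewrite /sel.
      case: asboolP => [gi|_]; last by rewrite setI0 measure0 mule_ge0.
      case: asboolP => [_|[]]; last exact: gi.1.
      by have [_ _ _ ?] := HG _ gi.
    rewrite nneseriesZl// EFinM -muleA; apply: lee_wpmul2l => //.
  rewrite -[in leRHS](setIidr UGOm) -measureD//.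
  apply: le_measure; rewrite ?inE//; first exact: measurableD.
  exact: setSD.
move: h1 h2 h3 h4.
have fO := fin _ mOm (@subset_refl _ _); have fG := fin _ mUG UGOm.
have fg := fin _ mUg UgOm; have fb := fin _ mUb UbOm; have fE := fin _ mE EOm.
rewrite -(fineK fO) -(fineK fG) -(fineK fg) -(fineK fb) -(fineK fE).
rewrite -!EFinN -!EFinM -!EFinD !lee_fin.
move: (fine (mu Om)) (fine (mu UG)) (fine (mu Ug)) (fine (mu Ub)) (fine (mu E)).
move=> o u g b e h1 h2 h3 h4.
have hg : o / 2 <= g by lra.
have hu : theta * o / (2 * N%:R) <= u.
  rewrite ler_pdivrMr ?mulr_gt0//; have := ler_wpM2l theta0 hg; lra.
apply: (le_trans h4).
rewrite (_ : (1 - theta / (2 * N%:R) + tau * N%:R) * o =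
  o - theta * o / (2 * N%:R) + tau * N%:R * o); last by ring.
lra.
Qed.

End covering.

Section distance_to_complement.
Context {R : realType} {n : nat}.
Local Notation T := (Rn R n).
Variables (Om : set T) (w0 : T).
Hypothesis w0P : ~ Om w0.
Hypothesis opOm : forall x, Om x -> exists2 r, 0 < r & forall y, sup_dist x y < r -> Om y.

(** A point [w0] outside [Om] makes this infimum range over a nonempty set. *)
Definition codist (x : T) : R := inf [set sup_dist x w | w in ~` Om].

Let codist_lb x : has_lbound [set sup_dist x w | w in ~` Om].
Proof. by exists 0 => _ [w _ <-]; exact: sup_dist_ge0. Qed.

Let codist_nonempty x : [set sup_dist x w | w in ~` Om] !=set0.
Proof. by exists (sup_dist x w0); exists w0. Qed.

Lemma codist_lt x r : codist x < r -> exists2 w, ~ Om w & sup_dist x w < r.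
Proof. by move=> /(inf_lt (codist_nonempty x))[_ [w nw <-] wr]; exists w. Qed.

Lemma codist_lip x y : codist x <= codist y + sup_dist x y.
Proof.
rewrite -lerBlDr; apply: lb_le_inf => // _ [w nw <-]; rewrite lerBlDr.
apply: (@le_trans _ _ (sup_dist x w)); first by apply: ge_inf => //; exists w.
by rewrite addrC sup_dist_triangle.
Qed.

Lemma codist_gt0 x : Om x <-> 0 < codist x.
Proof.
split=> [/opOm[r r0 h]|h].
  apply: (lt_le_trans r0); apply: lb_le_inf => // _ [w nw <-].
  by rewrite leNgt; apply/negP => /h.
apply: contrapT => nx; have : codist x <= sup_dist x x by apply: ge_inf => //; exists x.
by rewrite sup_distxx leNgt h.
Qed.

End distance_to_complement.

Lemma overlap_cst_gt0 n : (0 < @overlap_cst n)%N.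
Proof. by rewrite /overlap_cst -lock; apply/card_gt0P; exists (ord0, [ffun=> ord0]). Qed.

Section distribution.
Context {d} {T : measurableType d} {R : realType}
  (mu : {sigma_finite_measure set T -> \bar R}).
Local Notation leb := (@lebesgue_measure R).
Local Open Scope ereal_scope.

Lemma measurable_distribution (u : T -> \bar R) (D : set (measurableTypeR R)) :
  measurable_fun setT u -> measurable_fun D (fun s : R => mu [set x | s%:E < u x]).
Proof.
move=> mu_; apply: measurable_funTS.
have := measurable_fun_ysection mu (measurable_superlevel mu_).
apply: eq_measurable_fun => s _ /=; congr (mu _).
by apply/seteqP; split => x; rewrite /ysection/= ?inE.
Qed.

(** Integrating in [s] by the layer cake formula turns the left side into the integral of [u]
    divided by [1 + c / 2]. That factor is at least [1 - c / 2], so [c / 2] times the integral of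
    [u] survives after the finite term [1 - c] times it is absorbed. *)
Lemma integral_le_of_good_lambda (u v : T -> \bar R) (c : R) :
  measurable_fun setT u -> measurable_fun setT v ->
  (forall x, 0 <= u x) -> (forall x, 0 <= v x) -> (0 < c < 1)%R -> \int[mu]_x u x < +oo ->
  (forall s : R, (0 < s)%R -> mu [set x | ((1 + c / 2) * s)%:E < u x] <=
    (1 - c)%:E * mu [set x | s%:E < u x] + mu [set x | s%:E < v x]) ->
  \int[mu]_x u x <= (2 / c)%:E * \int[mu]_x v x.
Proof.
move=> mu_ mv u0 v0 /andP[c0 c1] ufin H.
set K := (1 + c / 2)%R in H.
have K0 : (0 < K)%R by rewrite /K addr_gt0// divr_gt0.
have Ki : (0 <= K^-1)%R by rewrite invr_ge0 ltW.
pose w x := K^-1%:E * u x.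
have mw : measurable_fun setT w by exact: measurable_funeM.
have w0 x : 0 <= w x by rewrite mule_ge0.
have mH : measurable (`]0%R, +oo[%classic : set (measurableTypeR R)) by exact: measurable_itv.
have step : \int[mu]_x w x <= (1 - c)%:E * \int[mu]_x u x + 1%:E * \int[mu]_x v x.
  rewrite (layer_cake mu mw w0) (layer_cake mu mu_ u0) (layer_cake mu mv v0).
  apply: le_integral_lincomb => //.
  - by rewrite subr_ge0 ltW.
  - exact: measurable_distribution.
  - exact: measurable_distribution.
  move=> s; rewrite /= in_itv/= andbT => s0; rewrite mul1e.
  apply: le_trans (H _ s0); rewrite (_ : [set x | s%:E < w x] = [set x | (K * s)%:E < u x])//.
  by apply/seteqP; split => x; rewrite /= /w lte_pdivlMl// EFinM.
move: step; rewrite ge0_integralZl// mul1e.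
have [->|] := eqVneq (\int[mu]_x v x) +oo.
  by move=> _; rewrite mulry gtr0_sg ?divr_gt0// mul1e leey.
rewrite -ltey => vfin.
have uf : \int[mu]_x u x \is a fin_num by rewrite ge0_fin_numE//; exact: integral_ge0.
have vf : \int[mu]_x v x \is a fin_num by rewrite ge0_fin_numE//; exact: integral_ge0.
rewrite -(fineK uf) -(fineK vf) -!EFinM -EFinD !lee_fin.
have X0 : (0 <= fine (\int[mu]_x u x))%R by rewrite fine_ge0// integral_ge0.
move: X0; move: (fine _) (fine _) => V X X0 h.
(* Because [(1 - c / 2) * (1 + c / 2) = 1 - (c / 2) ^+ 2]. *)
have Kc : (1 - c / 2 <= K^-1)%R.
  rewrite -[leRHS]mul1r ler_pdivlMr// /K -subr_ge0.
  by rewrite (_ : _ - _ = (c / 2) ^+ 2)%R ?sqr_ge0//; ring.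
have : (c / 2 * X <= V)%R by have := ler_wpM2r X0 Kc; lra.
by move=> h2; rewrite mulrAC ler_pdivlMr//; lra.
Qed.

End distribution.

(** A crude weighted inequality of arithmetic and geometric means: every [u i] is at most the sum,
    and the exponents add up to 1. *)
Lemma prod_powR_le_sum {R : realType} (k : nat) (u t : 'I_k.+1 -> R) :
  (forall i, 0 <= u i) -> (forall i, 0 < t i) -> \sum_i t i = 1 ->
  \prod_i u i `^ t i <= \sum_i u i.
Proof.
move=> u0 t0 t1; set S := \sum_i u i.
have uS i : u i <= S by rewrite /S (bigD1 i)//= lerDl sumr_ge0.
have S0 : 0 <= S by exact: sumr_ge0.
apply: (@le_trans _ _ (\prod_i S `^ t i)).
  by apply: ler_prod => i _; rewrite powR_ge0/=; apply: ge0_ler_powR; rewrite ?nnegrE// ltW.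
move: S0; rewrite le_eqVlt => /predU1P[<-|S0].
  by rewrite (bigD1 ord0)//= powR0 ?mul0r// gt_eqF.
have hS (a b : R) : (a + b == 0) ==> (S != 0) by rewrite (gt_eqF S0) implybT.
rewrite -(big_morph (powR S) (fun a b => powRD (hS a b)) (powRr0 S)).
by rewrite t1 powRr1// ltW.
Qed.

Lemma powR_prod {R : realType} (I : finType) (u : I -> R) (p : R) :
  (forall i, 0 <= u i) -> (\prod_i u i) `^ p = \prod_i u i `^ p.
Proof.
move=> u0; suff : 0 <= \prod_i u i /\ (\prod_i u i) `^ p = \prod_i u i `^ p by case.
elim/big_ind2 : _ => [|x1 x2 y1 y2 [x0 <-] [y0 <-]|i _]; last by [].
  by rewrite powR1.
by rewrite mulr_ge0// powRM.
Qed.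

(** Keeping [delta] at most 1 bounds its square by itself, so both conditions become linear. *)
Lemma exists_small_delta {R : realType} (L B x y : R) : 0 <= L -> 0 <= B -> 0 < x -> 0 < y ->
  exists2 delta, 0 < delta & L * delta ^+ 2 <= x /\ B * delta <= y.
Proof.
move=> L0 B0 x0 y0.
have L1 : 0 < L + 1 by rewrite ltr_wpDl.
have B1 : 0 < B + 1 by rewrite ltr_wpDl.
pose dl := Num.min 1 (Num.min (x / (L + 1)) (y / (B + 1))).
have d0 : 0 < dl by rewrite !lt_min ltr01 !divr_gt0.
have h1 : dl <= 1 by rewrite ge_min lexx.
have h2 : dl * (L + 1) <= x by rewrite -ler_pdivlMr// !ge_min lexx ?orbT.
have h3 : dl * (B + 1) <= y by rewrite -ler_pdivlMr// !ge_min lexx ?orbT.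
exists dl => //; split; last by nra.
have : dl ^+ 2 <= dl by rewrite expr2 ler_piMr// ltW.
nra.
Qed.

(** * Estimates for the square function *)

Section square_function_bounds.
Context {R : realType} {n : nat}.
Local Notation T := (Rn R n).
Local Notation leb := (@lebesgue_measure R).
Variable mu : {sigma_finite_measure set T -> \bar R}.
Variables m Cm : R.
Hypotheses (m0 : 0 < m) (Cm0 : 0 <= Cm).
Hypothesis mu_power : forall (x : T) r, 0 < r ->
  (mu [set y | (sup_dist x y <= r)%R] <= (Cm * r `^ m)%:E)%E.
Variables (k : nat) (s : R -> T -> k.+1.-tuple T -> R[i]) (Cs alpha lam : R).
Hypothesis ms : cmeasurable_fun setT
  (fun q : measurableTypeR R * T * k.+1.-tuple T => s q.1.1 q.1.2 q.2).
Hypotheses (Cs0 : 0 <= Cs) (alpha0 : 0 < alpha).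
Hypothesis lam_large : alpha + 2 * k.+1%:R * m <= m * lam.
Hypothesis size_s : size_condition m alpha Cs s.
Variables (f : 'I_k.+1 -> T -> R[i]) (p_ : 'I_k.+1 -> R).
Hypothesis mfc : forall i, cmeasurable_fun setT (f i).
Hypothesis p1 : forall i, 1 < p_ i.
Hypothesis fLp : forall i, (\int[mu]_x (cmod (f i x) `^ p_ i)%:E < +oo)%E.

Let a := alpha / 3.
Let a0 : 0 < a. Proof. by rewrite divr_gt0. Qed.

Definition absf i x : R := cmod (f i x).

Lemma measurable_absf i : measurable_fun setT (absf i).
Proof. exact: cmeasurable_cmod. Qed.

Lemma absf_ge0 i x : 0 <= absf i x.
Proof. exact: cmod_ge0. Qed.

Lemma le_1D_powR (x p : R) : 0 <= x -> 1 < p -> x <= 1 + x `^ p.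
Proof.
move=> x0 p_gt1; have [x1|x1] := leP x 1; first by rewrite ler_wpDr ?powR_ge0.
by rewrite ler_wpDl// -[leLHS](powRr1 x0) ler_powR// ltW.
Qed.

Lemma measurable_absf_powR i : measurable_fun setT (fun x => (absf i x `^ p_ i)%:E).
Proof.
by apply/measurable_EFinP; exact: (measurableT_comp (measurable_powR _) (measurable_absf i)).
Qed.

Lemma absf_locint i : locint mu (absf i).
Proof.
move=> x r; set B := [set y | _].
have mB : measurable B by exact: measurable_sup_ball.
apply: (@le_lt_trans _ _ (\int[mu]_(y in B) (1 + (absf i y `^ p_ i)%:E))%E).
  apply: le_nonneg_integral => y _; first by rewrite lee_fin absf_ge0.
  by rewrite -EFinD lee_fin le_1D_powR ?absf_ge0.
rewrite ge0_integralD//; first last.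
- by apply: measurable_funTS; exact: measurable_absf_powR.
- by move=> y _; rewrite lee_fin powR_ge0.
rewrite integral_cst// mul1e; apply: lte_add_pinfty; first exact: (mu_sup_ball_lty mu_power).
apply: le_lt_trans (fLp i); apply: ge0_subset_integral => //.
- exact: measurable_absf_powR.
- by move=> y _; rewrite lee_fin powR_ge0.
Qed.

Definition wabsf (b t : R) (y : T) i z : R := wt t y z `^ (m + b) * absf i z.

Lemma measurable_wabsf b t y i : 0 < t -> measurable_fun setT (wabsf b t y i).
Proof. by move=> t0; apply: measurable_funM; [exact: measurable_wt_r|exact: measurable_absf]. Qed.

Lemma wabsf_ge0 b t y i z : 0 <= wabsf b t y i z.
Proof. by rewrite mulr_ge0 ?powR_ge0 ?absf_ge0. Qed.

Lemma integrable_wabsf b t y i : 0 < b -> 0 < t -> mu.-integrable setT (EFin \o wabsf b t y i).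
Proof.
move=> b0 t0; apply/integrableP; split; first by apply/measurable_EFinP; exact: measurable_wabsf.
have mw : measurable_fun setT (fun z => (wt t y z `^ (m + b))%:E).
  by apply/measurable_EFinP; exact: measurable_wt_r.
(* The weight is at most 1 and [|f| <= 1 + |f|]^ p_ i[, so the product is at most the weight
   plus]|f| [^ p_ i], both integrable. *)
apply: (@le_lt_trans _ _ (\int[mu]_z ((wt t y z `^ (m + b))%:E + (absf i z `^ p_ i)%:E))%E).
  apply: le_nonneg_integral => z _ //=.
  rewrite -EFinD lee_fin ger0_norm ?wabsf_ge0//.
  have w1 : wt t y z `^ (m + b) <= 1.
    by rewrite wt_powR_le1// addr_ge0// ltW.
  have w0 := powR_ge0 (wt t y z) (m + b).
  have := le_1D_powR (absf_ge0 i z) (p1 i); have := powR_ge0 (absf i z) (p_ i).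
  rewrite /wabsf; nra.
rewrite ge0_integralD//; first last.
- exact: measurable_absf_powR.
- by move=> z _; rewrite lee_fin powR_ge0.
- by move=> z _; rewrite lee_fin powR_ge0.
apply: lte_add_pinfty; last exact: fLp.
by apply: le_lt_trans (integral_wt_le m0 b0 Cm0 mu_power y t0) _; rewrite ltry.
Qed.

Lemma size_wt t y zs : 0 < t ->
  cmod (s t y zs) <= Cs * (t `^ (- m)) ^+ k.+1 * \prod_i wt t y (tnth zs i) `^ (m + alpha).
Proof.
move=> t0; apply: (le_trans (size_s _ _ t0)).
rewrite -mulrA ler_wpM2l// /kernel_denom le_eqVlt; apply/orP; left; apply/eqP.
have -> : t `^ (k.+1%:R * alpha) = \prod_(i < k.+1) (t `^ alpha).
  by rewrite prodr_const card_ord mulrC powRrM powR_mulrn ?powR_ge0.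
have -> : (t `^ (- m)) ^+ k.+1 = \prod_(i < k.+1) t `^ (- m) by rewrite prodr_const card_ord.
rewrite -prodf_div -big_split/=.
apply: eq_bigr => i _; have d0 := wt_denom_gt0 y (tnth zs i) t0.
rewrite /wt powRM ?invr_ge0 ?(ltW d0) ?(ltW t0)// mulrA -powRD; last by rewrite (gt_eqF t0) implybT.
rewrite addrA addNr add0r -powR_inv1 ?(ltW d0)// -powRrM mulN1r powRN//.
Qed.

(** The set [B] of tuples separates configurations near a cube from those with a far entry; the full
    set gives back [Theta_mu]. *)
Definition ThB (B : set (k.+1.-tuple T)) (t : R) (y : T) : R[i] :=
  iterated_integral (fun _ : 'I_k.+1 => cintegral mu)
    (fun zs => s t y zs * \prod_i f i (tnth zs i) * (\1_B zs : R)%:C).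

Lemma Theta_mu_ThB : Theta_mu s mu f = ThB setT.
Proof.
apply/funext => t; apply/funext => y; rewrite /Theta_mu /ThB; congr iterated_integral.
by apply/funext => zs; rewrite indicT mulr1.
Qed.

Section B.
Variable B : set (k.+1.-tuple T).
Hypothesis mB : measurable B.

Lemma cmeasurable_indicC : cmeasurable_fun setT (fun zs => (\1_B zs : R)%:C).
Proof. by split; [exact: measurable_indic|exact: measurable_cst]. Qed.

Lemma cmeasurable_ThB_integrand : cmeasurable_fun setT
  (fun q : (measurableTypeR R * T) * k.+1.-tuple T =>
    s q.1.1 q.1.2 q.2 * \prod_i f i (tnth q.2 i) * (\1_B q.2 : R)%:C).
Proof.
apply: cmeasurable_funM; last exact: (cmeasurable_comp cmeasurable_indicC measurable_snd).
apply: cmeasurable_funM => //; apply: cmeasurable_prod => i.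
apply: (cmeasurable_comp (mfc i)).
exact: (measurableT_comp (measurable_tnth i) measurable_snd).
Qed.

Lemma cmeasurable_ThB : cmeasurable_fun setT
  (fun p : measurableTypeR R * T => ThB B p.1 p.2).
Proof. exact: (measurable_iterated _ cmeasurable_ThB_integrand). Qed.

(** Part of the decay [alpha] of the kernel may be exchanged on [B] for a factor [D], leaving decay
    [b]. *)
Lemma tuple_dominated_ThB (b D t : R) y : 0 < t -> 0 <= D ->
  (forall zs, B zs -> \prod_i wt t y (tnth zs i) `^ (m + alpha) <=
     D * \prod_i wt t y (tnth zs i) `^ (m + b)) ->
  tuple_dominated (Cs * (t `^ (- m)) ^+ k.+1 * D) (wabsf b t y)
   (fun zs => s t y zs * \prod_i f i (tnth zs i) * (\1_B zs : R)%:C).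
Proof.
move=> t0 D0 hB; split.
  apply: (cmeasurable_comp cmeasurable_ThB_integrand (g := fun zs => ((t : measurableTypeR R, y), zs))).
  exact: measurable_pair1.
move=> zs; rewrite !cmodM cmod_prod.
have [Bzs|nB] := pselect (B zs); last first.
  have -> : \1_B zs = 0 :> R by rewrite indicE memNset.
  rewrite cmod0 mulr0 mulr_ge0//; last by apply: prodr_ge0 => i _; exact: wabsf_ge0.
  by rewrite mulr_ge0// mulr_ge0// exprn_ge0// powR_ge0.
have -> : \1_B zs = 1 :> R by rewrite indicE mem_set.
have -> : cmod 1%:C = 1 :> R by rewrite cmodE/= expr0n addr0 expr1n sqrtr1.
rewrite mulr1 big_split/= mulrA ler_wpM2r//; first by apply: prodr_ge0 => i _; exact: cmod_ge0.
apply: (le_trans (size_wt _ _ t0)); rewrite -[leRHS]mulrA ler_wpM2l ?hB//.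
by rewrite mulr_ge0 ?exprn_ge0 ?powR_ge0.
Qed.

Lemma cmod_ThB_le (b D t : R) y : 0 < b -> 0 < t -> 0 <= D ->
  (forall zs, B zs -> \prod_i wt t y (tnth zs i) `^ (m + alpha) <=
     D * \prod_i wt t y (tnth zs i) `^ (m + b)) ->
  cmod (ThB B t y) <= 2 ^+ k.+1 * Cs * D * \prod_i (fine (pavg mu m b (absf i) t y) / t `^ m).
Proof.
move=> b0 t0 D0 hB.
have := cmod_iterated_le (fun i z => wabsf_ge0 b t y i z) (fun i => integrable_wabsf y i b0 t0) _
  (tuple_dominated_ThB t0 D0 hB).
move=> /(_ (mulr_ge0 (mulr_ge0 Cs0 (exprn_ge0 _ (powR_ge0 _ _))) D0)) h; apply: (le_trans h).
rewrite le_eqVlt; apply/orP; left; apply/eqP.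
rewrite big_split/= [X in _ = _ * (_ * X)]prodr_const card_ord -powRN.
by rewrite /Rintegral /pavg/=; ring.
Qed.

End B.

Lemma ThB_split (B : set (k.+1.-tuple T)) t y : measurable B -> 0 < t ->
  ThB setT t y = ThB B t y + ThB (~` B) t y.
Proof.
move=> mB t0.
have one (zs : k.+1.-tuple T) : \prod_i wt t y (tnth zs i) `^ (m + alpha) <=
    1 * \prod_i wt t y (tnth zs i) `^ (m + alpha) by rewrite mul1r.
have C0 : 0 <= Cs * (t `^ (- m)) ^+ k.+1 * 1 by rewrite !mulr_ge0 ?exprn_ge0 ?powR_ge0.
rewrite /ThB -(iteratedD (fun i z => wabsf_ge0 alpha t y i z) (fun i => integrable_wabsf y i alpha0 t0) C0
  (tuple_dominated_ThB mB t0 ler01 (fun zs _ => one zs))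
  (tuple_dominated_ThB (measurableC mB) t0 ler01 (fun zs _ => one zs))).
congr iterated_integral; apply/funext => zs.
rewrite -mulrDr indicT; congr (_ * _).
rewrite !indicE in_setC; case: (zs \in B) => /=; by apply/eqP; rewrite eq_complex/= ?addr0 ?add0r !eqxx.
Qed.

Definition sq_slice (Th : R -> T -> R[i]) (x : T) (t : R) : \bar R :=
  (\int[mu]_y (wt t x y `^ (m * lam) * cmod (Th t y) ^+ 2 / t `^ (m + 1))%:E)%E.

Lemma sq_slice_ge0 Th x t : (0 <= sq_slice Th x t)%E.
Proof. by apply: integral_ge0 => y _; rewrite lee_fin divr_ge0 ?powR_ge0// mulr_ge0 ?powR_ge0 ?sqr_ge0. Qed.

Lemma measurable_sq_slice_integrand Th x t : 0 < t ->
  cmeasurable_fun setT (fun p : measurableTypeR R * T => Th p.1 p.2) ->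
  measurable_fun setT (fun y => (wt t x y `^ (m * lam) * cmod (Th t y) ^+ 2 / t `^ (m + 1))%:E).
Proof.
move=> t0 mTh; apply/measurable_EFinP; apply: measurable_funM => //.
apply: measurable_funM; first exact: measurable_wt_r.
apply: measurable_funX; apply: cmeasurable_cmod.
exact: (cmeasurable_comp mTh (measurable_pair1 (t : measurableTypeR R))).
Qed.

(** For [t > 0] the quotients are real powers, jointly measurable in [(t, y)], and Tonelli applies;
    hence the restriction to the half-line. *)
Lemma measurable_sq_slice Th x :
  cmeasurable_fun setT (fun p : measurableTypeR R * T => Th p.1 p.2) ->
  measurable_fun (`]0, +oo[%classic : set (measurableTypeR R)) (sq_slice Th x).
Proof.
move=> mTh.
pose h (p : measurableTypeR R * T) : \bar R :=
  ((p.1 * (p.1 + eucl_dist x p.2) `^ (-1)) `^ (m * lam) * cmod (Th p.1 p.2) ^+ 2 * p.1 `^ (- (m + 1)))%:E.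
have mh : measurable_fun setT h.
  apply/measurable_EFinP; apply: measurable_funM; last first.
    exact: (measurableT_comp (measurable_powR _) measurable_fst).
  apply: measurable_funM; last by apply: measurable_funX; exact: cmeasurable_cmod.
  apply: (measurableT_comp (measurable_powR _)); apply: measurable_funM => //.
  apply: (measurableT_comp (measurable_powR _)); apply: measurable_funD => //.
  exact: (measurableT_comp (measurable_eucl_dist_l x) measurable_snd).
have h0 p : (0 <= h p)%E by rewrite lee_fin mulr_ge0 ?powR_ge0// mulr_ge0 ?powR_ge0 ?sqr_ge0.
have := @measurable_fun_fubini_tonelli_F _ _ _ _ _ mu h mh h0.
move=> /(measurable_funTS (D := `]0, +oo[%classic : set (measurableTypeR R))); apply: eq_measurable_fun.
move=> t; rewrite inE/= in_itv/= andbT => t0; rewrite /sq_slice /fubini_F.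
by apply: eq_integral => y _; rewrite /h/= wtE// powRN.
Qed.

Lemma alpha_ge_b (zs : k.+1.-tuple T) (t : R) (y : T) (b : R) : b <= alpha -> 0 < t ->
  \prod_(i < k.+1) wt t y (tnth zs i) `^ (m + alpha) <= 1 * \prod_(i < k.+1) wt t y (tnth zs i) `^ (m + b).
Proof.
move=> ba t0; rewrite mul1r; apply: ler_prod => i _; rewrite powR_ge0/=.
have w0 := wt_gt0 y (tnth zs i) t0; have w1 := wt_le1 y (tnth zs i) t0.
by rewrite /powR !gt_eqF// ler_expR; apply: ler_wnM2r; [rewrite ln_le0|rewrite lerD2l].
Qed.

Section point.
Variables (x : T) (K : 'I_k.+1 -> R).
Hypotheses (K0 : forall i, 0 <= K i) (MK : forall i, (maximal mu (absf i) x <= (K i)%:E)%E).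

Definition slice_cst : R := locked (key_cst m a Cm k * (2 ^+ k.+1 * Cs) ^+ 2).

Lemma slice_cst_ge0 : 0 <= slice_cst.
Proof.
rewrite /slice_cst -lock mulr_ge0 ?sqr_ge0// /key_cst !mulr_ge0 ?exprn_ge0 ?conv_cst_ge0 ?avg_cst_ge0//.
Qed.

Lemma sq_slice_le_gen Th (D t : R) : 0 < t -> 0 <= D ->
  cmeasurable_fun setT (fun p : measurableTypeR R * T => Th p.1 p.2) ->
  (forall y, cmod (Th t y) <= (2 ^+ k.+1 * Cs) * D * wt t x y `^ (- a) *
     \prod_i (fine (pavg mu m a (absf i) t y) / t `^ m)) ->
  (sq_slice Th x t <= (slice_cst * D ^+ 2 * (\prod_i K i) ^+ 2 * t^-1)%:E)%E.
Proof.
move=> t0 D0 mTh hTh.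
have D1 : 0 <= 2 ^+ k.+1 * Cs * D by rewrite !mulr_ge0 ?exprn_ge0.
have lam' : 2 * a + 2 * k.+1%:R * m + a <= m * lam by move: lam_large; rewrite /a; lra.
have := key_estimate m0 a0 Cm0 mu_power (fun i => measurable_absf i) (fun i => absf_ge0 i)
  (fun i => absf_locint i) K0 MK t0 D1 (ltW a0) lam' (fun y => cmod_ge0 (Th t y)) hTh.
move=> h.
have tm0 : 0 <= (t `^ (m + 1))^-1 by rewrite invr_ge0 powR_ge0.
have -> : sq_slice Th x t = ((t `^ (m + 1))^-1%:E *
    \int[mu]_y (wt t x y `^ (m * lam) * cmod (Th t y) ^+ 2)%:E)%E.
  rewrite -ge0_integralZl//; first by apply: eq_integral => y _; rewrite -EFinM mulrC.
  - apply/measurable_EFinP; apply: measurable_funM; first exact: measurable_wt_r.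
    apply: measurable_funX; apply: cmeasurable_cmod.
    exact: (cmeasurable_comp mTh (measurable_pair1 (t : measurableTypeR R))).
  - by move=> y _; rewrite lee_fin mulr_ge0 ?powR_ge0 ?sqr_ge0.
apply: (le_trans (lee_wpmul2l _ h)); first by rewrite lee_fin.
rewrite -EFinM lee_fin /slice_cst -lock le_eqVlt; apply/orP; left; apply/eqP.
rewrite powRD ?powRr1 ?(ltW t0)//; last by rewrite (gt_eqF t0) implybT.
have tm := powR_gt0 m t0.
by field; rewrite !gt_eqF.
Qed.

(** The bound [1 / t] is scale invariant and fails to be integrable both at 0 and at infinity: it
    serves on a window, and elsewhere only with an additional gain. *)
Lemma sq_slice_le t : 0 < t ->
  (sq_slice (ThB setT) x t <= (slice_cst * (\prod_i K i) ^+ 2 * t^-1)%:E)%E.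
Proof.
move=> t0.
have -> : slice_cst * (\prod_i K i) ^+ 2 * t^-1 = slice_cst * 1 ^+ 2 * (\prod_i K i) ^+ 2 * t^-1.
  by rewrite expr1n mulr1.
apply: sq_slice_le_gen => //; first exact: (cmeasurable_ThB measurableT).
move=> y; rewrite mulr1.
apply: (le_trans (cmod_ThB_le measurableT a0 t0 ler01 (fun zs _ => alpha_ge_b zs y _ t0))).
  by move=> zs _; rewrite /a; move: alpha0; lra.
rewrite mulr1 ler_wpM2r//.
  by apply: prodr_ge0 => i _; rewrite divr_ge0 ?fine_ge0 ?powR_ge0 ?pavg_ge0//; exact: absf_ge0.
rewrite ler_peMr ?mulr_ge0 ?exprn_ge0// powRN -[leLHS]invr1 lef_pV2 ?posrE ?powR_gt0 ?wt_gt0//.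
by rewrite wt_powR_le1// ltW.
Qed.

(* A tuple with an entry at distance at least [r] from [x] gains the factor
   [(t / r) ^ a], because [wt t x y * wt t y z <= wt t x z <= t / r]. *)
Lemma sq_slice_far_le (A : set T) (r t : R) : measurable A -> 0 < r ->
  (forall z, ~ A z -> r <= eucl_dist x z) -> 0 < t ->
  (sq_slice (ThB (~` [set zs | forall i, A (tnth zs i)])) x t <=
    (slice_cst * (r `^ (- (2 * a))) * (\prod_i K i) ^+ 2 * t `^ (2 * a - 1))%:E)%E.
Proof.
move=> mA r0 hA t0; set B := ~` _.
have mB : measurable B.
  apply: measurableC; rewrite (_ : [set zs | _] = \bigcap_(i in [set: 'I_k.+1]) ((fun zs => tnth zs i) @^-1` A)).
    apply: fin_bigcap_measurable; first exact: finite_finset.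
    by move=> i _; rewrite -[X in measurable X]setTI; exact: measurable_tnth.
  by apply/seteqP; split => zs /= h i; [move=> _; exact: h|exact: (h i I)].
(* The power of [t / r] is the gain; the negative power of the weight is the loss that
   [sq_slice_le_gen] tolerates. *)
pose D y := (t / r) `^ a * wt t x y `^ (- a).
have D0 y : 0 <= D y by rewrite mulr_ge0 ?powR_ge0.
have hD y zs : B zs -> \prod_i wt t y (tnth zs i) `^ (m + alpha) <=
     D y * \prod_i wt t y (tnth zs i) `^ (m + a).
  move=> /existsNP[i0 /hA ri0].
  have w0 z : 0 < wt t y z by exact: wt_gt0.
  have w1 z : wt t y z <= 1 by exact: wt_le1.
  have step z : wt t y z `^ (m + alpha) <= wt t y z `^ (m + a).
    rewrite /powR !gt_eqF// ler_expR; apply: ler_wnM2r; first by rewrite ln_le0.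
    by rewrite lerD2l /a; move: alpha0; lra.
  rewrite (bigD1 i0)//= [X in _ <= _ * X](bigD1 i0)//= mulrA; apply: ler_pM.
  - exact: powR_ge0.
  - by apply: prodr_ge0 => i _; exact: powR_ge0.
  - set z := tnth zs i0 in ri0 *.
    (* The distant entry has [alpha >= 2 * a] of decay: one [a] is kept, the other yields the
       gain. *)
    apply: (@le_trans _ _ (wt t y z `^ a * wt t y z `^ (m + a))).
      rewrite -powRD; last by rewrite (gt_eqF (w0 z)) implybT.
      rewrite /powR !gt_eqF// ler_expR; apply: ler_wnM2r; first by rewrite ln_le0.
      by rewrite /a; move: alpha0; lra.
    rewrite ler_wpM2r ?powR_ge0// /D.
    have wx := wt_gt0 x y t0.
    rewrite powRN -ler_pdivrMr ?invr_gt0 ?powR_gt0// invrK -powRM ?(ltW (w0 _)) ?(ltW wx)//.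
    apply: ge0_ler_powR; rewrite ?nnegrE ?(ltW a0)//.
    - by rewrite mulr_ge0 ?(ltW (w0 _)) ?(ltW wx).
    - by rewrite divr_ge0 ?(ltW t0) ?(ltW r0).
    rewrite mulrC; apply: (le_trans (wtM_le x y z t0)).
    rewrite /wt ler_pM2l// lef_pV2 ?posrE ?wt_denom_gt0//.
    by rewrite (le_trans ri0)// lerDr ltW.
  - by apply: ler_prod => i _; rewrite powR_ge0 step.
have := @sq_slice_le_gen (ThB B) ((t / r) `^ a) t t0 (powR_ge0 _ _) (cmeasurable_ThB mB).
have -> : slice_cst * ((t / r) `^ a) ^+ 2 * (\prod_i K i) ^+ 2 * t^-1 =
    slice_cst * (r `^ (- (2 * a))) * (\prod_i K i) ^+ 2 * t `^ (2 * a - 1).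
  rewrite powRD; last by rewrite (gt_eqF t0) implybT.
  rewrite powR_inv1 ?(ltW t0)// -powR_mulrn ?powR_ge0// -powRrM mulrC powRM ?invr_ge0 ?(ltW t0) ?(ltW r0)//.
  rewrite -[r^-1]powR_inv1 ?(ltW r0)// -powRrM mulN1r (mulrC a 2).
  ring.
apply => y; rewrite -(mulrA _ ((t / r) `^ a)) -/(D y).
exact: (cmod_ThB_le mB a0 t0 (D0 y) (hD y)).
Qed.

End point.

Definition sqf (D : set R) (Th : R -> T -> R[i]) (x : T) : \bar R :=
  (\int[leb]_(t in D) sq_slice Th x t)%E.

Definition halfline : set R := `]0, +oo[%classic.

Lemma sqf_ge0 D Th x : (0 <= sqf D Th x)%E.
Proof. by apply: integral_ge0 => t _; exact: sq_slice_ge0. Qed.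

Lemma square_function_sqf Th x :
  square_function mu m lam Th x = (sqf halfline Th x `^ 2^-1)%E.
Proof. by []. Qed.

Definition window (e : R) : set R := `[e, e^-1]%classic.

Lemma windowP (e t : R) : window e t <-> e <= t <= e^-1.
Proof. by rewrite /window/= in_itv/=. Qed.

Lemma measurable_window e : measurable (window e : set (measurableTypeR R)).
Proof. exact: measurable_itv. Qed.

Lemma window_gt0 e t : 0 < e -> window e t -> 0 < t.
Proof. by move=> e0 /windowP/andP[et _]; exact: lt_le_trans et. Qed.

Lemma window_pos e : 0 < e -> window e `<=` halfline.
Proof. by move=> e0 t /(window_gt0 e0) t0; rewrite /halfline/= in_itv/= andbT. Qed.

Lemma leb_window e : 0 < e -> (leb (window e) <= e^-1%:E)%E.
Proof.
move=> e0; rewrite /window lebesgue_measure_itv/=; case: ifPn => _; last first.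
  by rewrite lee_fin invr_ge0 ltW.
by rewrite -EFinD lee_fin gerBl ltW.
Qed.

Lemma measurable_slice Th x (D : set R) : measurable (D : set (measurableTypeR R)) ->
  D `<=` halfline ->
  cmeasurable_fun setT (fun p : measurableTypeR R * T => Th p.1 p.2) ->
  measurable_fun (D : set (measurableTypeR R)) (sq_slice Th x).
Proof.
by move=> mD D0 mTh; apply: measurable_funS (measurable_sq_slice x mTh).
Qed.

Lemma sqf_subset D D' Th x :
  measurable (D : set (measurableTypeR R)) -> measurable (D' : set (measurableTypeR R)) ->
  D `<=` D' -> D' `<=` halfline ->
  cmeasurable_fun setT (fun p : measurableTypeR R * T => Th p.1 p.2) ->
  (sqf D Th x <= sqf D' Th x)%E.
Proof.
move=> mD mD' DD' D'0 mTh; apply: ge0_subset_integral => //; first exact: measurable_slice.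
by move=> t _; exact: sq_slice_ge0.
Qed.

Lemma integrand_ge0 (Th : R -> T -> R[i]) (x : T) (t : R) (y : T) :
  (0 <= (wt t x y `^ (m * lam) * cmod (Th t y) ^+ 2 / t `^ (m + 1))%:E)%E.
Proof. by rewrite lee_fin divr_ge0 ?powR_ge0// mulr_ge0 ?powR_ge0 ?sqr_ge0. Qed.

(** On the window [t] is at least [e], so moving the vertex changes the weights by a bounded factor,
    which tends to 1 with the displacement: this makes superlevel sets open. *)
Lemma sqf_shift e Th x x' : 0 < e -> 0 <= m * lam ->
  cmeasurable_fun setT (fun p : measurableTypeR R * T => Th p.1 p.2) ->
  (sqf (window e) Th x <= ((1 + eucl_dist x x' / e) `^ (m * lam))%:E * sqf (window e) Th x')%E.
Proof.
move=> e0 q0 mTh; apply: le_integral_scale => //.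
- exact: measurable_window.
- exact: powR_ge0.
- by apply: measurable_slice => //; [exact: measurable_window|exact: window_pos].
- by move=> t _; exact: sq_slice_ge0.
- by move=> t _; exact: sq_slice_ge0.
move=> t Jt; have t0 := window_gt0 e0 Jt; have /windowP/andP[et _] := Jt.
apply: le_integral_scale => //.
- exact: powR_ge0.
- exact: (measurable_sq_slice_integrand x' t0 mTh).
- by move=> y _; exact: integrand_ge0.
- by move=> y _; exact: integrand_ge0.
move=> y _; rewrite -EFinM lee_fin.
set N := cmod _ ^+ 2; set r := (t `^ (m + 1))^-1.
have N0 : 0 <= N by exact: sqr_ge0.
have r0 : 0 <= r by rewrite invr_ge0 powR_ge0.
have d0 := eucl_dist_ge0 x x'.
have wx := ltW (wt_gt0 x y t0); have wx' := ltW (wt_gt0 x' y t0).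
have de : 0 <= 1 + eucl_dist x x' / e by rewrite addr_ge0// divr_ge0 ?(ltW e0).
move: N N0 r r0 => N N0 r r0.
rewrite !mulrA ler_wpM2r// ler_wpM2r// -powRM//.
apply: ge0_ler_powR; rewrite ?nnegrE//; first exact: mulr_ge0.
apply: (le_trans (wt_shift x x' y t0)); rewrite mulrC ler_wpM2r//.
by rewrite lerD2l ler_wpM2l// lef_pV2.
Qed.

Lemma sqf_window_le e x (K : 'I_k.+1 -> R) : 0 < e -> (forall i, 0 <= K i) ->
  (forall i, (maximal mu (absf i) x <= (K i)%:E)%E) ->
  (sqf (window e) (ThB setT) x <= (slice_cst * (e^-1) ^+ 2 * (\prod_i K i) ^+ 2)%:E)%E.
Proof.
move=> e0 K0 MK.
have c0 : 0 <= slice_cst * (\prod_i K i) ^+ 2 by rewrite mulr_ge0 ?slice_cst_ge0 ?sqr_ge0.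
have ei : 0 <= e^-1 by rewrite invr_ge0 ltW.
apply: (@le_trans _ _ (\int[leb]_(t in window e) (slice_cst * (\prod_i K i) ^+ 2 * e^-1)%:E)%E).
  apply: le_nonneg_integral => t Jt; first exact: sq_slice_ge0.
  have t0 := window_gt0 e0 Jt; have /windowP/andP[et _] := Jt.
  apply: (le_trans (sq_slice_le K0 MK t0)).
  by rewrite lee_fin ler_wpM2l// lef_pV2.
rewrite integral_cst; last exact: measurable_window.
apply: (@le_trans _ _ ((slice_cst * (\prod_i K i) ^+ 2 * e^-1)%:E * e^-1%:E)%E).
  by apply: lee_wpmul2l; rewrite ?leb_window// lee_fin mulr_ge0.
rewrite -EFinM lee_fin le_eqVlt; apply/orP; left; apply/eqP; ring.
Qed.

Definition all_in (A : set T) : set (k.+1.-tuple T) := [set zs | forall i, A (tnth zs i)].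

Lemma measurable_all_in A : measurable A -> measurable (all_in A).
Proof.
move=> mA; rewrite (_ : all_in A = \bigcap_(i in [set: 'I_k.+1]) ((fun zs => tnth zs i) @^-1` A)).
  apply: fin_bigcap_measurable; first exact: finite_finset.
  by move=> i _; rewrite -[X in measurable X]setTI; exact: measurable_tnth.
by apply/seteqP; split => zs /= h i; [move=> _; exact: h|exact: (h i I)].
Qed.

Lemma sq_slice_split B x t : measurable B -> 0 < t ->
  (sq_slice (ThB setT) x t <= 2%:E * sq_slice (ThB B) x t + 2%:E * sq_slice (ThB (~` B)) x t)%E.
Proof.
move=> mB t0; apply: le_integral_lincomb => //.
- exact: (measurable_sq_slice_integrand x t0 (cmeasurable_ThB mB)).
- by move=> y _; exact: integrand_ge0.
- exact: (measurable_sq_slice_integrand x t0 (cmeasurable_ThB (measurableC mB))).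
- by move=> y _; exact: integrand_ge0.
- by move=> y _; exact: integrand_ge0.
move=> y _; rewrite -!EFinM -EFinD lee_fin.
rewrite (ThB_split y mB t0).
set u := ThB B t y; set v := ThB (~` B) t y.
have h : cmod (u + v) ^+ 2 <= 2 * cmod u ^+ 2 + 2 * cmod v ^+ 2.
  exact: sqr_le_2sqrD (cmod_ge0 _) (cmodD u v).
set w := wt t x y `^ (m * lam); set r := (t `^ (m + 1))^-1.
have wr : 0 <= w * r by rewrite mulr_ge0 ?invr_ge0 ?powR_ge0.
have := ler_wpM2l wr h; lra.
Qed.

Definition local_cst (c1 : R) : R := locked (slice_cst / a + m * lam * c1 * slice_cst).

(** The two ranges of [t] are handled separately, cut at the side [l]: small [t] by localising the
    functions to [A], large [t] by moving the vertex from [x] to [w]. *)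
Lemma sqf_local (c1 l e : R) x w (K : 'I_k.+1 -> R) (A : set T) : 0 < l -> 0 < e -> 0 <= c1 ->
  0 <= m * lam ->
  eucl_dist x w <= c1 * l -> measurable A -> (forall z, ~ A z -> l <= eucl_dist x z) ->
  (forall i, 0 <= K i) -> (forall i, (maximal mu (absf i) x <= (K i)%:E)%E) ->
  (sqf (window e) (ThB setT) x <= sqf (window e) (ThB setT) w +
     2%:E * sqf halfline (ThB (all_in A)) x + (local_cst c1 * (\prod_i K i) ^+ 2)%:E)%E.
Proof.
move=> l0 e0 c10 q0 dxw mA hA K0 MK.
have mH : measurable (halfline : set (measurableTypeR R)) by exact: measurable_itv.
have mB := measurable_all_in mA; set B := all_in A in mB *.
set P2 := (\prod_i K i) ^+ 2.
have P20 : 0 <= P2 by exact: sqr_ge0.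
have C0 : 0 <= slice_cst by exact: slice_cst_ge0.
pose J1 := window e `&` `]0, l[%classic; pose J2 := window e `&` `[l, +oo[%classic.
have mJ1 : measurable (J1 : set (measurableTypeR R)).
  by apply: measurableI; [exact: measurable_window|exact: measurable_itv].
have mJ2 : measurable (J2 : set (measurableTypeR R)).
  by apply: measurableI; [exact: measurable_window|exact: measurable_itv].
have J1p : J1 `<=` halfline by move=> t [/(window_pos e0)].
have J2p : J2 `<=` halfline by move=> t [/(window_pos e0)].
have mT B' : measurable B' -> cmeasurable_fun setT
    (fun p : measurableTypeR R * T => ThB B' p.1 p.2) by exact: cmeasurable_ThB.
have mTT := mT setT measurableT.
have -> : sqf (window e) (ThB setT) x = (sqf J1 (ThB setT) x + sqf J2 (ThB setT) x)%E.
  rewrite /sqf -ge0_integral_setU//.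
  - congr integral; rewrite -setIUr; apply/seteqP; split => [t Jt|t []//].
    split => //=; have t0 := window_gt0 e0 Jt.
    by have [tl|tl] := ltP t l; [left|right]; rewrite /= in_itv/= ?t0 ?tl.
  - by apply: measurable_slice => //; [exact: measurableU|rewrite subUset].
  - by move=> t _; exact: sq_slice_ge0.
  - apply/disj_setPS => t [[_ /=]]; rewrite in_itv/= => /andP[_ tl] [_ /=].
    by rewrite in_itv/= andbT leNgt tl.
have h1 : (sqf J1 (ThB setT) x <= 2%:E * sqf halfline (ThB B) x + (slice_cst / a * P2)%:E)%E.
  apply: (@le_trans _ _ (2%:E * sqf J1 (ThB B) x + 2%:E * sqf J1 (ThB (~` B)) x)%E).
    apply: le_integral_lincomb => //.
    - exact: (measurable_slice x mJ1 J1p (mT _ mB)).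
    - by move=> t _; exact: sq_slice_ge0.
    - exact: (measurable_slice x mJ1 J1p (mT _ (measurableC mB))).
    - by move=> t _; exact: sq_slice_ge0.
    - by move=> t _; exact: sq_slice_ge0.
    by move=> t Jt; apply: sq_slice_split => //; exact: (window_gt0 e0 Jt.1).
  apply: leeD.
    by apply: lee_wpmul2l => //; exact: (sqf_subset x mJ1 mH J1p (fun _ h => h) (mT _ mB)).
  have c0 : 0 <= slice_cst * l `^ (- (2 * a)) * P2 by rewrite mulr_ge0// mulr_ge0// powR_ge0.
  apply: (@le_trans _ _ (2%:E * ((slice_cst * l `^ (- (2 * a)) * P2)%:E *
      \int[leb]_(t in `]0%R, l[) (t `^ (2 * a - 1))%:E))%E).
    apply: lee_wpmul2l => //.
    apply: (@le_trans _ _ (sqf `]0, l[%classic (ThB (~` B)) x)).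
      apply: (sqf_subset x mJ1 (measurable_itv _) _ _ (mT _ (measurableC mB))); first by move=> t [_].
      by move=> t; rewrite /halfline /= !in_itv/= => /andP[-> _].
    apply: le_integral_scale => //.
    - by apply: measurable_funTS; exact: measurable_powR_EFin.
    - by move=> t _; rewrite lee_fin powR_ge0.
    - by move=> t _; exact: sq_slice_ge0.
    move=> t; rewrite /= in_itv/= => /andP[t0 _].
    by have := sq_slice_far_le K0 MK mA l0 hA t0.
  have a20 : 0 < 2 * a by rewrite mulr_gt0.
  apply: (@le_trans _ _ (2%:E * ((slice_cst * l `^ (- (2 * a)) * P2)%:E * (l `^ (2 * a) / (2 * a))%:E))%E).
    apply: lee_wpmul2l => //; apply: lee_wpmul2l; first by rewrite lee_fin.
    exact: (integral_powR_near0 a20 (ltW l0)).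
  rewrite -!EFinM lee_fin powRN le_eqVlt; apply/orP; left; apply/eqP.
  by field; rewrite !gt_eqF ?powR_gt0.
(* Here [powR_wt_shift] costs [c1 * l / t] times the slice at [x], altogether a multiple of
   [l / t ^+ 2], integrable from [l] on. *)
have h2 : (sqf J2 (ThB setT) x <= sqf (window e) (ThB setT) w + (m * lam * c1 * slice_cst * P2)%:E)%E.
  set c2 := m * lam * c1 * slice_cst * P2 * l.
  have c20 : 0 <= c2 by rewrite /c2 mulr_ge0 ?(ltW l0)// mulr_ge0// mulr_ge0// mulr_ge0.
  have mp : measurable_fun (J2 : set (measurableTypeR R)) (fun t : R => (t `^ (- 1 - 1))%:E).
    by apply: measurable_funTS; exact: measurable_powR_EFin.
  apply: (@le_trans _ _ (1%:E * sqf J2 (ThB setT) w + c2%:E * \int[leb]_(t in J2) (t `^ (- 1 - 1))%:E)%E).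
    apply: le_integral_lincomb => //.
    - exact: (measurable_slice w mJ2 J2p mTT).
    - by move=> t _; exact: sq_slice_ge0.
    - by move=> t _; rewrite lee_fin powR_ge0.
    - by move=> t _; exact: sq_slice_ge0.
    move=> t Jt; have t0 := window_gt0 e0 Jt.1.
    have -> : (c2%:E * (t `^ (- 1 - 1))%:E)%E = ((m * lam * (c1 * l / t))%:E * (slice_cst * P2 * t^-1)%:E)%E.
      rewrite -!EFinM; congr EFin; rewrite powRD; last by rewrite (gt_eqF t0) implybT.
      by rewrite powR_inv1 ?(ltW t0)// /c2; field; rewrite gt_eqF.
    have sl := sq_slice_le K0 MK t0.
    have u0 : 0 <= m * lam * (c1 * l / t) by rewrite mulr_ge0// divr_ge0 ?(ltW t0)// mulr_ge0// ltW.
    apply: (@le_trans _ _ (1%:E * sq_slice (ThB setT) w t +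
      (m * lam * (c1 * l / t))%:E * sq_slice (ThB setT) x t)%E); last first.
      by rewrite leeD2l// lee_wpmul2l// lee_fin.
    apply: le_integral_lincomb => //.
    - exact: (measurable_sq_slice_integrand w t0 mTT).
    - by move=> y _; exact: integrand_ge0.
    - exact: (measurable_sq_slice_integrand x t0 mTT).
    - by move=> y _; exact: integrand_ge0.
    - by move=> y _; exact: integrand_ge0.
    move=> y _; rewrite -!EFinM -EFinD lee_fin mul1r.
    have h := powR_wt_shift x w y q0 t0.
    set X := wt t x y `^ (m * lam) in h *; set W := wt t w y `^ (m * lam) in h *.
    have X0 : 0 <= X by exact: powR_ge0.
    have h' : X <= W + m * lam * (c1 * l / t) * X.
      apply: (le_trans h); rewrite lerD2l ler_wpM2r// ler_wpM2l// ler_wpM2r// invr_ge0 ltW//.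
    set r := cmod _ ^+ 2; set i := (t `^ (m + 1))^-1.
    have ri : 0 <= r * i by rewrite mulr_ge0 ?sqr_ge0 ?invr_ge0 ?powR_ge0.
    have := ler_wpM2r ri h'; lra.
  rewrite mul1e; apply: leeD.
    apply: (sqf_subset w mJ2 (measurable_window e) _ (window_pos e0) mTT); by move=> t [].
  have -> : (m * lam * c1 * slice_cst * P2)%:E = (c2%:E * (l `^ (- 1) / 1)%:E)%E.
    by rewrite -EFinM powR_inv1 ?(ltW l0)// /c2; congr EFin; field; rewrite gt_eqF.
  apply: lee_wpmul2l; first by rewrite lee_fin.
  apply: (@le_trans _ _ (\int[leb]_(t in `[l, +oo[) (t `^ (- 1 - 1))%:E)%E).
    apply: ge0_subset_integral => //.
    - by apply: measurable_funTS; exact: measurable_powR_EFin.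
    - by move=> t _; rewrite lee_fin powR_ge0.
    - by move=> t [].
  exact: (integral_powR_infty ltr01 l0).
apply: (le_trans (leeD h1 h2)); rewrite /local_cst -lock.
rewrite (_ : ((_ + _) * P2)%:E = ((slice_cst / a * P2)%:E + (m * lam * c1 * slice_cst * P2)%:E)%E); last first.
  by rewrite -EFinD mulrDl.
by rewrite addeACA (addeC _ (sqf (window e) (ThB setT) w)) addeA.
Qed.

Lemma cmod_kernel_le t y zs : 0 < t -> cmod (s t y zs) <= Cs * (t `^ (- m)) ^+ k.+1.
Proof.
move=> t0; apply: (le_trans (size_wt y zs t0)).
rewrite -[leRHS]mulr1 ler_wpM2l ?mulr_ge0 ?exprn_ge0 ?powR_ge0//.
by apply: prodr_ile1 => i _; rewrite powR_ge0 wt_powR_le1// addr_ge0// ltW.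
Qed.

Lemma cmeasurable_kernel t y : cmeasurable_fun setT (s t y).
Proof.
exact: (cmeasurable_comp ms (measurable_pair1 ((t : measurableTypeR R), y))).
Qed.

(** * The weak type hypothesis for localised functions *)

Section induced.
Variable A : set T.
Hypothesis mA : measurable A.
Hypothesis A_fin : forall i, (\int[mu]_(x in A) (absf i x)%:E < +oo)%E.

Definition frestr i x : R[i] := f i x * (\1_A x : R)%:C.

Lemma Re_frestr i x : complex.Re (frestr i x) = complex.Re (f i x) * \1_A x.
Proof. by rewrite /frestr; case: (f i x) => u v /=; rewrite mulr0 subr0. Qed.

Lemma Im_frestr i x : complex.Im (frestr i x) = complex.Im (f i x) * \1_A x.
Proof. by rewrite /frestr; case: (f i x) => u v /=; rewrite mulr0 add0r. Qed.

Lemma cmod_frestr i x : cmod (frestr i x) = absf i x * \1_A x.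
Proof.
rewrite /frestr cmodM; congr (_ * _).
by rewrite cmodE/= expr0n addr0 sqrtr_sqr ger0_norm.
Qed.

Lemma integral_cmod_frestr i :
  (\int[mu]_x (cmod (frestr i x))%:E = \int[mu]_(x in A) (absf i x)%:E)%E.
Proof.
rewrite [RHS]integral_mkcond; apply: eq_integral => x _.
rewrite cmod_frestr patchE indicE; case: (x \in A); first by rewrite mulr1.
by rewrite mulr0.
Qed.

Lemma integrable_frestr i :
  mu.-integrable setT (EFin \o (fun x => complex.Re (frestr i x))) /\
  mu.-integrable setT (EFin \o (fun x => complex.Im (frestr i x))).
Proof.
have mR : measurable_fun setT (fun x => complex.Re (frestr i x)).
  rewrite (_ : (fun _ => _) = fun x => complex.Re (f i x) * \1_A x); last first.
    by apply/funext => x; rewrite Re_frestr.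
  by apply: measurable_funM; [exact: (mfc i).1|exact: measurable_indic].
have mI : measurable_fun setT (fun x => complex.Im (frestr i x)).
  rewrite (_ : (fun _ => _) = fun x => complex.Im (f i x) * \1_A x); last first.
    by apply/funext => x; rewrite Im_frestr.
  by apply: measurable_funM; [exact: (mfc i).2|exact: measurable_indic].
split; apply/integrableP; split; try exact/measurable_EFinP.
- apply: le_lt_trans (A_fin i); rewrite -integral_cmod_frestr; apply: le_nonneg_integral => x _ //=.
  by rewrite lee_fin normr_Re_le_cmod.
- apply: le_lt_trans (A_fin i); rewrite -integral_cmod_frestr; apply: le_nonneg_integral => x _ //=.
  by rewrite lee_fin normr_Im_le_cmod.
Qed.

Definition restr_measure i : complex_measure T R :=
  induced_cmeasure (integrable_frestr i).1 (integrable_frestr i).2.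

Lemma restr_measure_norm i :
  (cmeasure_norm (restr_measure i) <= 2%:E * \int[mu]_(x in A) (absf i x)%:E)%E.
Proof. by rewrite -integral_cmod_frestr; exact: cmeasure_norm_induced. Qed.

Lemma Theta_restr_measure t y : 0 < t -> Theta s restr_measure t y = ThB (all_in A) t y.
Proof.
move=> t0; rewrite /Theta.
have D0 : 0 <= Cs * (t `^ (- m)) ^+ k.+1 by rewrite mulr_ge0 ?exprn_ge0 ?powR_ge0.
rewrite (iterated_integral_induced (fun i => (integrable_frestr i).1)
  (fun i => (integrable_frestr i).2) D0 (cmeasurable_kernel t y)
  (fun zs => cmod_kernel_le y zs t0)).
rewrite /ThB; congr iterated_integral; apply/funext => zs; rewrite -mulrA; congr (_ * _).
rewrite /frestr big_split/=; congr (_ * _).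
have [h|h] := pselect (all_in A zs).
  rewrite (_ : \1_(all_in A) zs = 1 :> R); last by rewrite indicE mem_set.
  by rewrite big1// => i _; rewrite indicE mem_set//; exact: h.
rewrite (_ : \1_(all_in A) zs = 0 :> R); last by rewrite indicE memNset.
move/existsNP : h => [i hi].
by rewrite (bigD1 i)//= indicE memNset// mul0r.
Qed.

Lemma sqf_restr_measure x :
  sqf halfline (Theta s restr_measure) x = sqf halfline (ThB (all_in A)) x.
Proof.
apply: eq_integral => t; rewrite inE /halfline/= in_itv/= andbT => t0.
apply: eq_integral => y _; congr (_ * cmod _ ^+ 2 / _)%:E.
exact: Theta_restr_measure.
Qed.

(** The hypothesis at the measures with densities [f i * \1_A]. The level is [z ^+ 2] since [sqf] is
    the square of the square function, [2 ^+ k.+1] bounds the total variations, and [|Aw|] appears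
    because no sign of [Aw] is assumed. *)
Lemma near_weak G Aw (L : 'I_k.+1 -> R) (z : R) :
  weak_bounded mu m lam s G Aw -> (forall i, (\int[mu]_(x in A) (absf i x)%:E <= (L i)%:E)%E) ->
  0 < z ->
  (z%:E * mu [set x | G x /\ ((z ^+ 2)%:E < sqf halfline (ThB (all_in A)) x)%E] ^+ k.+1 <=
    (`|Aw| * 2 ^+ k.+1 * \prod_i L i)%:E)%E.
Proof.
move=> hw hL z0.
have gE x : gstar mu m lam s restr_measure x = (sqf halfline (ThB (all_in A)) x `^ 2^-1)%E.
  by rewrite /gstar square_function_sqf sqf_restr_measure.
have -> : [set x | G x /\ ((z ^+ 2)%:E < sqf halfline (ThB (all_in A)) x)%E] =
    [set x | G x /\ (z%:E < gstar mu m lam s restr_measure x)%E].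
  apply/seteqP; split => x /= [Gx h]; split => //; move: h; rewrite gE.
    rewrite lt_poweR_invr ?invr_gt0 ?sqf_ge0 ?(ltW z0)// invrK powR_mulrn ?(ltW z0)//.
  rewrite lt_poweR_invr ?invr_gt0 ?sqf_ge0 ?(ltW z0)// invrK powR_mulrn ?(ltW z0)//.
apply: (@le_trans _ _ (Aw%:E * \prod_(i < k.+1) cmeasure_norm (restr_measure i))%E).
  by apply: le_trans (hw restr_measure); apply: ereal_sup_ubound; exists z.
have n0 i : (0 <= cmeasure_norm (restr_measure i))%E by exact: cmeasure_norm_ge0.
apply: (@le_trans _ _ (`|Aw|%:E * \prod_(i < k.+1) cmeasure_norm (restr_measure i))%E).
  by apply: lee_wpmul2r; [apply: prode_ge0 => i _|rewrite lee_fin ler_norm].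
rewrite -mulrA EFinM; apply: lee_wpmul2l; first by rewrite lee_fin.
have -> : 2 ^+ k.+1 * \prod_i L i = \prod_(i < k.+1) (2 * L i).
  by rewrite big_split/= prodr_const card_ord.
rewrite -prodEFin; apply: lee_prod => i; rewrite n0/= EFinM.
apply: (le_trans (restr_measure_norm i)); apply: lee_wpmul2l => //.
Qed.

End induced.

Lemma fin_mass_absf i : (mu setT < +oo)%E -> (\int[mu]_x (absf i x)%:E < +oo)%E.
Proof.
move=> muT; apply: (@le_lt_trans _ _ (\int[mu]_x (1 + (absf i x `^ p_ i)%:E))%E).
  apply: le_nonneg_integral => y _; first by rewrite lee_fin absf_ge0.
  by rewrite -EFinD lee_fin le_1D_powR ?absf_ge0.
rewrite ge0_integralD//; first last.
- exact: measurable_absf_powR.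
- by move=> y _; rewrite lee_fin powR_ge0.
rewrite integral_cst// mul1e; apply: lte_add_pinfty => //; exact: fLp.
Qed.

(** The vertex runs to infinity along the diagonal; as [mu] is finite, the constant 1 is an
    integrable majorant and dominated convergence applies. *)
Lemma wt_vanish (t q eta : R) : (0 < n)%N -> (mu setT < +oo)%E -> 0 < t -> 0 < q -> 0 < eta ->
  exists w, (\int[mu]_y (wt t w y `^ q)%:E <= eta%:E)%E.
Proof.
move=> n0 muT t0 q0 eta0.
pose w (N : nat) : T := (\row_(j < n) N%:R : 'rV[R]_n).
have mw N : measurable_fun setT (fun y => (wt t (w N) y `^ q)%:E).
  by apply/measurable_EFinP; exact: measurable_wt_r.
have i1 : mu.-integrable setT (fun _ : T => 1%E : \bar R).
  apply/integrableP; split => //.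
  apply: (@le_lt_trans _ _ (\int[mu]_y (fun=> 1%E : \bar R) y)%E).
    by apply: le_nonneg_integral => y _ //; rewrite gee0_abs.
  by rewrite integral_cst// mul1e.
have cv y : [set: T] y -> ((wt t (w N) y `^ q)%:E @[N --> \oo] --> (cst 0%E : T -> \bar R) y)%classic.
  move=> _; apply: cvg_EFin; first by apply: nearW.
  apply/cvgrPdist_le => e e0.
  pose i0 := Ordinal n0.
  near=> N.
  rewrite sub0r normrN ger0_norm ?powR_ge0//.
  have -> : e = (e `^ q^-1) `^ q by rewrite -powRrM mulVf ?gt_eqF// powRr1 ?ltW.
  have w0 := wt_gt0 (w N) y t0.
  apply: ge0_ler_powR; rewrite ?nnegrE ?powR_ge0 ?(ltW q0) ?(ltW w0)//.
  have ee : 0 < e `^ q^-1 by exact: powR_gt0.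
  rewrite /wt ler_pdivrMr ?wt_denom_gt0// mulrC -ler_pdivrMr//.
  have hN : t / e `^ q^-1 + `|(y : 'rV[R]_n) 0 i0| <= N%:R.
    near: N; exact: nbhs_infty_ger.
  have h1 : `|(w N : 'rV[R]_n) 0 i0 - (y : 'rV[R]_n) 0 i0| <= sup_dist (w N) y.
    exact: coord_le_sup_dist.
  have h2 := sup_dist_le_eucl (w N) y.
  have h3 : N%:R - `|(y : 'rV[R]_n) 0 i0| <= `|(w N : 'rV[R]_n) 0 i0 - (y : 'rV[R]_n) 0 i0|.
    by rewrite mxE; apply: le_trans (ler_norm _); rewrite lerB// ler_norm.
  apply: (@le_trans _ _ (eucl_dist (w N) y)); last by rewrite lerDr ltW.
  by apply: le_trans (le_trans h3 (le_trans h1 h2)); rewrite lerBrDr.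
have f1 : forall y : T, [set: T] y -> (1%E : \bar R) \is a fin_num by [].
have := dominated_cvg measurableT mw cv f1 i1.
have h1 N y : [set: T] y -> (`|(wt t (w N) y `^ q)%:E| <= 1)%E.
  by move=> _; rewrite gee0_abs ?lee_fin ?powR_ge0// wt_powR_le1// ltW.
move=> /(_ h1); rewrite integral0 => /fine_cvgP[_ /cvgrPdist_le/(_ eta eta0)][N _ /(_ N (leqnn N))] /=.
rewrite sub0r normrN => h; exists (w N).
have fin : (\int[mu]_y (wt t (w N) y `^ q)%:E)%E \is a fin_num.
  rewrite ge0_fin_numE; last by apply: integral_ge0 => y _; rewrite lee_fin powR_ge0.
  apply: (@le_lt_trans _ _ (\int[mu]_y (fun=> 1%E : \bar R) y)%E).
    apply: le_nonneg_integral => y _; first by rewrite lee_fin powR_ge0.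
    by rewrite lee_fin wt_powR_le1// ltW.
  by rewrite integral_cst// mul1e.
by rewrite -(fineK fin) lee_fin (le_trans (ler_norm _) h).
Unshelve. all: by end_near. Qed.

(** Shows that a superlevel set of finite measure is not the whole space when the whole space has
    finite measure, so that distances to its complement make sense. *)
Lemma sqf_vanish (e eta : R) : (0 < n)%N -> (mu setT < +oo)%E -> 0 < e -> 0 < eta ->
  exists w, (sqf (window e) (ThB setT) w <= eta%:E)%E.
Proof.
move=> n0 muT e0 eta0.
have q0 : 0 < m * lam.
  apply: lt_le_trans lam_large; rewrite ltr_pwDl// !mulr_ge0// ltW//.
pose L i := fine (\int[mu]_x (absf i x)%:E)%E.
have L0 i : 0 <= L i by apply: fine_ge0; apply: integral_ge0 => x _; rewrite lee_fin absf_ge0.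
have LE i : (\int[mu]_x (absf i x)%:E = (L i)%:E)%E.
  rewrite fineK// ge0_fin_numE ?fin_mass_absf//.
  by apply: integral_ge0 => x _; rewrite lee_fin absf_ge0.
(* On the window the averages are at most the integrals of the [|f i|] and [t] is at least [e], so
   this bounds [ThB] uniformly. *)
pose D : R := 2 ^+ k.+1 * Cs * \prod_i (L i / e `^ m).
have D0 : 0 <= D.
  rewrite mulr_ge0//; first by rewrite mulr_ge0 ?exprn_ge0.
  by apply: prodr_ge0 => i _; rewrite divr_ge0 ?powR_ge0.
have hT t y : window e t -> cmod ((ThB setT) t y) <= D.
  move=> Jt; have t0 := window_gt0 e0 Jt; have /windowP/andP[et _] := Jt.
  have := cmod_ThB_le measurableT alpha0 t0 ler01
    (y := y) (fun zs _ => alpha_ge_b zs y (lexx alpha) t0).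
  rewrite mulr1 => h; apply: (le_trans h); rewrite ler_wpM2l ?mulr_ge0 ?exprn_ge0//.
  apply: ler_prod => i _; have P0 := pavg_ge0 mu m alpha t y (absf_ge0 i).
  rewrite divr_ge0 ?fine_ge0 ?powR_ge0//=; apply: ler_pM.
  - by rewrite fine_ge0.
  - by rewrite invr_ge0 powR_ge0.
  - rewrite -lee_fin -LE.
    have PL : (pavg mu m alpha (absf i) t y <= \int[mu]_x (absf i x)%:E)%E.
      apply: le_nonneg_integral => z _; first by rewrite lee_fin mulr_ge0 ?powR_ge0 ?absf_ge0.
      by rewrite lee_fin ler_piMl ?absf_ge0// wt_powR_le1// addr_ge0// ltW.
    by rewrite fineK// ge0_fin_numE// (le_lt_trans PL)// LE ltry.
  - rewrite lef_pV2 ?posrE ?powR_gt0//; apply: ge0_ler_powR; rewrite ?nnegrE ?(ltW m0) ?(ltW t0) ?(ltW e0)//.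
pose c : R := D ^+ 2 / e `^ (m + 1) * e^-1 + 1.
have c0 : 0 < c by rewrite ltr_wpDl// mulr_ge0 ?invr_ge0 ?(ltW e0)// divr_ge0 ?sqr_ge0 ?powR_ge0.
have ei0 : 0 < e^-1 by rewrite invr_gt0.
have [w hw] := wt_vanish n0 muT ei0 q0 (divr_gt0 eta0 c0).
exists w.
pose I := (\int[mu]_y (wt e^-1 w y `^ (m * lam))%:E)%E.
have I0 : (0 <= I)%E by apply: integral_ge0 => y _; rewrite lee_fin powR_ge0.
have c10 : 0 <= D ^+ 2 / e `^ (m + 1) by rewrite divr_ge0 ?sqr_ge0 ?powR_ge0.
apply: (@le_trans _ _ ((D ^+ 2 / e `^ (m + 1))%:E * I * e^-1%:E)%E); last first.
  apply: (@le_trans _ _ (c%:E * (eta / c)%:E)%E); last first.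
    by rewrite -EFinM lee_fin mulrC divfK// gt_eqF.
  rewrite muleAC -EFinM; apply: lee_pmul => //.
  - by rewrite lee_fin mulr_ge0// ltW.
  - by rewrite lee_fin lerDl.
apply: (@le_trans _ _ (((D ^+ 2 / e `^ (m + 1))%:E * I) * leb (window e))%E); last first.
  by apply: lee_wpmul2l; [rewrite mule_ge0|exact: leb_window].
rewrite -integral_cst; last exact: measurable_window.
apply: le_nonneg_integral => t Jt; first exact: sq_slice_ge0.
have t0 := window_gt0 e0 Jt; have /windowP/andP[et te] := Jt.
apply: le_integral_scale => //.
- by apply/measurable_EFinP; exact: measurable_wt_r.
- by move=> y _; rewrite lee_fin powR_ge0.
- by move=> y _; exact: integrand_ge0.
move=> y _; rewrite -EFinM lee_fin.
have ww : wt t w y `^ (m * lam) <= wt e^-1 w y `^ (m * lam).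
  apply: ge0_ler_powR; rewrite ?nnegrE ?(ltW (wt_gt0 _ _ _)) ?(ltW q0)//.
  have d0 := eucl_dist_ge0 w y.
  rewrite /wt ler_pdivrMr ?wt_denom_gt0// mulrAC ler_pdivlMr ?wt_denom_gt0//; nra.
have hr : (t `^ (m + 1))^-1 <= (e `^ (m + 1))^-1.
  rewrite lef_pV2 ?posrE ?powR_gt0//; apply: ge0_ler_powR; rewrite ?nnegrE ?(ltW t0) ?(ltW e0)//.
  by rewrite addr_ge0// ltW.
have hN : cmod ((ThB setT) t y) ^+ 2 <= D ^+ 2 by rewrite ler_pXn2r ?nnegrE ?cmod_ge0// hT.
have r0 : 0 <= (t `^ (m + 1))^-1 by rewrite invr_ge0 powR_ge0.
have N0 := sqr_ge0 (cmod ((ThB setT) t y)).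
rewrite [leRHS]mulrC -[leLHS]mulrA; apply: ler_pM => //; first exact: powR_ge0.
  exact: mulr_ge0.
exact: ler_pM.
Qed.

Lemma local_cst_ge0 c : 0 <= c -> 0 <= m * lam -> 0 <= local_cst c.
Proof.
move=> c0 q0; have C0 : 0 <= slice_cst by exact: slice_cst_ge0.
rewrite /local_cst -lock; apply: addr_ge0; first by rewrite divr_ge0// ltW.
by rewrite mulr_ge0// mulr_ge0.
Qed.

Lemma measurable_sqf (D : set R) (Th : R -> T -> R[i]) :
  measurable (D : set (measurableTypeR R)) -> D `<=` halfline ->
  cmeasurable_fun setT (fun p : measurableTypeR R * T => Th p.1 p.2) ->
  measurable_fun setT (sqf D Th).
Proof.
move=> mD Dh mTh.
pose h (q : (T * measurableTypeR R) * T) : \bar R :=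
  ((q.1.2 * (q.1.2 + eucl_dist q.1.1 q.2) `^ (-1)) `^ (m * lam) *
   cmod (Th q.1.2 q.2) ^+ 2 * q.1.2 `^ (- (m + 1)))%:E.
have mt : measurable_fun setT (fun q : (T * measurableTypeR R) * T => q.1.2).
  exact: (measurableT_comp measurable_snd measurable_fst).
have mh : measurable_fun setT h.
  apply/measurable_EFinP; apply: measurable_funM; last first.
    exact: (measurableT_comp (measurable_powR _) mt).
  apply: measurable_funM; last first.
    apply: measurable_funX; apply: cmeasurable_cmod.
    apply: (cmeasurable_comp mTh (g := fun q : (T * measurableTypeR R) * T => (q.1.2, q.2))).
    by apply: measurable_fun_pair => //; exact: measurable_snd.
  apply: (measurableT_comp (measurable_powR _)); apply: measurable_funM => //.
  apply: (measurableT_comp (measurable_powR _)); apply: measurable_funD => //.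
  apply: (measurableT_comp measurable_eucl_dist (g := fun q : (T * measurableTypeR R) * T => (q.1.1, q.2))).
  apply: measurable_fun_pair; last exact: measurable_snd.
  exact: (measurableT_comp measurable_fst measurable_fst).
have h0 q : (0 <= h q)%E by rewrite lee_fin mulr_ge0 ?powR_ge0// mulr_ge0 ?powR_ge0 ?sqr_ge0.
pose G p : \bar R := (fubini_F mu h p * (\1_D p.2)%:E)%E.
have mG : measurable_fun setT G.
  apply: emeasurable_funM; first exact: measurable_fun_fubini_tonelli_F.
  apply/measurable_EFinP; apply: (measurableT_comp _ measurable_snd).
  exact: measurable_indic.
have G0 p : (0 <= G p)%E.
  by rewrite mule_ge0 ?lee_fin//; apply: integral_ge0 => y _; exact: h0.
rewrite (_ : sqf D Th = fubini_F leb G); first exact: measurable_fun_fubini_tonelli_F.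
apply/funext => x; rewrite /sqf /fubini_F [LHS]integral_mkcond; apply: eq_integral => t _.
rewrite patchE /G indicE; case: ifPn => tD; last by rewrite mule0.
rewrite mule1; have : halfline t by apply: Dh; rewrite inE in tD.
rewrite /halfline/= in_itv/= andbT => t0; apply: eq_integral => y _.
by rewrite /h/= wtE// powRN.
Qed.

(** * Good-lambda inequality for the truncated square function *)

Section good_lambda.
Hypothesis n0 : (0 < n)%N.
Variables (e : R).
Hypothesis e0 : 0 < e.
Let F := sqf (window e) (ThB setT).

Let q0 : 0 < m * lam.
Proof. by apply: lt_le_trans lam_large; rewrite ltr_pwDl// !mulr_ge0// ltW. Qed.

Let mTfull : cmeasurable_fun setT (fun p : measurableTypeR R * T => (ThB setT) p.1 p.2).
Proof. exact: (cmeasurable_ThB measurableT). Qed.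

Let F0 y : (0 <= F y)%E. Proof. exact: sqf_ge0. Qed.

(** If [F y <= c] at a point too close to [x], then [sqf_shift] would force [F x] below a level [b]
    lying strictly between [c] and [F x]. *)
Lemma superlevel_open (c : R) x : (c%:E < F x)%E ->
  exists2 r, 0 < r & forall y, sup_dist x y < r -> (c%:E < F y)%E.
Proof.
move=> cF; have [c0|c0] := ltP c 0.
  by exists 1 => [|y _]; [exact: ltr01|apply: lt_le_trans (F0 y); rewrite lte_fin].
have [b cb bF] : exists2 b : R, c < b & (b%:E < F x)%E.
  move: cF; case: (F x) => [v| |]//.
    rewrite lte_fin => cv; exists ((c + v) / 2); rewrite ?lte_fin; lra.
  by move=> _; exists (c + 1); rewrite ?ltry// ltrDl.
have nr : 0 < n%:R :> R by rewrite ltr0n.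
pose g r := 1 + n%:R * r / e.
have key r : 0 < r -> g r `^ (m * lam) * c <= b ->
    forall y, sup_dist x y < r -> (c%:E < F y)%E.
  move=> r0 grc y xy; rewrite ltNge; apply/negP => Fy.
  have := sqf_shift x y e0 (ltW q0) mTfull; apply/negP; rewrite -ltNge.
  apply: le_lt_trans bF.
  apply: (@le_trans _ _ ((g r `^ (m * lam))%:E * c%:E)%E); last by rewrite -EFinM lee_fin.
  apply: lee_pmul; [by rewrite lee_fin; exact: powR_ge0|exact: F0| |exact: Fy].
  have d0 : 0 <= eucl_dist x y / e by rewrite divr_ge0 ?eucl_dist_ge0 ?ltW.
  have dg : 1 + eucl_dist x y / e <= g r.
    rewrite lerD2l ler_wpM2r ?invr_ge0 ?(ltW e0)//.
    by rewrite (le_trans (eucl_dist_le_sup x y))// ler_wpM2l// ltW.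
  rewrite lee_fin; apply: ge0_ler_powR; rewrite ?nnegrE ?(ltW q0)//; first exact: addr_ge0.
  by rewrite (le_trans _ dg)// addr_ge0.
have [ce|c_gt0] : c = 0 \/ 0 < c by move: c0; rewrite le_eqVlt => /orP[/eqP|]; [left|right].
  exists 1; first exact: ltr01.
  by apply: (key 1 ltr01); rewrite ce mulr0 -ce; exact: ltW.
pose B := (b / c) `^ (m * lam)^-1.
have B1 : 1 < B.
  rewrite -[ltLHS](congr1 (@^~ (m * lam)^-1) (powR1 R)) gt0_ltr_powR ?invr_gt0 ?nnegrE//.
    by rewrite divr_ge0// ltW// (le_lt_trans c0).
  by rewrite ltr_pdivlMr// mul1r.
exists (e * (B - 1) / n%:R); first by rewrite divr_gt0// mulr_gt0// subr_gt0.
apply: key; first by rewrite divr_gt0// mulr_gt0// subr_gt0.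
rewrite (_ : g _ = B); last by rewrite /g; field; rewrite !gt_eqF.
rewrite -powRrM mulVf ?gt_eqF// powRr1 ?divfK ?gt_eqF//.
by rewrite divr_ge0// ltW// (le_lt_trans c0).
Qed.

Let measurable_F : measurable_fun setT F.
Proof. exact: (measurable_sqf (measurable_window e) (window_pos e0) mTfull). Qed.

Lemma measurable_superlevel_sqf (c : R) : measurable [set x | (c%:E < F x)%E].
Proof. by rewrite -[X in measurable X]setTI; exact: emeasurable_fun_o_infty. Qed.

Variables (Aw theta beta frakC : R).
Hypothesis theta0 : 0 < theta.
Hypotheses (beta_large : 2 * (@overlap_cst n)%:R <= beta) (frakC_large : 150 <= frakC).
Hypothesis weak : forall (c : T) (l : R), 0 < l ->
  doubling mu 2 beta c l -> small_boundary mu frakC c l ->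
  exists G : set T, [/\ measurable G, G `<=` cube c l,
    (theta%:E * mu (cube c l) <= mu G)%E & weak_bounded mu m lam s G Aw].

Variables (eta delta zeta tau : R).
Hypotheses (eta0 : 0 < eta) (delta0 : 0 < delta) (zeta0 : 0 < zeta) (tau0 : 0 < tau).
Local Notation c1 := (n%:R * 1154).
Hypothesis delta_local : local_cst c1 * delta ^+ 2 <= 2 * eta ^+ 2.
Hypothesis delta_weak : `|Aw| * 2 ^+ k.+1 * delta <= tau ^+ k.+1 * eta.
Variable E : set T.
Hypothesis mE : measurable E.
Hypothesis E_large : forall x, E x -> (((1 + 4 * eta ^+ 2) * zeta ^+ 2)%:E < F x)%E.
Hypothesis E_max : forall x, E x -> exists K : 'I_k.+1 -> R,
  [/\ forall i, 0 <= K i, forall i, (maximal mu (absf i) x <= (K i)%:E)%E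
    & \prod_i K i <= delta * zeta].

Let Om := [set x | ((zeta ^+ 2)%:E < F x)%E].

Section good_cube.
Variable w0 : T.
Hypothesis w0P : ~ Om w0.
Variable i : nat.
Local Notation side := (@grid_radius R n i).
Local Notation Bl := (@grid_ball R n).
Hypothesis wi : whitney (codist Om) i.
Hypothesis gi : (mu (Bl 128 i) <= (2 * (@overlap_cst n)%:R)%:E * mu (Bl 1 i))%E.

Let opOm x : Om x -> exists2 r, 0 < r & forall y, sup_dist x y < r -> Om y.
Proof. exact: superlevel_open. Qed.

Let side0 : 0 < side. Proof. exact: grid_radius_gt0. Qed.

Let Bl_sub (j l : R) : j <= l -> Bl j i `<=` Bl l i.
Proof. by move=> jl y; rewrite /grid_ball /family_ball/= => /le_trans; apply; rewrite ler_pM2r. Qed.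

(** Regularising the side [2 * side] gives a side at most [3 * side], so the cube sits between the
    balls of factors 1 and 2 and its double lies far inside the 128-dilate; doubling is then read
    off from [gi]. *)
Lemma exists_good_cube : exists l, [/\ 0 < l, doubling mu 2 beta (grid_center i) l,
  small_boundary mu frakC (grid_center i) l, Bl 1 i `<=` cube (grid_center i) l &
  cube (grid_center i) l `<=` Bl 2 i].
Proof.
have s20 : 0 < 2 * side by rewrite mulr_gt0.
have [l /andP[l1 l2] sb] := exists_small_boundary n0 (mu_sup_ball_lty mu_power) (grid_center i) s20.
have l0 : 0 < l := lt_le_trans s20 l1.
have QB : cube (grid_center i) l `<=` Bl 2 i.
  rewrite cubeE ?(ltW l0)// => y /=; rewrite sup_distC /grid_ball /family_ball/= => h.
  by apply: (le_trans h); lra.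
have BQ : Bl 1 i `<=` cube (grid_center i) l.
  rewrite cubeE ?(ltW l0)// => y /=; rewrite sup_distC /grid_ball /family_ball/= => h.
  by apply: (le_trans h); lra.
have Q2 : cube (grid_center i) (2 * l) `<=` Bl 128 i.
  rewrite cubeE ?mulr_ge0 ?(ltW l0)// => y /=; rewrite sup_distC /grid_ball /family_ball/= => h.
  by apply: (le_trans h); lra.
exists l; split => //.
- apply: (@le_trans _ _ (mu (Bl 128 i))).
    by apply: le_measure; rewrite ?inE//; [exact: measurable_cube|exact: measurable_grid_ball].
  apply: (le_trans gi); apply: lee_pmul => //.
  apply: le_measure; rewrite ?inE//; [exact: measurable_grid_ball|exact: measurable_cube].
- move=> xi xi0; apply: (le_trans (sb xi xi0)); apply: lee_wpmul2r => //.
  by rewrite lee_fin ler_wpM2r// ltW.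
Qed.

(** At each point of [E] in the cube, [sqf_local] leaves only the local part to explain the excess
    over [zeta ^+ 2]. So [E] meets [G] inside a superlevel set of the local part, whose measure the
    weak type bound controls. *)
Lemma good_cube : exists G, [/\ measurable G, G `<=` Bl 128 i,
  (theta%:E * mu (Bl 1 i) <= mu G)%E & (mu (E `&` G) <= tau%:E * mu (Bl 128 i))%E].
Proof.
have [l [l0 dbl sb BQ QB]] := exists_good_cube.
have [G [mG GQ tG wG]] := weak l0 dbl sb.
have GB2 : G `<=` Bl 2 i by exact: subset_trans QB.
have GB : G `<=` Bl 128 i.
  by apply: (subset_trans GB2); apply: Bl_sub; rewrite ler_nat.
exists G; split => //.
  apply: le_trans tG; apply: lee_wpmul2l; first by rewrite lee_fin ltW.
  apply: le_measure; rewrite ?inE//; [exact: measurable_grid_ball|exact: measurable_cube].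
have [->|] := eqVneq (E `&` G) set0; first by rewrite measure0 mule_ge0// lee_fin ltW.
move=> /set0P[x0 [Ex0 Gx0]].
have [K [K0 MK PK]] := E_max Ex0.
have mB128 : measurable (Bl 128 i) by exact: measurable_grid_ball.
have B_fin : (mu (Bl 128 i) < +oo)%E by exact: (mu_sup_ball_lty mu_power).
set b := fine (mu (Bl 128 i)).
have b0 : 0 <= b by exact: fine_ge0.
have bE : mu (Bl 128 i) = b%:E by rewrite fineK// ge0_fin_numE.
(* [G] lies in the ball of factor 2, so points outside [A] are at least one side away from it. *)
pose A := Bl 3 i; have mA : measurable A by exact: measurable_grid_ball.
have inB y j : Bl j i y -> sup_dist (grid_center i) y <= j * side by [].
(* From a point [x0] of [G] the set [A] is within [2 + 3 = 5] sides; the 20-fold enlargement of that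
   ball stays within [100 + 2] sides of the centre. This is the origin of the dilation factor
   128. *)
have hL j : (\int[mu]_(x in A) (absf j x)%:E <= (K j * b)%:E)%E.
  have r50 : 0 < 5 * side by rewrite mulr_gt0.
  have x0c := inB _ _ (GB2 _ Gx0).
  apply: (@le_trans _ _ (\int[mu]_(y in [set y | (sup_dist x0 y <= 5 * side)%R]) (absf j y)%:E)%E).
    apply: ge0_subset_integral => //; first exact: measurable_sup_ball.
    - by apply: measurable_funTS; apply/measurable_EFinP; exact: measurable_absf.
    - by move=> y _; rewrite lee_fin absf_ge0.
    - move=> y /inB yc /=; have := sup_dist_triangle (grid_center i) x0 y.
      rewrite (sup_distC x0 (grid_center i)); lra.
  have h := integral_ball_le_maximal (mu_sup_ball_lty mu_power) (measurable_absf j) (absf_ge0 j)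
    (absf_locint j) r50 (MK j).
  apply: (le_trans h); rewrite EFinM -bE; apply: lee_wpmul2l; first by rewrite lee_fin.
  apply: le_measure; rewrite ?inE//; first exact: measurable_sup_ball.
  move=> y /= xy; rewrite /grid_ball /family_ball/=.
  have := sup_dist_triangle x0 (grid_center i) y; lra.
have A_fin j : (\int[mu]_(x in A) (absf j x)%:E < +oo)%E.
  by rewrite (le_lt_trans (hL j))// ltry.
have z0 : 0 < eta * zeta by rewrite mulr_gt0.
have := near_weak mA A_fin wG hL z0.
set S := [set x | _] => hS.
(* If the local part were at most [(eta * zeta) ^+ 2], then [F x] would be at most [zeta ^+ 2 + 2 *
   (eta * zeta) ^+ 2 + 2 * eta ^+ 2 * zeta ^+ 2], the level that [E] exceeds. The last term is the
   choice of [delta]. *)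
have ES : E `&` G `<=` S.
  move=> x [Ex Gx]; split => //.
  have [Kx [Kx0 MKx PKx]] := E_max Ex.
  have xB : Bl 2 i x by exact: GB2.
  have [_ dx] := whitney_depth (codist_lip w0P) wi (GB _ Gx).
  have [w nw xw] : exists2 w, ~ Om w & sup_dist x w < 1154 * side.
    by apply: (codist_lt w0P); apply: (le_lt_trans dx); rewrite ltr_pM2r// ltr_nat.
  have Fw : (F w <= (zeta ^+ 2)%:E)%E by rewrite leNgt; apply/negP.
  have dw : eucl_dist x w <= c1 * side.
    by apply: (le_trans (eucl_dist_le_sup x w)); rewrite -mulrA ler_wpM2l// ltW.
  have far z : ~ A z -> side <= eucl_dist x z.
    move=> /negP; rewrite /A /grid_ball /family_ball/= -ltNge => zA.
    apply: (le_trans _ (sup_dist_le_eucl x z)).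
    have := sup_dist_triangle x (grid_center i) z; have := inB _ _ xB; lra.
  have c10 : 0 <= c1 :> R := mulr_ge0 (ler0n _ _) (ler0n _ _).
  have := sqf_local side0 e0 c10 (ltW q0)
    dw mA far Kx0 MKx.
  rewrite -/F; set X := sqf halfline _ x => hloc.
  rewrite ltNge; apply/negP => hX.
  have := E_large Ex; apply/negP; rewrite -leNgt; apply: (le_trans hloc).
  apply: (@le_trans _ _ ((zeta ^+ 2)%:E + 2%:E * ((eta * zeta) ^+ 2)%:E +
     (2 * eta ^+ 2 * zeta ^+ 2)%:E)%E).
    apply: leeD; first by apply: leeD => //; apply: lee_wpmul2l.
    rewrite lee_fin.
    apply: (@le_trans _ _ (local_cst c1 * (delta * zeta) ^+ 2)).
      apply: ler_wpM2l; first by apply: local_cst_ge0 => //; exact: ltW.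
      by rewrite ler_pXn2r ?nnegrE ?(ltW (mulr_gt0 _ _))// prodr_ge0.
    by rewrite exprMn mulrA ler_wpM2r// sqr_ge0.
  rewrite -EFinM -!EFinD lee_fin exprMn le_eqVlt; apply/orP; left; apply/eqP; ring.
have mH : measurable (halfline : set (measurableTypeR R)) by exact: measurable_itv.
have mS : measurable S.
  rewrite (_ : S = G `&` [set x | (((eta * zeta) ^+ 2)%:E < sqf halfline (ThB (all_in A)) x)%E])//.
  apply: measurableI; first exact: mG.
  rewrite -[X in measurable X]setTI; apply: (emeasurable_fun_o_infty measurableT).
  exact: (measurable_sqf mH (@subset_refl _ _) (cmeasurable_ThB (measurable_all_in mA))).
have SG : S `<=` Bl 128 i := fun x h => GB x h.1.
have S_fin : mu S \is a fin_num.
  rewrite ge0_fin_numE; last exact: measure_ge0.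
  by apply: le_lt_trans B_fin; apply: le_measure SG; rewrite inE.
have mEG : measurable (E `&` G) by exact: measurableI.
apply: (@le_trans _ _ (mu S)); first by apply: le_measure ES; rewrite inE.
move: hS; rewrite bE -(fineK S_fin) -EFin_expe -!EFinM !lee_fin.
set X := fine (mu S); have X0 : 0 <= X by exact: fine_ge0.
rewrite big_split/= prodr_const card_ord => hS.
have tb : 0 <= tau * b by rewrite mulr_ge0// ltW.
(* The weak bound controls the power [k.+1] of the measure, so the comparison is made between these
   powers; [delta_weak] then closes it. *)
rewrite -(ler_pXn2r (ltn0Sn k)) ?nnegrE// exprMn.
rewrite -(ler_pM2l z0); apply: (le_trans hS).
apply: (@le_trans _ _ (`|Aw| * 2 ^+ k.+1 * (delta * zeta * b ^+ k.+1))).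
  apply: ler_wpM2l; first by rewrite mulr_ge0 ?exprn_ge0.
  by rewrite ler_wpM2r ?exprn_ge0.
have zb : 0 <= zeta * b ^+ k.+1 by rewrite mulr_ge0 ?exprn_ge0// ltW.
have := ler_wpM2r zb delta_weak; set bk := b ^+ k.+1; set tk := tau ^+ k.+1; lra.
Qed.

End good_cube.

Lemma good_lambda : (mu Om < +oo)%E ->
  (mu E <= (1 - theta / (2 * (@overlap_cst n)%:R) + tau * (@overlap_cst n)%:R)%:E * mu Om)%E.
Proof.
move=> Om_fin.
(* Otherwise [Om] is the whole space, [mu] is finite, and [F] takes values below [zeta ^+ 2] far
   away. *)
have [w0 w0P] : exists w0, ~ Om w0.
  apply: contrapT => /forallNP h.
  have OmT : Om = setT by apply/seteqP; split => x // _; exact: (contrapT (h x)).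
  have [w hw] := sqf_vanish n0
    (ltac:(by rewrite -OmT) : (mu setT < +oo)%E) e0 (exprn_gt0 2 zeta0).
  by apply: (h w) => Ow; have := lt_le_trans Ow hw; rewrite ltxx.
have opOm x : Om x -> exists2 r, 0 < r & forall y, sup_dist x y < r -> Om y.
  exact: superlevel_open.
have dlip := codist_lip w0P; have dgt0 := codist_gt0 w0P opOm.
apply: (@cover_estimate _ _ _ mu Om E (whitney (codist Om)) (grid_ball 1) (grid_ball 128)).
- exact: measurable_superlevel_sqf.
- exact: mE.
- move=> x /E_large; apply: le_lt_trans; rewrite lee_fin ler_peMl ?sqr_ge0// lerDl.
  by rewrite mulr_ge0 ?sqr_ge0.
- exact: Om_fin.
- exact: overlap_cst_gt0.
- exact: ltW.
- exact: ltW.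
- by move=> i; exact: measurable_grid_ball.
- by move=> i; exact: measurable_grid_ball.
- move=> i y; rewrite /grid_ball /family_ball/= => /le_trans; apply.
  by rewrite ler_pM2r ?grid_radius_gt0// ler1n.
- by move=> i wi; exact: (whitney_sub dlip dgt0 wi).
- by move=> x Ox; exact: (whitney_cover dgt0 Ox).
- by move=> t y ut ht; exact: (whitney_overlap dlip ut ht).
- by move=> i wi gi; exact: (good_cube w0P wi gi).
Qed.

End good_lambda.

(** * From the good-lambda inequality to weighted bounds *)

Section lp_bound.
Hypothesis n0 : (0 < n)%N.
Variable p : R.
Hypothesis pE : p^-1 = \sum_i (p_ i)^-1.

Let pi0 i : 0 < p_ i. Proof. by rewrite (lt_trans ltr01). Qed.

Lemma exponent_gt0 : 0 < p.
Proof.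
rewrite -invr_gt0 pE (bigD1 ord0)//= ltr_pwDl ?invr_gt0//.
by apply: sumr_ge0 => i _; rewrite invr_ge0 ltW.
Qed.
Let p0 := exponent_gt0.

Let tht i := p / p_ i.
Let tht0 i : 0 < tht i. Proof. by rewrite divr_gt0. Qed.
Let tht1 : \sum_i tht i = 1.
Proof. by rewrite /tht -mulr_sumr -pE mulfV ?gt_eqF. Qed.

Variable w : 'I_k.+1 -> R.
Hypothesis w0 : forall i, 0 < w i.

Definition wprod : R := \prod_i w i `^ tht i.

Lemma wprod_gt0 : 0 < wprod.
Proof. by apply: prodr_gt0 => i _; exact: powR_gt0. Qed.

(** Bounds the [p]-th power of the product of the maximal functions, up to [wprod], by a quantity
    that integrates term by term; the free weights [w] restore homogeneity later. *)
Definition msum x : \bar R := (\sum_i ((w i)^-1%:E * maximal mu (absf i) x `^ p_ i))%E.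

Let max0 i x : (0 <= maximal mu (absf i) x)%E.
Proof. by apply: maximal_ge0 => z; exact: absf_ge0. Qed.

Let term0 i x : (0 <= (w i)^-1%:E * maximal mu (absf i) x `^ p_ i)%E.
Proof. by rewrite mule_ge0 ?poweR_ge0// lee_fin invr_ge0 ltW. Qed.

Lemma msum_ge0 x : (0 <= msum x)%E.
Proof. by apply: sume_ge0. Qed.

Let mterm i : measurable_fun setT (fun x => ((w i)^-1%:E * maximal mu (absf i) x `^ p_ i)%E).
Proof.
apply: measurable_funeM; apply: (measurableT_comp (measurable_poweR _)).
exact: measurable_maximal.
Qed.

Lemma measurable_msum : measurable_fun setT msum.
Proof. exact: emeasurable_sum. Qed.

Definition max_cst (i : 'I_k.+1) : R := 2 `^ p_ i / (1 - (p_ i)^-1).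

Lemma max_cst_ge0 i : 0 <= max_cst i.
Proof. by rewrite divr_ge0 ?powR_ge0// subr_ge0 invf_le1// ltW. Qed.

Lemma integral_msum_le : (\int[mu]_x msum x <= (\sum_i max_cst i)%:E *
  \sum_i ((w i)^-1%:E * \int[mu]_x (cmod (f i x) `^ p_ i)%:E))%E.
Proof.
rewrite ge0_integral_sum// ge0_sume_distrr; last first.
  move=> i _; apply: mule_ge0; first by rewrite lee_fin invr_ge0 ltW.
  by apply: integral_ge0 => x _; rewrite lee_fin powR_ge0.
apply: lee_sum => i _; rewrite ge0_integralZl//; first last.
- by rewrite lee_fin invr_ge0 ltW.
- by move=> x _; rewrite poweR_ge0.
- by apply: (measurableT_comp (measurable_poweR _)); exact: measurable_maximal.
rewrite muleCA; apply: lee_wpmul2l; first by rewrite lee_fin invr_ge0 ltW.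
apply: (le_trans (maximal_Lp (mu_sup_ball_lty mu_power) (measurable_absf i) (absf_ge0 i)
  (absf_locint i) (p1 i))).
apply: lee_wpmul2r.
  by apply: integral_ge0 => x _; rewrite lee_fin powR_ge0.
rewrite lee_fin (bigD1 i)//= lerDl; apply: sumr_ge0 => j _; exact: max_cst_ge0.
Qed.

(** A finite sum with positive coefficients makes every maximal function finite at [x], so their
    values serve as [K]; then [prod_powR_le_sum] applies with the exponents [p / p_ i]. *)
Lemma msum_max x (r : R) : (msum x <= r%:E)%E -> exists K : 'I_k.+1 -> R,
  [/\ forall i, 0 <= K i, forall i, (maximal mu (absf i) x <= (K i)%:E)%E
    & (\prod_i K i) `^ p <= wprod * r].
Proof.
move=> mr.
have fin i : maximal mu (absf i) x \is a fin_num.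
  rewrite ge0_fin_numE// ltNge leye_eq; apply/negP => /eqP h.
  have : ((w i)^-1%:E * maximal mu (absf i) x `^ p_ i <= r%:E)%E.
    by apply: le_trans mr; rewrite /msum (bigD1 i)//= leeDl// sume_ge0.
  by rewrite h poweRyr ?gt_eqF// mulry gtr0_sg ?invr_gt0// mul1e leye_eq.
pose K i := fine (maximal mu (absf i) x).
have K0 i : 0 <= K i by exact: fine_ge0.
have KE i : maximal mu (absf i) x = (K i)%:E by rewrite fineK.
exists K; split => // [i|]; first by rewrite KE.
have -> : (\prod_i K i) `^ p = wprod * \prod_i ((w i)^-1 * K i `^ p_ i) `^ tht i.
  rewrite -big_split/= powR_prod; last by [].
  apply: eq_bigr => i _; rewrite -powRM ?(ltW (w0 i)) ?mulr_ge0 ?invr_ge0 ?(ltW (w0 i)) ?powR_ge0//.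
  rewrite mulrA mulfV ?gt_eqF// mul1r -powRrM /tht; congr (_ `^ _).
  by rewrite mulrCA mulfV ?gt_eqF// mulr1.
rewrite ler_wpM2l ?(ltW wprod_gt0)//.
apply: (@le_trans _ _ (\sum_i ((w i)^-1 * K i `^ p_ i))).
  by apply: prod_powR_le_sum => // i; rewrite mulr_ge0 ?powR_ge0// invr_ge0 ltW.
rewrite -lee_fin; apply: le_trans mr; rewrite -sumEFin /msum.
by apply: lee_sum => i _; rewrite KE poweR_EFin EFinM.
Qed.

Variable e : R.
Hypothesis e0 : 0 < e.
Let F := sqf (window e) (ThB setT).
Let u x : \bar R := (F x `^ (p / 2))%E.

Let p20 : 0 < p / 2. Proof. by rewrite divr_gt0. Qed.

Let Fge0 x : (0 <= F x)%E. Proof. exact: sqf_ge0. Qed.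

Let u0 x : (0 <= u x)%E. Proof. exact: poweR_ge0. Qed.

Let mF : measurable_fun setT F.
Proof.
apply: measurable_sqf; [exact: measurable_window|exact: window_pos|].
exact: (cmeasurable_ThB measurableT).
Qed.

Let mu_ : measurable_fun setT u.
Proof. exact: (measurableT_comp (measurable_poweR _) mF). Qed.

Let weighted_sum_lty :
  (\sum_i ((w i)^-1%:E * \int[mu]_x (cmod (f i x) `^ p_ i)%:E) < +oo)%E.
Proof.
apply/lte_sum_pinfty => i _; apply: lte_mul_pinfty; [|by []|exact: fLp].
by rewrite lee_fin invr_ge0 ltW.
Qed.

Let msum_lty : (\int[mu]_x msum x < +oo)%E.
Proof.
apply: (le_lt_trans integral_msum_le); apply: lte_mul_pinfty; [|by []|exact: weighted_sum_lty].
by rewrite lee_fin sumr_ge0// => i _; exact: max_cst_ge0.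
Qed.

Definition window_cst : R := slice_cst * e^-1 ^+ 2 + 1.

Lemma window_cst_gt0 : 0 < window_cst.
Proof. by rewrite ltr_wpDl// mulr_ge0 ?sqr_ge0 ?slice_cst_ge0. Qed.

Lemma sqf_powR_le_msum x : (u x <= (window_cst `^ (p / 2) * wprod)%:E * msum x)%E.
Proof.
have c0 : 0 < window_cst `^ (p / 2) * wprod.
  by rewrite mulr_gt0 ?powR_gt0 ?window_cst_gt0 ?wprod_gt0.
have := msum_ge0 x; case E : (msum x) => [r| |]// r0; last first.
  by rewrite mulry gtr0_sg// mul1e leey.
have [|K [K0 MK PK]] := @msum_max x r; first by rewrite E.
have P0 : 0 <= \prod_i K i by exact: prodr_ge0.
have hF : (F x <= (window_cst * (\prod_i K i) ^+ 2)%:E)%E.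
  apply: (le_trans (sqf_window_le e0 K0 MK)).
  by rewrite lee_fin ler_wpM2r ?sqr_ge0// lerDl.
apply: (@le_trans _ _ ((window_cst * (\prod_i K i) ^+ 2)%:E `^ (p / 2))%E).
  apply: gt0_ler_poweR; rewrite ?in_itv/= ?leey ?andbT ?(ltW p20)//.
  by rewrite lee_fin mulr_ge0 ?sqr_ge0// ltW// window_cst_gt0.
rewrite poweR_EFin -EFinM lee_fin powRM ?sqr_ge0 ?(ltW window_cst_gt0)//.
rewrite -mulrA ler_wpM2l ?powR_ge0//; apply: le_trans PK.
by rewrite -powR_mulrn// -powRrM mulrC divfK.
Qed.

(** Purely qualitative, the bound blowing up with [e]; it licenses the absorption in
    [integral_le_of_good_lambda]. *)
Lemma sqf_powR_lty : (\int[mu]_x u x < +oo)%E.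
Proof.
have c0 : 0 <= window_cst `^ (p / 2) * wprod.
  by rewrite mulr_ge0 ?powR_ge0 ?(ltW wprod_gt0).
apply: (@le_lt_trans _ _ ((window_cst `^ (p / 2) * wprod)%:E * \int[mu]_x msum x)%E).
  apply: le_integral_scale => //.
  - exact: measurable_msum.
  - by move=> x _; exact: msum_ge0.
  - by move=> x _; exact: sqf_powR_le_msum.
by apply: lte_mul_pinfty; [rewrite lee_fin|by []|exact: msum_lty].
Qed.

Variables (Aw theta beta frakC : R).
Hypothesis theta0 : 0 < theta.
Hypotheses (beta_large : 2 * (@overlap_cst n)%:R <= beta) (frakC_large : 150 <= frakC).
Hypothesis weak : forall (c : T) (l : R), 0 < l ->
  doubling mu 2 beta c l -> small_boundary mu frakC c l ->
  exists G : set T, [/\ measurable G, G `<=` cube c l,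
    (theta%:E * mu (cube c l) <= mu G)%E & weak_bounded mu m lam s G Aw].
Variables (eta delta tau c : R).
Hypotheses (eta0 : 0 < eta) (delta0 : 0 < delta) (tau0 : 0 < tau).
Hypothesis delta_local :
  local_cst (n%:R * 1154) * delta ^+ 2 <= 2 * eta ^+ 2.
Hypothesis delta_weak : `|Aw| * 2 ^+ k.+1 * delta <= tau ^+ k.+1 * eta.
Hypotheses (c01 : 0 < c < 1) (cE : c = theta / (2 * (@overlap_cst n)%:R) - tau * (@overlap_cst n)%:R).
Hypothesis etaE : (1 + 4 * eta ^+ 2) `^ (p / 2) = 1 + c / 2.

(** The level [r] of the power [u] corresponds to [zeta = r]^
    p^-1[. The function]v[is scaled by]delta [^ (- p) * wprod] so that [v x <= r] says that the
    product of the maximal functions is at most [delta * zeta]. *)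
Lemma sqf_powR_bound : (\int[mu]_x u x <=
  (2 / c * (delta `^ (- p) * wprod) * \sum_i max_cst i)%:E *
  \sum_i ((w i)^-1%:E * \int[mu]_x (cmod (f i x) `^ p_ i)%:E))%E.
Proof.
have /andP[c0 c1] := c01.
have W0 : 0 < delta `^ (- p) * wprod by rewrite mulr_gt0 ?powR_gt0 ?wprod_gt0.
pose v x : \bar R := ((delta `^ (- p) * wprod)%:E * msum x)%E.
have v0 x : (0 <= v x)%E by rewrite mule_ge0 ?msum_ge0// lee_fin ltW.
have mv : measurable_fun setT v by apply: measurable_funeM; exact: measurable_msum.
have iv : (\int[mu]_x v x <= (delta `^ (- p) * wprod * \sum_i max_cst i)%:E *
    \sum_i ((w i)^-1%:E * \int[mu]_x (cmod (f i x) `^ p_ i)%:E))%E.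
  rewrite ge0_integralZl//; last 3 first.
  - exact: measurable_msum.
  - by move=> x _; exact: msum_ge0.
  - by rewrite lee_fin ltW.
  rewrite [in leRHS]EFinM -muleA; apply: lee_wpmul2l; last exact: integral_msum_le.
  by rewrite lee_fin ltW.
apply: (@le_trans _ _ ((2 / c)%:E * \int[mu]_x v x)%E); last first.
  rewrite -(mulrA (2 / c)) [in leRHS]EFinM -muleA; apply: lee_wpmul2l; last exact: iv.
  by rewrite lee_fin divr_ge0// ltW.
apply: integral_le_of_good_lambda => //; first exact: sqf_powR_lty.
move=> r r0.
pose zeta := r `^ p^-1.
have zeta0 : 0 < zeta by exact: powR_gt0.
have p2V : (p / 2)^-1 = p^-1 * 2%:R by rewrite invfM invrK mulrC.
have z2 : r `^ (p / 2)^-1 = zeta ^+ 2 by rewrite p2V powRrM powR_mulrn ?powR_ge0.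
have g0 : 0 < 1 + 4 * eta ^+ 2 by rewrite ltr_pwDl// mulr_ge0 ?sqr_ge0.
have K0 : 0 < 1 + c / 2 by rewrite -etaE powR_gt0.
have Kz : ((1 + c / 2) * r) `^ (p / 2)^-1 = (1 + 4 * eta ^+ 2) * zeta ^+ 2.
  by rewrite powRM ?(ltW K0) ?(ltW r0)// z2 -etaE -powRrM mulfV ?gt_eqF// powRr1// ltW.
have EOm : [set x | (r%:E < u x)%E] = [set x | ((zeta ^+ 2)%:E < F x)%E].
  by apply/seteqP; split => x; rewrite /= /u lt_poweR_invr// z2.
have ELarge : [set x | (((1 + c / 2) * r)%:E < u x)%E] =
    [set x | (((1 + 4 * eta ^+ 2) * zeta ^+ 2)%:E < F x)%E].
  by apply/seteqP; split => x; rewrite /= /u lt_poweR_invr ?mulr_gt0// Kz.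
pose V := [set x | (r%:E < v x)%E].
have mV : measurable V by rewrite -[X in measurable X]setTI; exact: emeasurable_fun_o_infty.
have mL : measurable [set x | (((1 + c / 2) * r)%:E < u x)%E].
  by rewrite -[X in measurable X]setTI; exact: emeasurable_fun_o_infty.
pose E := [set x | (((1 + c / 2) * r)%:E < u x)%E] `\` V.
have mE : measurable E by exact: measurableD.
have Om_fin : (mu [set x | ((zeta ^+ 2)%:E < F x)%E] < +oo)%E.
  by rewrite -EOm; apply: (chebyshev_poweR mu_ u0 sqf_powR_lty r0).
have E_large x : E x -> (((1 + 4 * eta ^+ 2) * zeta ^+ 2)%:E < F x)%E.
  by case; rewrite ELarge.
have E_max x : E x -> exists K : 'I_k.+1 -> R,
  [/\ forall i, 0 <= K i, forall i, (maximal mu (absf i) x <= (K i)%:E)%E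
    & \prod_i K i <= delta * zeta].
  case=> _ /negP; rewrite -leNgt /v -lee_pdivlMl// -EFinM => h.
  have [K [K0' MK PK]] := msum_max h; exists K; split => //.
  have P0 : 0 <= \prod_i K i by exact: prodr_ge0.
  have dz : 0 <= delta * zeta by rewrite mulr_ge0// ltW.
  rewrite leNgt; apply/negP => hlt; have := gt0_ltr_powR p0 dz P0 hlt; apply/negP; rewrite -leNgt.
  apply: (le_trans PK); rewrite powRM ?(ltW delta0) ?(ltW zeta0)// -powRrM mulVf ?gt_eqF// powRr1 ?(ltW r0)//.
  have dp : 0 < delta `^ p by exact: powR_gt0.
  rewrite powRN le_eqVlt; apply/orP; left; apply/eqP.
  by field; rewrite !gt_eqF ?wprod_gt0.
have := good_lambda n0 e0 theta0
  beta_large frakC_large weak eta0 delta0 zeta0 tau0 delta_local delta_weak mE E_large E_max Om_fin.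
rewrite -EOm (_ : 1 - theta / (2 * (@overlap_cst n)%:R) + tau * (@overlap_cst n)%:R = 1 - c); last first.
  by rewrite cE; ring.
move=> hE; apply: (@le_trans _ _ (mu E + mu V)%E); last exact: leeD.
apply: le_trans (measureU2 _ mE mV); apply: le_measure; rewrite ?inE//; first exact: measurableU.
by move=> x hx; have [Vx|nV] := pselect (V x); [right|left].
Qed.

End lp_bound.

End square_function_bounds.

(** * Conclusion *)

Section monotone_poweR.
Context {d} {T : measurableType d} {R : realType} (mu : {measure set T -> \bar R}).
Local Open Scope ereal_scope.

Lemma le_integral_poweR_cvg (F_ : (T -> \bar R)^nat) (F : T -> \bar R) (q : R) (C : \bar R) :
  (0 < q)%R -> (forall N, measurable_fun setT (F_ N)) -> (forall N x, 0 <= F_ N x) ->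
  (forall x, {homo F_ ^~ x : N M / (N <= M)%N >-> N <= M}) ->
  (forall x, F_ N x @[N --> \oo] --> F x) ->
  (forall N, \int[mu]_x (F_ N x `^ q) <= C) -> \int[mu]_x (F x `^ q) <= C.
Proof.
move=> q0 mF F0 ndF cF intF.
pose g N x := F_ N x `^ q.
have mg N : measurable_fun setT (g N) by exact: (measurableT_comp (measurable_poweR _) (mF N)).
have g0 N x : setT x -> 0 <= g N x by move=> _; exact: poweR_ge0.
have ndg x : setT x -> {homo g ^~ x : N M / (N <= M)%N >-> N <= M}.
  move=> _ N M NM; apply: gt0_ler_poweR; rewrite ?in_itv/= ?leey ?andbT ?F0 ?(ltW q0)//.
  exact: ndF.
have cg x : g N x @[N --> \oo] --> ereal_sup (range (g ^~ x)).
  by apply: ereal_nondecreasing_cvgn => N M NM; exact: ndg.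
have ub x N : g N x <= ereal_sup (range (g ^~ x)) by apply: ereal_sup_ubound; exists N.
have le_sup x : F x `^ q <= ereal_sup (range (g ^~ x)).
  have lt_ex b : b < F x -> exists N, b < F_ N x.
    move=> bF; apply: contrapT => /forallNP h.
    suff : F x <= b by rewrite leNgt bF.
    by apply: (cvge_to_le (cF x)); apply: nearW => N; rewrite leNgt; apply/negP.
  have Fx0 : 0 <= F x.
    by apply: (cvge_to_ge (cF x)); exact: nearW.
  rewrite leNgt; apply/negP => h.
  have := le_trans (g0 0%N x I) (ub x 0%N).
  move: h; case E : (ereal_sup _) => [b| |]; [|by rewrite ltNge leey|by []].
  rewrite lee_fin le_eqVlt => h /predU1P[b0|b0].
    have F_gt0 : 0 < F x by apply: (gt0_poweR q0) => //; move: h; rewrite -b0.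
    have [N FN] := lt_ex _ F_gt0.
    by have := ub x N; rewrite E -b0 leNgt poweR_gt0.
  have := h; rewrite lt_poweR_invr// => /lt_ex[N].
  by rewrite -lt_poweR_invr// => hN; have := ub x N; rewrite E leNgt hN.
apply: (@le_trans _ _ (\int[mu]_x limn (g ^~ x))).
  apply: le_nonneg_integral => x _; first exact: poweR_ge0.
  by rewrite (cvg_lim _ (cg x)).
rewrite (monotone_convergence mu measurableT mg g0 ndg).
apply: lime_le; last exact: nearW.
apply: ereal_nondecreasing_is_cvgn => N M NM; apply: le_nonneg_integral => x _; first exact: g0.
exact: ndg.
Qed.

End monotone_poweR.

(** * Choice of constants and removal of weights and truncation *)

Section uniform_bound.
Context {R : realType} {n : nat}.
Local Notation T := (Rn R n).
Local Notation leb := (@lebesgue_measure R).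
Variable mu : {sigma_finite_measure set T -> \bar R}.
Variables m Cm : R.
Hypotheses (m0 : 0 < m) (Cm0 : 0 <= Cm).
Hypothesis mu_power : forall (x : T) r, 0 < r ->
  (mu [set y | (sup_dist x y <= r)%R] <= (Cm * r `^ m)%:E)%E.
Variables (k : nat) (s : R -> T -> k.+1.-tuple T -> R[i]) (Cs alpha lam : R).
Hypothesis ms : cmeasurable_fun setT
  (fun q : measurableTypeR R * T * k.+1.-tuple T => s q.1.1 q.1.2 q.2).
Hypotheses (Cs0 : 0 <= Cs) (alpha0 : 0 < alpha).
Hypothesis lam_large : alpha + 2 * k.+1%:R * m <= m * lam.
Hypothesis size_s : size_condition m alpha Cs s.
Variables (p_ : 'I_k.+1 -> R) (p : R).
Hypothesis p1 : forall i, 1 < p_ i.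
Hypothesis pE : p^-1 = \sum_i (p_ i)^-1.
Hypothesis n0 : (0 < n)%N.
Variables (Aw theta beta frakC : R).
Local Notation ov := (@overlap_cst n).
Hypotheses (theta0 : 0 < theta) (theta1 : theta < 1).
Hypotheses (beta_large : 2 * ov%:R <= beta) (frakC_large : 150 <= frakC).
Hypothesis weak : forall (c : T) (l : R), 0 < l ->
  doubling mu 2 beta c l -> small_boundary mu frakC c l ->
  exists G : set T, [/\ measurable G, G `<=` cube c l,
    (theta%:E * mu (cube c l) <= mu G)%E & weak_bounded mu m lam s G Aw].
Local Notation SQ := (sqf mu m lam).

Let p0 : 0 < p. Proof. exact: (exponent_gt0 p1 pE). Qed.

Let pi0 i : 0 < p_ i. Proof. by rewrite (lt_trans ltr01). Qed.

(** The constants are fixed before the functions, the weights and [e] are introduced, so [C] is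
    uniform in all three. *)
Lemma sqf_powR_weighted : exists2 C : R, 0 <= C & forall (f : 'I_k.+1 -> T -> R[i]) (w : 'I_k.+1 -> R) (e : R),
  (forall i, cmeasurable_fun setT (f i)) ->
  (forall i, (\int[mu]_x (cmod (f i x) `^ p_ i)%:E < +oo)%E) ->
  (forall i, 0 < w i) -> 0 < e ->
  (\int[mu]_x (SQ (window e) (ThB mu s f setT) x `^ (p / 2)) <=
    (C * \prod_i w i `^ (p / p_ i))%:E *
    \sum_i ((w i)^-1%:E * \int[mu]_x (cmod (f i x) `^ p_ i)%:E))%E.
Proof.
have N0 : 0 < ov%:R :> R by rewrite ltr0n overlap_cst_gt0.
have N1 : 1 <= ov%:R :> R by rewrite ler1n overlap_cst_gt0.
(* With this [tau] the loss [tau * N] is half of the gain [theta / (2 * N)], [N] being the overlap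
   number, which leaves [c = theta / (4 * N)]. *)
pose tau := theta / (4 * ov%:R ^+ 2).
have tau0 : 0 < tau by rewrite divr_gt0// mulr_gt0// exprn_gt0.
pose c := theta / (4 * ov%:R).
have c0 : 0 < c by rewrite divr_gt0// mulr_gt0.
have c1 : c < 1.
  rewrite ltr_pdivrMr ?mulr_gt0// mul1r; apply: (lt_le_trans theta1).
  by rewrite -[leLHS]mulr1 ler_pM// ler1n.
have cE : c = theta / (2 * ov%:R) - tau * ov%:R.
  by rewrite /c /tau; field; rewrite gt_eqF.
pose K := 1 + c / 2.
have K1 : 1 < K by rewrite ltrDl divr_gt0.
have Kp : 1 < K `^ (p / 2)^-1.
  rewrite -[ltLHS](congr1 (@^~ (p / 2)^-1) (powR1 R)) gt0_ltr_powR ?nnegrE ?invr_gt0 ?divr_gt0//.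
  by rewrite ltW// (lt_trans ltr01).
pose eta := Num.sqrt ((K `^ (p / 2)^-1 - 1) / 4).
have eta2 : 0 < (K `^ (p / 2)^-1 - 1) / 4 by rewrite divr_gt0// subr_gt0.
have eta0 : 0 < eta by rewrite sqrtr_gt0.
have etaE : (1 + 4 * eta ^+ 2) `^ (p / 2) = 1 + c / 2.
  rewrite sqr_sqrtr ?(ltW eta2)// mulrCA mulfV ?pnatr_eq0// mulr1 addrC subrK -powRrM mulVf.
    by rewrite powRr1// ltW// (lt_trans ltr01).
  by rewrite gt_eqF// divr_gt0.
have q0 : 0 <= m * lam.
  by apply: le_trans lam_large; rewrite addr_ge0// ?(ltW alpha0)// !mulr_ge0// ltW.
have L0 : 0 <= local_cst m Cm k Cs alpha lam (n%:R * 1154).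
  exact: (local_cst_ge0 Cm0 k Cs alpha0 (mulr_ge0 (ler0n _ _) (ler0n _ _)) q0).
have B0 : 0 <= `|Aw| * 2 ^+ k.+1 by rewrite mulr_ge0 ?exprn_ge0.
have x0 : 0 < 2 * eta ^+ 2 by rewrite mulr_gt0// exprn_gt0.
have y0 : 0 < tau ^+ k.+1 * eta by rewrite mulr_gt0// exprn_gt0.
have [delta delta0 [dl dw]] := exists_small_delta L0 B0 x0 y0.
have M0 : 0 <= \sum_(i < k.+1) max_cst p_ i by apply: sumr_ge0 => i _; exact: max_cst_ge0.
exists (2 / c * delta `^ (- p) * \sum_i max_cst p_ i).
  by rewrite mulr_ge0// mulr_ge0 ?powR_ge0// divr_ge0// ltW.
move=> f w e mfc fLp w0 e0.
have c01 : 0 < c < 1 by rewrite c0.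
have := sqf_powR_bound m0 Cm0 mu_power ms Cs0 alpha0 lam_large size_s mfc p1 fLp n0 pE w0 e0
  theta0 beta_large frakC_large weak eta0 delta0 tau0 dl dw c01 cE etaE.
rewrite (_ : 2 / c * (_ * _) * _ = 2 / c * delta `^ (- p) * (\sum_i max_cst p_ i) * wprod p_ p w)//.
ring.
Qed.

(* The weights are the integrals themselves; when one of them vanishes, its
   weight tends to 0 instead. *)
Lemma sqf_powR_uniform : exists2 C : R, 0 <= C & forall (f : 'I_k.+1 -> T -> R[i]) (e : R),
  (forall i, cmeasurable_fun setT (f i)) ->
  (forall i, (\int[mu]_x (cmod (f i x) `^ p_ i)%:E < +oo)%E) -> 0 < e ->
  (\int[mu]_x (SQ (window e) (ThB mu s f setT) x `^ (p / 2)) <=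
    (C * \prod_i (fine (\int[mu]_x (cmod (f i x) `^ p_ i)%:E)) `^ (p / p_ i))%:E)%E.
Proof.
have [C C0 HC] := sqf_powR_weighted.
exists (C * k.+1%:R); first by rewrite mulr_ge0.
move=> f e mfc fLp e0.
pose A i := fine (\int[mu]_x (cmod (f i x) `^ p_ i)%:E)%E.
have I0 i : (0 <= \int[mu]_x (cmod (f i x) `^ p_ i)%:E)%E.
  by apply: integral_ge0 => x _; rewrite lee_fin powR_ge0.
have A0 i : 0 <= A i by exact: fine_ge0.
have AE i : (\int[mu]_x (cmod (f i x) `^ p_ i)%:E = (A i)%:E)%E by rewrite fineK// ge0_fin_numE.
have {}HC w : (forall i, 0 < w i) -> (\int[mu]_x (SQ (window e) (ThB mu s f setT) x `^ (p / 2)) <=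
    (C * \prod_i w i `^ (p / p_ i) * \sum_i ((w i)^-1 * A i))%:E)%E.
  move=> w0; apply: (le_trans (HC f w e mfc fLp w0 e0)); rewrite [leRHS]EFinM -[in leRHS]sumEFin.
  apply: lee_wpmul2l; last by apply: lee_sum => i _; rewrite AE EFinM.
  by rewrite lee_fin mulr_ge0// prodr_ge0// => i _; exact: powR_ge0.
have [[i0 Ai0]|Apos] := pselect (exists i, A i = 0); last first.
  have A_gt0 i : 0 < A i by rewrite lt0r A0 andbT; apply/eqP => h; apply: Apos; exists i.
  apply: (le_trans (HC A A_gt0)).
  have -> : \sum_i ((A i)^-1 * A i) = k.+1%:R.
    rewrite (eq_bigr (fun=> 1)); first by rewrite sumr_const card_ord.
    by move=> i _; rewrite mulVf// gt_eqF.
  rewrite lee_fin le_eqVlt; apply/orP; left; apply/eqP.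
  by rewrite mulrAC.
rewrite [X in (_ * X)%:E](_ : _ = 0); last first.
  by rewrite (bigD1 i0)//= -/(A i0) Ai0 powR0 ?mul0r// gt_eqF// divr_gt0.
rewrite mulr0; apply/lee_addgt0Pr => r r0; rewrite add0e.
pose S := \sum_i A i.
have S0 : 0 <= S by exact: sumr_ge0.
have D0 : 0 < C * S + 1 by rewrite ltr_wpDl// mulr_ge0.
(* Only the weight of a vanishing integral changes; its term in the sum remains 0, and this choice
   makes the whole bound at most [r]. *)
pose y := (r / (C * S + 1)) `^ (p / p_ i0)^-1.
have t0 : 0 < p / p_ i0 by rewrite divr_gt0.
have y0 : 0 < y by rewrite powR_gt0// divr_gt0.
have yE : y `^ (p / p_ i0) = r / (C * S + 1).
  by rewrite -powRrM mulVf ?gt_eqF// powRr1// ltW// divr_gt0.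
pose w i := if i == i0 then y else 1.
have w0 i : 0 < w i by rewrite /w; case: ifP.
apply: (le_trans (HC w w0)); rewrite lee_fin.
have -> : \prod_i w i `^ (p / p_ i) = y `^ (p / p_ i0).
  rewrite (bigD1 i0)//= {1}/w eqxx big1 ?mulr1// => i ii0.
  by rewrite /w (negbTE ii0) powR1.
have -> : \sum_i ((w i)^-1 * A i) = S.
  apply: eq_bigr => i _; rewrite /w; case: eqP => [->|_]; first by rewrite Ai0 mulr0.
  by rewrite invr1 mul1r.
rewrite yE mulrAC mulrCA ler_piMr ?(ltW r0)// ler_pdivrMr// mul1r; lra.
Qed.

Lemma sqf_halfline_powR : exists2 C : R, 0 <= C & forall (f : 'I_k.+1 -> T -> R[i]),
  (forall i, cmeasurable_fun setT (f i)) ->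
  (forall i, (\int[mu]_x (cmod (f i x) `^ p_ i)%:E < +oo)%E) ->
  (\int[mu]_x (SQ halfline (ThB mu s f setT) x `^ (p / 2)) <=
    (C * \prod_i (fine (\int[mu]_x (cmod (f i x) `^ p_ i)%:E)) `^ (p / p_ i))%:E)%E.
Proof.
have [C C0 HC] := sqf_powR_uniform; exists C => // f mfc fLp.
have mT := cmeasurable_ThB mu ms mfc measurableT.
pose ee (N : nat) : R := N.+1%:R^-1.
have ee0 N : 0 < ee N by rewrite invr_gt0 ltr0n.
have ndw : nondecreasing_seq (fun N => window (ee N)).
  move=> N M NM; rewrite subsetEset => t /windowP/andP[h1 h2]; apply/windowP.
  have NM' : N.+1%:R <= M.+1%:R :> R by rewrite ler_nat.
  rewrite (le_trans _ h1) /ee ?lef_pV2 ?posrE ?ltr0n//=.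
  by rewrite invrK (le_trans h2)// /ee invrK.
have mw N : measurable (window (ee N) : set (measurableTypeR R)) by exact: measurable_window.
have wU : \bigcup_N window (ee N) = halfline.
  apply/seteqP; split => [t [N _]|t]; first exact: (window_pos (ee0 N)).
  rewrite /halfline/= in_itv/= andbT => t0.
  pose N := Num.truncn (t + t^-1).
  have tt : t + t^-1 < N.+1%:R by rewrite truncnS_gt.
  exists N => //; apply/windowP; rewrite /ee invrK.
  have ti : 0 < t^-1 by rewrite invr_gt0.
  apply/andP; split; last by lra.
  by rewrite invf_ple ?posrE ?ltr0n//; lra.
apply: (@le_integral_poweR_cvg _ _ _ mu (fun N => SQ (window (ee N)) (ThB mu s f setT))).
- by rewrite divr_gt0.
- by move=> N; apply: measurable_sqf => //; exact: (window_pos (ee0 N)).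
- by move=> N x; exact: sqf_ge0.
- move=> x N M NM; apply: sqf_subset => //; last exact: (window_pos (ee0 M)).
  by rewrite -subsetEset; exact: ndw.
- move=> x; rewrite /sqf -wU.
  apply: ge0_nondecreasing_set_cvg_integral => //.
  + by move=> N; apply: measurable_slice => //; exact: (window_pos (ee0 N)).
  + by move=> N t _; exact: sq_slice_ge0.
- by move=> N; exact: HC.
Qed.

End uniform_bound.

(** * Reduction to sigma-finite measures and to kernels defined for all times *)

Section sigma_finite_copy.
Context d (T : measurableType d) (R : realType) (mu : {measure set T -> \bar R}).
Hypothesis mu_sigma_finite : sigma_finite setT mu.

Definition sigma_finite_copy : set T -> \bar R := mu.

HB.instance Definition _ := Measure.copy sigma_finite_copy mu.
HB.instance Definition _ := @Measure_isSigmaFinite.Build _ _ _ sigma_finite_copy mu_sigma_finite.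

Definition sigma_finite_measure_of : {sigma_finite_measure set T -> \bar R} := sigma_finite_copy.

End sigma_finite_copy.

(** Equality as measures, and not only on sets, lets the given measure be replaced by substitution
    throughout the hypotheses. *)
Lemma sigma_finite_measureE d (T : measurableType d) (R : realType) (mu : {measure set T -> \bar R}) :
  sigma_finite setT mu ->
  exists nu : {sigma_finite_measure set T -> \bar R}, (nu : {measure set T -> \bar R}) = mu.
Proof.
move=> h; exists (sigma_finite_measure_of h).
by case: mu h => f [].
Qed.

(** The factor [n.+1] instead of [n] fits a closed sup ball into an open Euclidean one. *)
Lemma power_bounded_sup_ball {R : realType} {n : nat} (mu : {measure set (Rn R n) -> \bar R}) (m : R) :
  power_bounded mu m -> exists2 C : R, 0 <= C & forall (x : Rn R n) r, 0 < r ->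
    (mu [set y | (sup_dist x y <= r)%R] <= (C * r `^ m)%:E)%E.
Proof.
move=> [C HC]; exists (`|C| * n.+1%:R `^ m); first by rewrite mulr_ge0 ?powR_ge0.
move=> x r r0; have nr0 : 0 < n.+1%:R * r by rewrite mulr_gt0.
apply: (@le_trans _ _ (mu (eball x (n.+1%:R * r)))).
  apply: le_measure; rewrite ?inE; [exact: measurable_sup_ball|exact: measurable_eball|].
  move=> y /= xy; rewrite /eball/=; apply: (le_lt_trans (eucl_dist_le_sup x y)).
  apply: (@le_lt_trans _ _ (n%:R * r)); first by rewrite ler_wpM2l.
  by rewrite ltr_pM2r// ltr_nat.
apply: (le_trans (HC x _ nr0)); rewrite lee_fin powRM ?(ltW r0)// mulrA.
by rewrite ler_wpM2r ?powR_ge0// ler_wpM2r ?powR_ge0// ler_norm.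
Qed.

Lemma sup_ball_sigma_finite {R : realType} {n : nat} (mu : {measure set (Rn R n) -> \bar R}) :
  (forall (x : Rn R n) r, 0 < r -> (mu [set y | (sup_dist x y <= r)%R] < +oo)%E) ->
  sigma_finite setT mu.
Proof.
move=> h; exists (fun N => [set y : Rn R n | sup_dist (0 : 'rV[R]_n) y <= N.+1%:R]); last first.
  by move=> N; split; [exact: measurable_sup_ball|exact: h].
apply/seteqP; split => // y _; exists (Num.truncn (sup_dist (0 : 'rV[R]_n) y)) => //=.
by rewrite ltW// truncnS_gt.
Qed.

(* The kernel is only assumed measurable for t > 0. *)
Section extend_kernel.
Context {R : realType} {n kappa : nat}.
Variable s : R -> Rn R n -> kappa.-tuple (Rn R n) -> R[i].

Definition extend_kernel t x zs : R[i] := if 0 < t then s t x zs else 0.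

Lemma extend_kernelE t : 0 < t -> extend_kernel t = s t.
Proof. by move=> t0; apply/funext => x; apply/funext => zs; rewrite /extend_kernel t0. Qed.

Lemma cmeasurable_extend_kernel : kernel_measurable s -> cmeasurable_fun setT
  (fun q : measurableTypeR R * Rn R n * kappa.-tuple (Rn R n) => extend_kernel q.1.1 q.1.2 q.2).
Proof.
pose D := [set q : measurableTypeR R * Rn R n * kappa.-tuple (Rn R n) | 0 < q.1.1].
have mD : measurable D.
  rewrite (_ : D = setT `&` (fun q => q.1.1) @^-1` `]0, +oo[%classic).
    have : measurable_fun setT (fun q : measurableTypeR R * Rn R n * kappa.-tuple (Rn R n) => q.1.1).
      exact: (measurableT_comp measurable_fst measurable_fst).
    by apply => //; exact: measurable_itv.
  by rewrite setTI; apply/seteqP; split => q; rewrite /D /= in_itv/= andbT.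
move=> [mr mi]; split.
- move/(measurable_restrictT _ mD) : mr; congr measurable_fun; apply/funext => q.
  rewrite patchE /extend_kernel; have [h|h] := boolP (0 < q.1.1); first by rewrite mem_set.
  by rewrite memNset//; exact/negP.
- move/(measurable_restrictT _ mD) : mi; congr measurable_fun; apply/funext => q.
  rewrite patchE /extend_kernel; have [h|h] := boolP (0 < q.1.1); first by rewrite mem_set.
  by rewrite memNset//; exact/negP.
Qed.

Lemma size_extend_kernel m alpha C : size_condition m alpha C s ->
  size_condition m alpha C extend_kernel.
Proof. by move=> h t x zs t0; rewrite extend_kernelE//; exact: h. Qed.

Lemma eq_square_function (mu : {measure set (Rn R n) -> \bar R}) (m lam : R) (Th Th' : R -> Rn R n -> R[i]) :
  (forall t, 0 < t -> Th t = Th' t) -> square_function mu m lam Th = square_function mu m lam Th'.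
Proof.
move=> h; apply/funext => x; rewrite /square_function; apply: (congr1 (fun I => I `^ _)%E).
apply: eq_integral => t; rewrite inE/= in_itv/= andbT => t0.
by apply: eq_integral => y _; rewrite (h _ t0).
Qed.

Lemma weak_extend_kernel (mu : {measure set (Rn R n) -> \bar R}) m lam G A :
  weak_bounded mu m lam s G A -> weak_bounded mu m lam extend_kernel G A.
Proof.
move=> h nu; have := h nu; rewrite /gstar.
rewrite (@eq_square_function mu m lam (Theta s nu) (Theta extend_kernel nu))// => t t0.
by apply/funext => y; rewrite /Theta extend_kernelE.
Qed.

End extend_kernel.

Lemma abs_sqrt_poweR {R : realType} (u : \bar R) (p : R) : (`|u `^ 2^-1| `^ p = u `^ (p / 2))%E.
Proof. by rewrite gee0_abs ?poweR_ge0// -poweRrM (mulrC p). Qed.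

Lemma cLnormE {d} {T : measurableType d} {R : realType} (mu : {measure set T -> \bar R}) (p : R)
  (f : T -> R[i]) : cLnorm mu p f = ((\int[mu]_x (cmod (f x) `^ p)%:E) `^ p^-1)%E.
Proof.
rewrite /cLnorm unlock; apply: (congr1 (fun I => I `^ _)%E); apply: eq_integral => x _.
by rewrite gee0_abs ?lee_fin ?cmod_ge0// poweR_EFin.
Qed.

Theorem theorem2p2 (R : realType) (n : nat) (hn : (0 < n)%N) :
  exists beta0 frakC0 : R,
  forall (kappa : nat) (m lambda alpha : R) (p_ : 'I_kappa -> R) (p : R)
    (mu : {measure set (Rn R n) -> \bar R})
    (s : R -> Rn R n -> kappa.-tuple (Rn R n) -> R[i])
    (beta frakC theta : R),
  (0 < kappa)%N -> 0 < m -> (2 * kappa)%:R < lambda ->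
  0 < alpha -> alpha <= m * (lambda - (2 * kappa)%:R) ->
  (forall i, 1 < p_ i) -> p^-1 = \sum_(i < kappa) (p_ i)^-1 ->
  power_bounded mu m ->
  kernel_measurable s -> kernel_conditions m alpha s ->
  0 < beta -> beta0 < beta -> 0 < frakC -> frakC0 < frakC ->
  0 < theta -> theta < 1 ->
  (exists A : R, forall (c : Rn R n) (l : R), 0 < l ->
     doubling mu 2 beta c l -> small_boundary mu frakC c l ->
     exists G : set (Rn R n),
       [/\ measurable G, G `<=` cube c l,
           (theta%:E * mu (cube c l) <= mu G)%E
         & weak_bounded mu m lambda s G A]) ->
  exists C : R, forall f : 'I_kappa -> Rn R n -> R[i],
    (forall i, in_cLp mu (p_ i) (f i)) ->
    ('N[mu]_p%:E [gstar_mu mu m lambda s f]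
       <= C%:E * \prod_(i < kappa) cLnorm mu (p_ i) (f i))%E.
Proof.
(* Whitney cubes failing to be doubling with constant twice the overlap number
   carry at most half of the measure; 150 is the constant of
   [exists_small_boundary]. *)
exists (2 * (@overlap_cst n)%:R), 150.
move=> [//|k] m lam alpha p_ p mu s beta frakC theta _ m0 _ alpha0 alpha_le p1 pE mu_pow ms
  [Cs [size_s _ _]] _ beta_large _ frakC_large theta0 theta1 [Aw weak].
have [Cm Cm0 mu_power] := power_bounded_sup_ball mu_pow.
have [nu nuE] : exists nu : {sigma_finite_measure set (Rn R n) -> \bar R},
    (nu : {measure set (Rn R n) -> \bar R}) = mu.
  apply: sigma_finite_measureE; apply: sup_ball_sigma_finite => x r r0.
  by apply: le_lt_trans (mu_power x r r0) _; rewrite ltry.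
subst mu.
(* The constant of the kernel conditions has no assumed sign, so its absolute value replaces it. *)
have Cs0 : 0 <= `|Cs| by [].
have size_s' : size_condition m alpha `|Cs| (extend_kernel s).
  apply: size_extend_kernel => t x y t0; apply: (le_trans (size_s t x y t0)).
  rewrite ler_wpM2r ?ler_norm// divr_ge0 ?powR_ge0// /kernel_denom.
  by apply: prodr_ge0 => i _; exact: powR_ge0.
have lam_large : alpha + 2 * k.+1%:R * m <= m * lam.
  by move: alpha_le; rewrite natrM mulrBr lerBrDr (mulrC m (2 * _)).
have weak' (c : Rn R n) (l : R) : 0 < l -> doubling nu 2 beta c l -> small_boundary nu frakC c l ->
    exists G : set (Rn R n), [/\ measurable G, G `<=` cube c l,
      (theta%:E * nu (cube c l) <= nu G)%E & weak_bounded nu m lam (extend_kernel s) G Aw].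
  move=> l0 dbl sb; have [G [mG GQ tG wG]] := weak c l l0 dbl sb.
  by exists G; split; [exact: mG|exact: GQ|exact: tG|exact: weak_extend_kernel].
have [C C0 HC] := sqf_halfline_powR m0 Cm0 mu_power (cmeasurable_extend_kernel ms) Cs0 alpha0
  lam_large size_s' p1 pE hn theta0 theta1 (ltW beta_large) (ltW frakC_large) weak'.
have p0 : 0 < p by exact: (exponent_gt0 p1 pE).
have pi0 i : 0 < p_ i by rewrite (lt_trans ltr01).
exists (C `^ p^-1) => f fLp.
have mfc i : cmeasurable_fun setT (f i) := (fLp i).1.
have I_lty i : (\int[nu]_x (cmod (f i x) `^ p_ i)%:E < +oo)%E.
  by have := (fLp i).2; rewrite cLnormE => /lty_poweRy; apply; rewrite gt_eqF ?invr_gt0.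
have gE : gstar_mu nu m lam s f =
    fun x => (sqf nu m lam halfline (ThB nu (extend_kernel s) f setT) x `^ 2^-1)%E.
  rewrite -Theta_mu_ThB /gstar_mu (@eq_square_function _ _ _ _ _ _ (Theta_mu (extend_kernel s) nu f))//.
  by move=> t t0; apply/funext => y; rewrite /Theta_mu extend_kernelE.
rewrite unlock gE {gE}.
have -> : (\int[nu]_x (`|sqf nu m lam halfline (ThB nu (extend_kernel s) f setT) x `^ 2^-1| `^ p) =
    \int[nu]_x (sqf nu m lam halfline (ThB nu (extend_kernel s) f setT) x `^ (p / 2)))%E.
  by apply: eq_integral => x _; exact: abs_sqrt_poweR.
pose A i := fine (\int[nu]_x (cmod (f i x) `^ p_ i)%:E)%E.
have I0 i : (0 <= \int[nu]_x (cmod (f i x) `^ p_ i)%:E)%E.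
  by apply: integral_ge0 => x _; rewrite lee_fin powR_ge0.
have A0 i : 0 <= A i := fine_ge0 (I0 i).
have AE i : (\int[nu]_x (cmod (f i x) `^ p_ i)%:E = (A i)%:E)%E.
  by apply/esym/fineK; rewrite (ge0_fin_numE (I0 i)); exact: I_lty.
have P0 : 0 <= \prod_i A i `^ (p / p_ i) by apply: prodr_ge0 => i _; exact: powR_ge0.
have pV0 : 0 <= p^-1 by rewrite invr_ge0 ltW.
(* Taking [p]-th roots turns each exponent [p / p_ i] into [(p_ i)^-1], that is, into the norms of
   the [f i]. *)
apply: (@le_trans _ _ ((C * \prod_i A i `^ (p / p_ i))%:E `^ p^-1)%E).
  apply: gt0_ler_poweR; first exact: pV0.
  - by rewrite in_itv/= leey andbT; apply: integral_ge0 => x _; exact: poweR_ge0.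
  - by rewrite in_itv/= leey andbT lee_fin mulr_ge0.
  - exact: HC.
rewrite poweR_EFin powRM// EFinM powR_prod; last by move=> i; exact: powR_ge0.
rewrite -prodEFin le_eqVlt; apply/orP; left; apply/eqP; congr (_ * _)%E.
apply: eq_bigr => i _; rewrite cLnormE AE poweR_EFin -powRrM; congr (_ `^ _)%:E.
by rewrite mulrAC mulfV ?gt_eqF// mul1r.
Qed.
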